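(* Let $0<\sigma<1$ and $s\ge0$. Let $f$ and $g$ be Schwartz functions on $\mathbb{R}^d$ whose Fourier transforms vanish in a neighbourhood of the origin, and let $u$ be the unique Schwartz solution of $$\begin{cases}\partial_t^2u+\frac{1-2\sigma}{t}\partial_tu=\Delta u,\\ u(\cdot,0)=f,\quad\partial_t^\sigma u(\cdot,0)=g .\end{cases}$$ There is a constant $C$, independent of $t$, $f$ and $g$, such that for all $t>0$: (1) if $\sigma\le\frac12$, then $$\|u(\cdot,t)\|_{2,s}\le C\big(\|f\|_{2,s}+t^{2\sigma}\|g\|_2+\|g\|_{2,s-2\sigma}\big);$$ (2) if $\sigma\ge\frac12$, then $$\|u(\cdot,t)\|_{2,s}\le C\big((1+t)^{\sigma-\frac12}\|f\|_{2,s+\sigma-\frac12}+t^{2\sigma}\|g\|_2+t^{\sigma-\frac12}\|g\|_{2,s-\sigma-\frac12}\big).$$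
   Context: $\partial_t^\sigma=\frac{1}{2\sigma}t^{1-2\sigma}\partial_t$. For $r\in\mathbb{R}$ the Sobolev norm of a Schwartz function $h$ on $\mathbb{R}^d$ is $\|h\|_{2,r}=\big(\int_{\mathbb{R}^d}|\langle\xi\rangle^r\widehat h(\xi)|^2\,d\xi\big)^{1/2}$ with $\langle\xi\rangle=(1+|\xi|^2)^{1/2}$, and $\|\cdot\|_2$ is the $L^2(\mathbb{R}^d)$ norm. A Schwartz solution is a solution $u$ such that $(0,\infty)\to L^2(\mathbb{R}^d)$, $t\mapsto u(\cdot,t)$, is $C^2$ in norm and $u(\cdot,t)$, $\partial_tu(\cdot,t)$, $\partial_t^2u(\cdot,t)$ are Schwartz functions for every $t>0$; the initial values are limits in $L^2(\mathbb{R}^d)$ as $t\to0^+$. The unique Schwartz solution is given by $$u(\cdot,t)=\frac{\Gamma(1-\sigma)}{2^\sigma}(t\sqrt{-\Delta})^\sigma J_{-\sigma}(t\sqrt{-\Delta})f+\sigma2^\sigma\Gamma(\sigma)(t\sqrt{-\Delta})^\sigma J_\sigma(t\sqrt{-\Delta})(-\Delta)^{-\sigma}g,$$ where $J_{\pm\sigma}$ are Bessel functions of the first kind and $m(\sqrt{-\Delta})$ denotes the Fourier multiplier operator with symbol $m(|\xi|)$ (with the Fourier transform normalized so that $-\Delta$ has symbol $|\xi|^2$). *)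

(* Defs.v *)
From HB Require Import structures.
From mathcomp Require Import all_boot all_order all_algebra.
From mathcomp Require Import all_classical all_reals all_analysis.
From mathcomp Require Import complex.

Set Implicit Arguments.
Unset Strict Implicit.
Unset Printing Implicit Defensive.

Import Order.TTheory GRing.Theory Num.Theory.
Import numFieldNormedType.Exports.

Local Open Scope classical_set_scope.
Local Open Scope ring_scope.

Fact rV_display : measure_display. Proof. exact: default_measure_display. Qed.

(* The product sigma-algebra on row vectors, generated by the coordinates as
   for [n.-tuple]. *)
Section measurable_rV.
Context {R : realType} {d : nat}.

Definition rV_coord (i : 'I_d) (x : 'rV[R]_d) : measurableTypeR R := x ord0 i.

Let rV_set0 : g_sigma_preimage rV_coord set0.
Proof. exact: sigma_algebra0. Qed.

Let rV_setC A : g_sigma_preimage rV_coord A -> g_sigma_preimage rV_coord (~` A).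
Proof. exact: sigma_algebraC. Qed.

Let rV_bigcup (F : _^nat) : (forall i, g_sigma_preimage rV_coord (F i)) ->
  g_sigma_preimage rV_coord (\bigcup_i (F i)).
Proof. exact: sigma_algebra_bigcup. Qed.

HB.instance Definition _ := @isMeasurable.Build rV_display
  'rV[R]_d (g_sigma_preimage rV_coord) rV_set0 rV_setC rV_bigcup.

Lemma measurable_rV_coord (i : 'I_d) : measurable_fun [set: 'rV[R]_d] (rV_coord i).
Proof.
move=> _ Y mY; rewrite setTI; apply: sub_sigma_algebra => /=.
rewrite -bigcup_seq/=; exists i => /=; first by rewrite mem_index_enum.
by exists Y => //; rewrite setTI.
Qed.

Lemma measurable_fun_rVP d1 (T1 : measurableType d1) (f : T1 -> 'rV[R]_d) :
  measurable_fun [set: T1] f <->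
  forall i, measurable_fun [set: T1] (rV_coord i \o f).
Proof.
split=> [mf i|mf]; first by apply: measurableT_comp => //; exact: measurable_rV_coord.
apply: (@measurability _ _ _ _ _ f
  (\big[setU/set0]_(i < d) preimage_set_system setT (rV_coord i) measurable)) => //.
move=> _ [A + <-]; rewrite -bigcup_seq => -[i _ [B mB <-]].
by rewrite !setTI -comp_preimage -[X in measurable X]setTI; exact: mf.
Qed.

End measurable_rV.

Section lebesgue_rV.
Context {R : realType}.

Definition rV_cons d (p : measurableTypeR R * 'rV[R]_d) : 'rV[R]_d.+1 :=
  row_mx (const_mx p.1 : 'rV[R]_1) p.2.

Definition rV_uncons d (x : 'rV[R]_d.+1) : measurableTypeR R * 'rV[R]_d :=
  (x ord0 ord0, \row_j x ord0 (lift ord0 j)).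

Lemma rV_consK d : cancel (@rV_cons d) (@rV_uncons d).
Proof.
move=> [a v]; rewrite /rV_uncons /rV_cons /=; congr pair.
  rewrite mxE; case: splitP => [j _|k /= //]; by rewrite mxE.
apply/rowP => j; rewrite !mxE; case: splitP => [k /= |k /=].
  by rewrite ord1 /bump.
by rewrite /bump /= => -[] /val_inj ->.
Qed.

Lemma measurable_rV_cons d : measurable_fun setT (@rV_cons d).
Proof.
apply/measurable_fun_rVP => i.
case: (split_ordP (i : 'I_(1 + d))) => j ->.
  rewrite (_ : _ \o _ = fst); first exact: measurable_fst.
  by apply/funext => p; exact: (etrans (row_mxEl _ _ _ _) (mxE _ _ _ _)).
rewrite (_ : _ \o _ = rV_coord j \o snd).
  by apply: measurableT_comp; [exact: measurable_rV_coord|exact: measurable_snd].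
by apply/funext => p; exact: row_mxEr.
Qed.

Lemma measurable_rV_uncons d : measurable_fun setT (@rV_uncons d).
Proof.
apply/measurable_fun_pairP; split; first exact: (measurable_rV_coord ord0).
apply/measurable_fun_rVP => i.
rewrite (_ : _ \o _ = rV_coord (lift ord0 i)); first exact: measurable_rV_coord.
by apply/funext => p; rewrite /= /rV_coord mxE.
Qed.

Section step.
Variables (d : nat) (mu : {sigma_finite_measure set 'rV[R]_d -> \bar R}).

Definition lebesgue_rV_step : set 'rV[R]_d.+1 -> \bar R :=
  pushforward (lebesgue_measure \x mu)%E (@rV_cons d).

Let pushforward_cons : {measure set 'rV[R]_d.+1 -> \bar R} :=
  measure_function_pushforward__canonical__measure_function_Measure
    (lebesgue_measure \x mu)%E (@measurable_rV_cons d).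

HB.instance Definition _ := isMeasure.Build _ _ _ lebesgue_rV_step
  (measure0 pushforward_cons) (measure_ge0 pushforward_cons)
  (@measure_semi_sigma_additive _ _ _ pushforward_cons).

Let lebesgue_rV_step_sigma_finite : sigma_finite setT lebesgue_rV_step.
Proof.
have /sigma_finiteP[F [TF ndF Foo]] := sigma_finiteT (@lebesgue_measure R).
have /sigma_finiteP[G [TG ndG Goo]] := sigma_finiteT mu.
exists (fun n => @rV_uncons d @^-1` (F n `*` G n)).
  rewrite -preimage_bigcup -(preimage_setT (@rV_uncons d)); congr (_ @^-1` _).
  rewrite -setXTT TF TG predeqE => -[x y]; split.
    move=> [/= [n _ Fnx] [k _ Gky]]; exists (maxn n k) => //; split.
    - by move: x Fnx; exact/subsetPset/ndF/leq_maxl.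
    - by move: y Gky; exact/subsetPset/ndG/leq_maxr.
  by move=> [n _ []/= ? ?]; split; exists n.
move=> n; have [? ?] := Foo n; have [? ?] := Goo n; split.
  by rewrite -[X in measurable X]setTI; apply: measurable_rV_uncons => //; exact: measurableX.
rewrite /lebesgue_rV_step /pushforward -comp_preimage.
rewrite (_ : _ \o _ = id) ?preimage_id; last by apply/funext => p; exact: rV_consK.
by rewrite product_measure1E// lte_mul_pinfty// ge0_fin_numE.
Qed.

HB.instance Definition _ := Measure_isSigmaFinite.Build _ _ _
  lebesgue_rV_step lebesgue_rV_step_sigma_finite.
End step.

(* Lebesgue measure on R^d: the d-fold product of [lebesgue_measure]. *)
Fixpoint lebesgue_rV d : {sigma_finite_measure set 'rV[R]_d -> \bar R} :=
  match d with
  | 0 => dirac (0 : 'rV[R]_0)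
  | d'.+1 => lebesgue_rV_step (lebesgue_rV d')
  end.

End lebesgue_rV.

Section schwartz.
Context {R : realType} {d : nat}.
Local Notation C := R[i].
Implicit Types (h : 'rV[R]_d -> C) (x xi : 'rV[R]_d).

Definition dotr x xi : R := \sum_(i < d) x ord0 i * xi ord0 i.

(* The norm [`|x|] of ['rV_d] is the sup norm. *)
Definition enorm x : R := Num.sqrt (dotr x x).

Definition japanese xi : R := Num.sqrt (1 + enorm xi ^+ 2).

Definition pderiv (i : 'I_d) h x : C :=
  ('D_(delta_mx ord0 i) (fun y => complex.Re (h y)) x
   +i* 'D_(delta_mx ord0 i) (fun y => complex.Im (h y)) x)%C.

Definition pderivs (l : seq 'I_d) h : 'rV[R]_d -> C := foldr pderiv h l.

Definition laplacian h x : C := \sum_(i < d) pderivs [:: i; i] h x.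

Definition smooth h := forall (l : seq 'I_d) x,
  differentiable (fun y => complex.Re (pderivs l h y)) x /\
  differentiable (fun y => complex.Im (pderivs l h y)) x.

Definition schwartz h := smooth h /\
  forall (k : nat) (l : seq 'I_d), exists M : R,
    forall x, enorm x ^+ k * Normc.normc (pderivs l h x) <= M.

Definition integralC h : C :=
  (Rintegral (lebesgue_rV d) setT (fun x => complex.Re (h x))
   +i* Rintegral (lebesgue_rV d) setT (fun x => complex.Im (h x)))%C.

(* The unitary normalization, for which [- laplacian] has symbol
   [enorm xi ^+ 2] and [sobolev_norm 0 h = L2_norm h] for Schwartz [h]. *)
Definition fourier h xi : C :=
  ((2 * pi) `^ (- (d%:R / 2)))%:C%C *
  integralC (fun x => h x * (cos (dotr x xi) -i* sin (dotr x xi))%C).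

Definition L2_norm h : \bar R :=
  Lnorm (lebesgue_rV d) 2%:E (fun x => (Normc.normc (h x))%:E).

Definition sobolev_norm (r : R) h : \bar R :=
  Lnorm (lebesgue_rV d) 2%:E
    (fun xi => (japanese xi `^ r * Normc.normc (fourier h xi))%:E).

Definition fourier_vanishes_near0 h :=
  \forall xi \near (0 : 'rV[R]_d), fourier h xi = 0.

Definition L2_derivative (u : R -> 'rV[R]_d -> C) t h :=
  L2_norm (fun x => (e^-1)%:C%C * (u (t + e) x - u t x) - h x)
    @[e --> 0^'] --> 0%E.

(* [u1] and [u2] are the first two time derivatives of [u], taken in the norm
   of L^2; the values of [u], [u1], [u2] at times [t <= 0] are irrelevant. *)
Definition schwartz_solution (sigma : R) (f g : 'rV[R]_d -> C)
    (u : R -> 'rV[R]_d -> C) :=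
  exists u1 u2 : R -> 'rV[R]_d -> C,
  [/\ forall t, 0 < t -> [/\ schwartz (u t), schwartz (u1 t) & schwartz (u2 t)],
      forall t, 0 < t ->
        [/\ L2_derivative u t (u1 t), L2_derivative u1 t (u2 t) &
            L2_norm (fun x => u2 r x - u2 t x) @[r --> t] --> 0%E],
      forall t x, 0 < t ->
        u2 t x + ((1 - 2 * sigma) / t)%:C%C * u1 t x = laplacian (u t) x,
      L2_norm (fun x => u t x - f x) @[t --> 0^'+] --> 0%E &
      L2_norm (fun x =>
        ((2 * sigma)^-1 * t `^ (1 - 2 * sigma))%:C%C * u1 t x - g x)
        @[t --> 0^'+] --> 0%E].

End schwartz.

(* Main.v *)
Require Import Defs.
From mathcomp Require Import all_boot all_order all_algebra.
From mathcomp Require Import all_classical all_reals all_analysis.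
From mathcomp Require Import complex.
From mathcomp Require Import measurable_realfun ring lra.

Set Implicit Arguments.
Unset Strict Implicit.
Unset Printing Implicit Defensive.

Import Order.TTheory GRing.Theory Num.Theory.
Import numFieldNormedType.Exports.
Local Open Scope classical_set_scope.
Local Open Scope ring_scope.

(** The multipliers of the theorem are never written with Bessel functions.
    With k = 1 - 2 sigma, v(t) the Fourier transform of u(t) and rho = |xi|,
    the equation becomes v'' + (k/t) v' + rho^2 v = 0, with v -> fhat and
    t^k v' / (2 sigma) -> ghat at time 0, and two energies control v.

    Up to time 1/rho, the quantity |v|^2 + l^2 |p|^2, with p = t^k v' and
    l = T^(2 sigma), grows by at most a constant factor on (0,T], since
    v' = t^(-k) p and p' = - t^k rho^2 v and both t^(-k) / l and
    l rho^2 t^k have integrals bounded independently of T <= 1/rho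
    ([energy_low]).  After time 1/rho, w = t^(k/2) v satisfies
    w'' + (rho^2 + O(1/t^2)) w = 0, so that |w'|^2 + rho^2 |w|^2 is conserved
    up to a factor ([energy_high]).  Together they give
      |v(t)|^2 <= C (|fhat|^2 + t^(4 sigma) |ghat|^2)             if t rho <= 1,
      |v(t)|^2 <= C (t rho)^(2 sigma - 1) (|fhat|^2 + rho^(-4 sigma) |ghat|^2)
                                                                if t rho >= 1.

    A solution is differentiable in time only as a function with values in
    L^2, so the frequency xi cannot be fixed.  Instead the energies are
    integrated over the bands of frequencies t rho < 1 and
    2^n <= t rho < 2^(n+1), on which one energy serves all frequencies.  The
    integrals of |v|^2, v v', |v'|^2, rho^2 |v|^2 and rho^2 v v' over a band
    are differentiable functions of t that satisfy a closed system of
    differential equations ([energy_system], [ip_derive],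
    [solution_energy_system]), and this is all that the energy estimates use.
    Summing over the bands and comparing |v(t)|^2 with the Sobolev weights
    (lemmas [data_weight_le], [solution_weight_le] and
    [solution_weight_high_le]) proves both cases of the theorem at once, with
    kap = max (0, sigma - 1/2) as the loss of derivatives ([sobolev_bound]).

    Two facts on Fourier transforms are needed.  The first one is that the
    Laplacian has symbol - |xi|^2 ([fpart_laplacian]); it follows from the
    vanishing of the integral of a partial derivative ([rint_partial0]).  The
    second one is that the Fourier transform is bounded on L^2
    ([fourier_L2_le]): one inserts the weight exp(- e (|xi_1| + ... + |xi_d|))
    into the integral of |hhat|^2 and exchanges the integrals; there appears
    the Poisson kernel, which is positive and has an integral that does not
    depend on e, so that Schur's test gives a bound uniform in e
    ([plancherel_le]). *)

(** * Integration of real functions *)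

Section integ.
Context {dsp : measure_display} {T : measurableType dsp} {R : realType}.
Variable mu : {measure set T -> \bar R}.
Implicit Types f g : T -> R.

(** Integrals of real functions are real numbers here: [rint] is used with
    integrability assumptions, under which all rules are those of real numbers. *)
Definition integ f := mu.-integrable setT (EFin \o f).
Definition rint f : R := Rintegral mu setT f.

Lemma integ_meas f : integ f -> measurable_fun setT f.
Proof. by move=> /measurable_int/measurable_EFinP. Qed.

Lemma integ_dom f g : measurable_fun setT f -> integ g ->
  (forall x, `|f x| <= g x) -> integ f.
Proof.
move=> mf ig fg; apply: le_integrable ig => //; first exact/measurable_EFinP.
by move=> x _ /=; rewrite lee_fin (le_trans (fg x))// ler_norm.
Qed.

Lemma eq_integ f g : f =1 g -> integ f -> integ g.
Proof. by move=> /funext ->. Qed.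

Lemma eq_rint f g : f =1 g -> rint f = rint g.
Proof. by move=> /funext ->. Qed.

Lemma integD f g : integ f -> integ g -> integ (fun x => f x + g x).
Proof. by move=> f_ g_; have := integrableD measurableT f_ g_. Qed.

Lemma integZ a f : integ f -> integ (fun x => a * f x).
Proof. by move=> f_; have := integrableZl measurableT a f_. Qed.

Lemma integ0 : integ (fun=> 0).
Proof. exact: integrable0. Qed.

Lemma integ_sum (I : Type) (r : seq I) (F : I -> T -> R) :
  (forall i, integ (F i)) -> integ (fun x => \sum_(i <- r) F i x).
Proof.
move=> iF; elim: r => [|i r IH].
  by apply: (eq_integ _ integ0) => x; rewrite big_nil.
by apply: (eq_integ _ (integD (iF i) IH)) => x; rewrite big_cons.
Qed.

Lemma integ_norm f : integ f -> integ (fun x => `|f x|).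
Proof. exact: integrable_norm. Qed.

Lemma integ_bndM (a f : T -> R) (M : R) : measurable_fun setT a -> (forall x, `|a x| <= M) ->
  integ f -> integ (fun x => a x * f x).
Proof.
move=> ma aM f_; apply: (integ_dom (g := fun x => M * `|f x|)).
- by apply: measurable_funM => //; exact: integ_meas.
- exact/integZ/integ_norm.
- by move=> x; rewrite normrM ler_wpM2r.
Qed.

Lemma rintD f g : integ f -> integ g -> rint (fun x => f x + g x) = rint f + rint g.
Proof. by move=> f_ g_; rewrite /rint RintegralD. Qed.

Lemma rintB f g : integ f -> integ g -> rint (fun x => f x - g x) = rint f - rint g.
Proof. by move=> f_ g_; rewrite /rint RintegralB. Qed.

Lemma rintZ a f : integ f -> rint (fun x => a * f x) = a * rint f.
Proof. by move=> f_; rewrite /rint RintegralZl. Qed.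

Lemma rint0 : rint (fun=> 0) = 0.
Proof. by rewrite /rint /Rintegral integral0. Qed.

Lemma rint_sum (I : Type) (r : seq I) (F : I -> T -> R) :
  (forall i, integ (F i)) ->
  rint (fun x => \sum_(i <- r) F i x) = \sum_(i <- r) rint (F i).
Proof.
move=> iF; elim: r => [|i r IH].
  by rewrite big_nil -[RHS]rint0; apply: eq_rint => x; rewrite big_nil.
rewrite big_cons -IH -rintD//; last exact: integ_sum.
by apply: eq_rint => x; rewrite big_cons.
Qed.

Lemma rint_ge0 f : (forall x, 0 <= f x) -> 0 <= rint f.
Proof. by move=> f0; apply: Rintegral_ge0 => x _. Qed.

Lemma le_rint f g : integ f -> integ g -> (forall x, f x <= g x) -> rint f <= rint g.
Proof. by move=> f_ g_ fg; apply: le_Rintegral. Qed.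

Lemma norm_rint_le f : integ f -> `|rint f| <= rint (fun x => `|f x|).
Proof. by move=> f_; apply: le_normr_Rintegral. Qed.

Lemma rint_EFin f : integ f -> (\int[mu]_x (f x)%:E)%E = (rint f)%:E.
Proof. by move=> f_; rewrite /rint /Rintegral fineK// integrable_fin_num. Qed.

Lemma integ_ge0 f : measurable_fun setT f -> (forall x, 0 <= f x) ->
  (\int[mu]_x (f x)%:E < +oo)%E -> integ f.
Proof.
move=> mf f0 fy; apply/integrableP; split; first exact/measurable_EFinP.
by under eq_integral do rewrite /= ger0_norm//.
Qed.

Lemma rint_dominated_cvg (F : nat -> T -> R) f g :
  (forall n, measurable_fun setT (F n)) -> integ g ->
  (forall n x, `|F n x| <= g x) -> (forall x, F n x @[n --> \oo] --> f x) ->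
  rint (F n) @[n --> \oo] --> rint f.
Proof.
move=> mF ig Fg Ff.
have iF n : integ (F n) by exact: integ_dom ig (Fg n).
have mf : measurable_fun setT f by apply: measurable_fun_cvg (fun n => mF n) _ => x _; exact: Ff.
have fg x : `|f x| <= g x.
  have H : `|F n x| @[n --> \oo] --> `|f x| by exact: (cvg_norm (Ff x)).
  rewrite -(cvg_lim _ H)//; apply: limr_le; first by apply/cvg_ex; eexists; exact: H.
  exact: nearW.
have if_ : integ f by exact: integ_dom ig fg.
have : (\int[mu]_x (F n x)%:E)%E @[n --> \oo] --> (\int[mu]_x (f x)%:E)%E.
  apply: (@dominated_cvg _ _ _ mu _ measurableT _ _ (EFin \o g)) => //.
  - by move=> n; exact/measurable_EFinP.
  - by move=> x _; apply: cvg_EFin; [exact: nearW|exact: Ff].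
  - by move=> n x _ /=; rewrite lee_fin.
rewrite rint_EFin// => H.
apply: cvg_trans (fine_cvg H); apply: near_eq_cvg; near=> n.
by rewrite /= rint_EFin.
Unshelve. all: by end_near. Qed.

End integ.

Section fubini.
Context {d1 d2 : measure_display} {T1 : measurableType d1} {T2 : measurableType d2}
  {R : realType}.
Variables (m1 : {sigma_finite_measure set T1 -> \bar R})
  (m2 : {sigma_finite_measure set T2 -> \bar R}).
Implicit Type f : T1 * T2 -> R.

(** A product of integrable functions is integrable on the product space, and
    so is whatever it dominates: the form in which Tonelli's theorem is used. *)
Lemma integ_prod_dom f g h : measurable_fun setT f -> integ m1 g -> integ m2 h ->
  (forall x y, `|f (x, y)| <= g x * h y) -> integ (m1 \x m2)%E f.
Proof.
move=> mf ig ih fgh; apply/integrable12ltyP; first exact/measurable_EFinP.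
pose G x := (rint m2 (fun y => `|h y|)) * `|g x|.
have iG : integ m1 G by exact/integZ/integ_norm.
apply: (@le_lt_trans _ _ (\int[m1]_x (G x)%:E)%E); last first.
  by rewrite rint_EFin// ltry.
apply: ge0_le_integral => //.
- by move=> x _; apply: integral_ge0 => y _; rewrite lee_fin.
- apply: (measurable_fun_fubini_tonelli_F (fun p => `|(f p)%:E|)%E) => //.
  by apply: measurableT_comp => //; exact/measurable_EFinP.
- by have /measurable_EFinP := integ_meas iG.
move=> x _; rewrite /G mulrC EFinM -rint_EFin; last exact: integ_norm.
rewrite -ge0_integralZl_EFin//; last first.
  by apply/measurable_EFinP; exact: (integ_meas (integ_norm ih)).
apply: ge0_le_integral => //.
- apply/measurable_EFinP; apply: measurableT_comp => //.
  exact: (measurableT_comp mf (measurable_pair1 x)).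
- by apply/measurable_EFinP; apply: measurable_funM => //; exact: (integ_meas (integ_norm ih)).
- by move=> y _; rewrite lee_fin -normrM (le_trans (fgh _ _))// ler_norm.
Qed.

(** Every section is assumed to be integrable, not just almost every one, so
    that the inner integral is a real number everywhere. *)
Lemma rint_fubini1 f : integ (m1 \x m2)%E f ->
  (forall x, integ m2 (fun y => f (x, y))) ->
  integ m1 (fun x => rint m2 (fun y => f (x, y))) /\
  rint (m1 \x m2)%E f = rint m1 (fun x => rint m2 (fun y => f (x, y))).
Proof.
move=> if_ ifx.
have E x : fubini_F m2 (EFin \o f) x = (rint m2 (fun y => f (x, y)))%:E.
  by rewrite /fubini_F -rint_EFin.
have iF : integ m1 (fun x => rint m2 (fun y => f (x, y))).
  have := integrable_fubini_F if_; congr (_.-integrable _ _); apply/funext => x.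
  by rewrite E.
split=> //; have := integral12_prod_meas1 if_; under eq_integral do rewrite E.
by rewrite !rint_EFin// => -[].
Qed.

Lemma rint_fubini2 f : integ (m1 \x m2)%E f ->
  (forall y, integ m1 (fun x => f (x, y))) ->
  rint (m1 \x m2)%E f = rint m2 (fun y => rint m1 (fun x => f (x, y))).
Proof.
move=> if_ ifx; rewrite /rint /Rintegral -(integral21_prod_meas1 if_).
congr fine; apply: eq_integral => y _.
by rewrite -[X in _ = X%:E]/(rint m1 _) -rint_EFin.
Qed.

End fubini.

(** * Lebesgue measure on row vectors *)

Section rV_measure.
Context {R : realType}.
Local Notation mu d := (@lebesgue_rV R d).
Local Notation leb := (@lebesgue_measure R).

(** The product sigma-algebra contains the open sets: an open set is the union
    of the countably many cubes with rational centre and radius of the form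
    1/(n+1) that it contains. *)
Lemma open_measurable_rV d (U : set 'rV[R]_d) : open U -> measurable U.
Proof.
move=> oU.
pose box (q : 'rV[rat]_d) (n : nat) : set 'rV[R]_d :=
  \bigcap_i [set x | `|ratr (q ord0 i) - x ord0 i| < n.+1%:R^-1].
pose P (p : 'rV[rat]_d * nat) := box p.1 p.2 `<=` U.
pose B p := if pselect (P p) then box p.1 p.2 else set0.
have -> : U = \bigcup_p B p.
  apply/seteqP; split=> [x Ux|x [p _]]; last by rewrite /B; case: pselect => // /[apply].
  have /nbhs_ballP[e /= e0 eU] : nbhs x U by apply: open_nbhs_nbhs; split.
  have e20 : 0 < e / 2 by rewrite divr_gt0.
  have [n nlt] : exists n : nat, n.+1%:R^-1 < e / 2.
    have [n _ /(_ n (leqnn n))] := near_infty_natSinv_lt (PosNum e20).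
    by exists n.
  have /(_ _)/cid qx i : exists q : rat, `|ratr q - x ord0 i| < n.+1%:R^-1.
    have n0 : 0 < n.+1%:R^-1 :> R by rewrite invr_gt0.
    have [|q] := @rat_in_itvoo _ (x ord0 i - n.+1%:R^-1) (x ord0 i + n.+1%:R^-1).
      by rewrite ltrD2l gtrN.
    rewrite in_itv/= => /andP[q1 q2]; exists q; rewrite ltr_distl q1.
    exact: q2.
  pose q : 'rV[rat]_d := \row_i sval (qx i).
  have bx : box q n x by move=> i _; rewrite /= mxE; exact: (svalP (qx i)).
  exists (q, n) => //; rewrite /B; case: pselect => // -[] y /= by_.
  apply: eU; split=> // i j; rewrite ord1.
  have := bx j I; have := by_ j I; rewrite /= /ball/= => h1 h2.
  rewrite -(subrKA (ratr (q ord0 j))) (le_lt_trans (ler_normD _ _))//.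
  by rewrite [e]splitr ltrD// (lt_trans _ nlt)// distrC.
apply: countable_bigcupT_measurable => [|p]; first exact: countableP.
rewrite /B; case: pselect => [?|?]; last exact: measurable0.
apply: fin_bigcap_measurable => // i _.
rewrite [X in measurable X](_ : _ = (fun x => ratr (p.1 ord0 i) - rV_coord i x)
   @^-1` (ball 0 p.2.+1%:R^-1)); last first.
  by apply/seteqP; split=> x /=; rewrite /ball/= sub0r normrN.
rewrite -[X in measurable X]setTI.
apply: (measurable_funB (measurable_cst _) (measurable_rV_coord i)) => //.
exact: measurable_ball.
Qed.

Lemma continuous_measurable_rV d (f : 'rV[R]_d -> R) :
  continuous f -> measurable_fun setT f.
Proof.
move=> cf; apply: (measurability _ (RGenOpens.measurableE R)).
move=> _ [_ [a [b ->] <-]]; rewrite setTI; apply: open_measurable_rV.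
by apply: open_comp => //; exact: interval_open.
Qed.

Lemma rV_cons0 d (p : measurableTypeR R * 'rV[R]_d) : rV_cons p ord0 ord0 = p.1.
Proof. by have := congr1 fst (rV_consK p). Qed.

Lemma rV_consS d (p : measurableTypeR R * 'rV[R]_d) j :
  rV_cons p ord0 (lift ord0 j) = p.2 ord0 j.
Proof. by have := congr1 (fun q : _ * 'rV[R]_d => q.2 ord0 j) (rV_consK p); rewrite mxE. Qed.

(** The measure in dimension d+1 is the image of a product measure, so that
    Tonelli's theorem splits off the first coordinate; this is the step of all
    the inductions on the dimension. *)
Lemma ge0_integral_rVS d (f : 'rV[R]_d.+1 -> \bar R) :
  measurable_fun setT f -> (forall x, 0 <= f x)%E ->
  (\int[mu d.+1]_x f x = \int[leb]_a \int[mu d]_v f (rV_cons (a, v)))%E.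
Proof.
move=> mf f0.
rewrite (_ : \int[mu d.+1]_x f x =
  \int[pushforward (leb \x mu d)%E (@rV_cons R d)]_x f x)%E//.
rewrite ge0_integral_pushforward//; last exact: measurable_rV_cons.
rewrite preimage_setT fubini_tonelli1//; last by move=> p; exact: f0.
by apply: measurableT_comp => //; exact: measurable_rV_cons.
Qed.

Lemma integ_rVS d (f : 'rV[R]_d.+1 -> R) :
  integ (mu d.+1) f -> integ (leb \x mu d)%E (f \o @rV_cons R d).
Proof.
move=> if_; have mf := integ_meas if_.
have mfc := measurableT_comp mf (@measurable_rV_cons R d).
apply/integrableP; split; first exact/measurable_EFinP.
have /integrableP[_] := if_; congr (_ < _)%E.
rewrite ge0_integral_rVS//; last by apply: measurableT_comp => //; exact/measurable_EFinP.
rewrite [RHS]fubini_tonelli1//; apply: measurableT_comp => //; exact/measurable_EFinP.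
Qed.

Lemma rint_rVS d (f : 'rV[R]_d.+1 -> R) : integ (mu d.+1) f ->
  rint (mu d.+1) f = rint (leb \x mu d)%E (f \o @rV_cons R d).
Proof.
move=> if_; have mf := integ_meas if_.
rewrite /rint /Rintegral (_ : \int[mu d.+1]_x (f x)%:E =
  \int[pushforward (leb \x mu d)%E (@rV_cons R d)]_x (f x)%:E)%E//.
rewrite integral_pushforward//.
- exact: measurable_rV_cons.
- exact/measurable_EFinP.
- exact: integ_rVS.
Qed.

Lemma measurable_prod_coord d (phi : 'I_d -> R -> R) :
  (forall i, measurable_fun setT (phi i)) ->
  measurable_fun setT (fun x : 'rV[R]_d => \prod_i phi i (x ord0 i)).
Proof.
move=> mphi; apply: measurable_prod => i _.
by apply: (measurableT_comp (mphi i)); exact: measurable_rV_coord.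
Qed.

(** Factors depending on one coordinate each are integrated one by one. *)
Lemma integral_prod_coord_le d (phi : 'I_d -> R -> R) (M : R) :
  (forall i, measurable_fun setT (phi i)) -> (forall i x, 0 <= phi i x) ->
  (forall i, \int[leb]_x (phi i x)%:E <= M%:E)%E ->
  (\int[mu d]_x (\prod_i phi i (x ord0 i))%:E <= (M ^+ d)%:E)%E.
Proof.
elim: d phi => [|d IH] phi mphi phi0 phiM.
  rewrite /= integral_dirac//; last by apply/measurable_EFinP; exact: measurable_prod_coord.
  by rewrite diracT mul1e big_ord0 expr0.
have M0 : 0 <= M.
  by rewrite -lee_fin (le_trans _ (phiM ord0))// integral_ge0// => x _; rewrite lee_fin.
rewrite ge0_integral_rVS; last 2 first.
- by apply/measurable_EFinP; exact: measurable_prod_coord.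
- by move=> x; rewrite lee_fin prodr_ge0.
set N := M ^+ d; have N0 : 0 <= N by exact: exprn_ge0.
apply: (@le_trans _ _ (\int[leb]_a (N * phi ord0 a)%:E)%E).
  apply: ge0_le_integral => //.
  - move=> x _; apply: integral_ge0 => v _; rewrite lee_fin prodr_ge0//.
  - apply: (measurable_fun_fubini_tonelli_F (fun p =>
      (\prod_i phi i (@rV_cons R d p ord0 i))%:E)) => //.
      by apply/measurable_EFinP; exact: (measurableT_comp (measurable_prod_coord mphi) (@measurable_rV_cons R d)).
    by move=> p; rewrite lee_fin prodr_ge0.
  - by apply/measurable_EFinP; apply: measurable_funM => //; exact: mphi.
   move=> a _; under eq_integral => v _.
    rewrite big_ord_recl rV_cons0/=; under eq_bigr do rewrite rV_consS/=.
    rewrite EFinM; over.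
  rewrite ge0_integralZl_EFin//; last 2 first.
  - by move=> v _; rewrite lee_fin prodr_ge0.
  - by apply/measurable_EFinP; exact: measurable_prod_coord (fun i => mphi (lift ord0 i)).
  rewrite [N * _]mulrC EFinM; apply: lee_pmul => //; first by rewrite lee_fin.
    by apply: integral_ge0 => v _; rewrite lee_fin prodr_ge0.
  exact: (IH (fun i => phi (lift ord0 i))).
under eq_integral do rewrite EFinM.
rewrite ge0_integralZl_EFin//; last by apply/measurable_EFinP; exact: mphi.
rewrite exprSr -/N EFinM; apply: lee_wpmul2l; first by rewrite lee_fin.
exact: phiM.
by move=> x _; rewrite lee_fin.
Qed.

End rV_measure.

(** A bound that is uniform along a monotone sequence passes to the limit.
    It removes truncations of the line and convergence factors. *)
Lemma monotone_integral_le dsp (T : measurableType dsp) (R : realType)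
  (mu : {measure set T -> \bar R}) (F : nat -> T -> R) (f : T -> R) (M : \bar R) :
  (forall n, measurable_fun setT (F n)) -> (forall n x, 0 <= F n x) ->
  (forall x, {homo F^~ x : n m / (n <= m)%N >-> n <= m}) ->
  (forall x, F n x @[n --> \oo] --> f x) ->
  (forall n, \int[mu]_x (F n x)%:E <= M)%E -> (\int[mu]_x (f x)%:E <= M)%E.
Proof.
move=> mF F0 ndF Ff FM.
have lF x : limn (fun n => (F n x)%:E) = (f x)%:E.
  by apply/cvg_lim => //; apply: cvg_EFin; [exact: nearW|exact: Ff].
under eq_integral do rewrite -lF.
have H := @cvg_monotone_convergence _ _ _ mu _ measurableT (fun n => EFin \o F n).
have {}H : (\int[mu]_x (F n x)%:E)%E @[n --> \oo] -->
    (\int[mu]_x limn (fun n => (F n x)%:E))%E.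
  apply: H => //.
  - by move=> n; exact/measurable_EFinP.
  - by move=> n x _ /=; rewrite lee_fin.
  - by move=> x _ n m nm /=; rewrite lee_fin ndF.
rewrite -(cvg_lim _ H)//; apply: lime_le; first by apply/cvg_ex; eexists; exact: H.
exact: nearW.
Qed.

(** * Integrals over the real line *)

Section line.
Context {R : realType}.
Local Notation leb := (@lebesgue_measure R).
Implicit Types (F G f P Q p q : R -> R) (a c z : R).

Lemma Rintegral_itv_FTC F f (a b : R) : a < b ->
  (forall x : R, is_derive x 1 F (f x)) -> continuous f ->
  Rintegral leb `[a, b] f = F b - F a.
Proof.
move=> ab dF cf; rewrite /Rintegral (continuous_FTC2 ab (F := F))//.
- exact: continuous_subspaceT.
- have cF : continuous F.
    by move=> x; apply: differentiable_continuous; exact/derivable1_diffP/(@ex_derive _ _ _ _ _ _ _ (dF x)).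
  split.
  + by move=> x _; exact: (@ex_derive _ _ _ _ _ _ _ (dF x)).
  + exact/cvg_at_right_filter/cF.
  + exact/cvg_at_left_filter/cF.
- by move=> x _; rewrite derive1E (@derive_val _ _ _ _ _ _ _ (dF x)).
Qed.

Definition window n (x : R) : R := \1_(`[- n%:R, n%:R]%classic : set R) x.

Lemma window_cvg x : window n x @[n --> \oo] --> (1 : R).
Proof.
apply: cvg_near_cst; near=> n; rewrite /window indicE mem_set//= in_itv/= -ler_norml.
have : (Num.bound `|x| <= n)%N by near: n; exists (Num.bound `|x|).
by rewrite -(ler_nat R); apply: le_trans; exact/ltW/archi_boundP.
Unshelve. all: by end_near. Qed.

Lemma window_nd x : {homo window^~ x : n m / (n <= m)%N >-> n <= m}.
Proof.
move=> n m nm; rewrite /window !indicE.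
case: (boolP (x \in `[- n%:R, n%:R]%classic)) => [|_]; last by rewrite ler0n.
rewrite inE/= in_itv/= => /andP[h1 h2]; rewrite mem_set//= in_itv/=.
have nm' : n%:R <= m%:R :> R by rewrite ler_nat.
by rewrite (le_trans _ h1) ?lerN2// (le_trans h2).
Qed.

Lemma measurable_window n : measurable_fun setT (window n).
Proof. exact: measurable_indic. Qed.

Lemma window_ge0 n x : 0 <= window n x.
Proof. by rewrite /window indicE ler0n. Qed.

Lemma window_le1 n x : window n x <= 1.
Proof. by rewrite /window indicE lern1 leq_b1. Qed.

(** The integrand need not have one antiderivative: it may have an angle at
    the origin, as exp(-|x|) does. *)
Lemma rint_line_kink f p q P Q (lP lQ : R) : integ leb f ->
  (forall x : R, 0 <= x -> f x = p x) -> (forall x : R, x <= 0 -> f x = q x) ->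
  continuous p -> continuous q ->
  (forall x : R, is_derive x 1 P (p x)) -> (forall x : R, is_derive x 1 Q (q x)) ->
  P n%:R @[n --> \oo] --> lP -> Q (- n%:R) @[n --> \oo] --> lQ ->
  rint leb f = (lP - P 0) + (Q 0 - lQ).
Proof.
move=> if_ fp fq cp cq dP dQ PlP QlQ.
have mf := integ_meas if_.
have H : rint leb (fun x => window n x * f x) @[n --> \oo] --> rint leb f.
  apply: (@rint_dominated_cvg _ _ _ leb (fun n x => window n x * f x) f (fun x => `|f x|)).
  - by move=> n; apply: measurable_funM => //; exact: measurable_window.
  - exact: integ_norm.
  - by move=> n x; rewrite normrM ler_piMl// ger0_norm ?window_le1// window_ge0.
  - move=> x; rewrite -[X in _ --> X]mul1r; apply: cvgM; first exact: window_cvg.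
    exact: cvg_cst.
have H2 : (P n%:R - P 0) + (Q 0 - Q (- n%:R)) @[n --> \oo] --> (lP - P 0) + (Q 0 - lQ).
  by apply: cvgD; apply: cvgB => //; exact: cvg_cst.
apply/esym; apply: (cvg_unique _ H2) => //.
apply: cvg_trans H; apply: near_eq_cvg; near=> n.
have n0 : 0 < n%:R :> R by rewrite ltr0n; near: n; exists 1%N.
rewrite /= -(Rintegral_itv_FTC n0 dP cp).
rewrite -[Q 0 - _](@Rintegral_itv_FTC Q q (- n%:R) 0)// ?oppr_lt0//.
have ifD D : measurable D -> leb.-integrable D (EFin \o f).
  by move=> mD; apply: integrableS if_.
rewrite (eq_rint leb (g := f \_ `[- n%:R, n%:R])); last first.
  move=> x; rewrite /window indicE patchE.
  by case: ifPn => _; rewrite ?mul1r ?mul0r.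
rewrite /rint -Rintegral_mkcond.
rewrite (_ : Rintegral leb `[0, n%:R] p = Rintegral leb `]0, n%:R] f); last first.
  rewrite Rintegral_itv_obnd_cbnd; last exact: ifD.
  by apply: eq_Rintegral => x; rewrite inE/= in_itv/= => /andP[x0 _]; rewrite fp.
rewrite (_ : Rintegral leb `[- n%:R, 0] q = Rintegral leb `[- n%:R, 0] f); last first.
  by apply: eq_Rintegral => x; rewrite inE/= in_itv/= => /andP[_ x0]; rewrite fq.
rewrite -(@Rintegral_itvB _ _ (BLeft (- n%:R)) (BRight n%:R) 0) ?subrK//.
- exact: ifD.
- by rewrite bnd_simp oppr_le0 ltW.
- by rewrite bnd_simp ltW.
Unshelve. all: by end_near. Qed.

Lemma rint_line G F (l1 l2 : R) : integ leb G -> continuous G ->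
  (forall x : R, is_derive x 1 F (G x)) ->
  F n%:R @[n --> \oo] --> l2 -> F (- n%:R) @[n --> \oo] --> l1 ->
  rint leb G = l2 - l1.
Proof.
move=> iG cG dF Fl2 Fl1.
by rewrite (@rint_line_kink G G G F F l2 l1)// addrA subrK.
Qed.

(** By monotone convergence over the intervals [-n,n], on which the integral is
    F(n) - F(-n). *)
Lemma ge0_integral_line_le G F (B : R) : (forall x : R, 0 <= G x) -> continuous G ->
  (forall x : R, is_derive x 1 F (G x)) -> (forall x : R, `|F x| <= B) ->
  (\int[leb]_x (G x)%:E <= (2 * B)%:E)%E.
Proof.
move=> G0 cG dF FB.
have mG : measurable_fun setT G by exact: continuous_measurable_fun.
apply: (@monotone_integral_le _ _ _ leb (fun n x => window n.+1 x * G x)).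
- by move=> n; apply: measurable_funM => //; exact: measurable_window.
- by move=> n x; rewrite mulr_ge0// window_ge0.
- by move=> x n m nm; rewrite ler_wpM2r// window_nd.
- move=> x; rewrite -[X in _ --> X]mul1r; apply: cvgM; last exact: cvg_cst.
  by have := @window_cvg x; rewrite -cvg_shiftS.
move=> n; have n0 : 0 < n.+1%:R :> R by rewrite ltr0n.
have ab : - n.+1%:R < n.+1%:R :> R by rewrite (lt_trans _ n0)// oppr_lt0.
have := Rintegral_itv_FTC ab dF cG; rewrite /Rintegral => E.
have iG : leb.-integrable `[- n.+1%:R, n.+1%:R] (EFin \o G).
  apply: continuous_compact_integrable; first exact: segment_compact.
  exact: continuous_subspaceT.
rewrite (_ : (fun x => _) = (EFin \o G) \_ `[- n.+1%:R, n.+1%:R]); last first.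
  by apply/funext => x; rewrite /window indicE patchE; case: ifPn => _ /=; rewrite ?mul1r ?mul0r.
rewrite -integral_mkcond -(fineK (integrable_fin_num _ iG))// E lee_fin.
by have := FB n.+1%:R; have := FB (- n.+1%:R); rewrite !ler_norml; lra.
Qed.

Lemma is_der_cst (c x : R) : is_derive x 1 (fun _ : R => c) 0.
Proof. exact: is_derive_cst. Qed.

Lemma is_der_id (x : R) : is_derive x 1 (fun y : R => y) 1.
Proof. exact: is_derive_id. Qed.

Lemma is_derD F G (x a b : R) : is_derive x 1 F a -> is_derive x 1 G b ->
  is_derive x 1 (fun y => F y + G y) (a + b).
Proof. exact: is_deriveD. Qed.

Lemma is_derM F G (x a b : R) : is_derive x 1 F a -> is_derive x 1 G b ->
  is_derive x 1 (fun y => F y * G y) (a * G x + F x * b).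
Proof.
move=> dF dG; apply: (is_derive_eq (is_deriveM dF dG)).
by rewrite addrC /GRing.scale/= mulrC.
Qed.

Lemma is_derZ (c : R) F (x a : R) : is_derive x 1 F a ->
  is_derive x 1 (fun y => c * F y) (c * a).
Proof. by move=> dF; apply: (is_derive_eq (is_derM (is_der_cst c x) dF)); rewrite mul0r add0r. Qed.

Lemma is_der_comp F G (x a b : R) : is_derive (G x) 1 F a -> is_derive x 1 G b ->
  is_derive x 1 (fun y => F (G y)) (a * b).
Proof. exact: is_derive1_comp. Qed.

Lemma is_der_exp G (x b : R) : is_derive x 1 G b ->
  is_derive x 1 (fun y => expR (G y)) (expR (G x) * b).
Proof. by move=> dG; apply: is_der_comp. Qed.

Lemma is_der_continuous F G : (forall x : R, is_derive x 1 F (G x)) -> continuous F.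
Proof.
move=> dF x; apply: differentiable_continuous.
exact/derivable1_diffP/(@ex_derive _ _ _ _ _ _ _ (dF x)).
Qed.

Definition poisson_kernel (a z : R) : R := 2 * a / (a ^+ 2 + z ^+ 2).

Lemma poisson_kernel_ge0 a z : 0 <= a -> 0 <= poisson_kernel a z.
Proof. by move=> a0; rewrite divr_ge0 ?mulr_ge0// addr_ge0 ?sqr_ge0. Qed.

Lemma continuous_poisson_kernel a c : 0 < a -> continuous (fun y => poisson_kernel a (c - y)).
Proof.
move=> a0 y; apply: cvgM; first exact: cvg_cst.
apply: cvgV; first by rewrite gt_eqF// ltr_pwDl ?sqr_ge0// exprn_gt0.
apply: cvgD; first exact: cvg_cst.
by apply: cvgM; (apply: cvgB; [exact: cvg_cst|exact: cvg_id]).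
Qed.

Lemma integral_poisson_kernel_le a c : 0 < a ->
  (\int[leb]_y (poisson_kernel a (c - y))%:E <= (2 * pi)%:E)%E.
Proof.
move=> a0; apply: (@ge0_integral_line_le _ (fun y => 2 * atan (a^-1 * (y - c)))).
- by move=> y; exact/poisson_kernel_ge0/ltW.
- exact: continuous_poisson_kernel.
- move=> y; apply: is_derive_eq.
  rewrite /poisson_kernel /GRing.scale/=; field.
  have A : 0 < a ^+ 2 + (c - y) ^+ 2 by rewrite ltr_pwDl ?exprn_gt0 ?sqr_ge0.
  by rewrite !gt_eqF.
- move=> y; rewrite normrM ger0_norm// -ler_pdivlMl// ler_norml.
  by have := atan_ltpi2 (a^-1 * (y - c)); have := atan_gtNpi2 (a^-1 * (y - c)); lra.
Qed.

Lemma integ_poisson_kernel a c : 0 < a -> integ leb (fun y => poisson_kernel a (c - y)).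
Proof.
move=> a0; apply: integ_ge0.
- by apply: continuous_measurable_fun; exact: continuous_poisson_kernel.
- by move=> y; exact/poisson_kernel_ge0/ltW.
- by rewrite (le_lt_trans (integral_poisson_kernel_le c a0))// ltry.
Qed.

(** The convergence factor of Abel summation: integrable, tending to 1 as a
    tends to 0, and with a positive explicit Fourier transform. *)
Definition abel (a x : R) : R := expR (- (a * `|x|)).

Lemma abel_ge0 a x : 0 <= abel a x. Proof. exact: expR_ge0. Qed.

Lemma continuous_abel a : continuous (abel a).
Proof.
move=> x; apply: (@continuous_comp _ _ _ (fun x => - (a * `|x|)) expR); last exact: continuous_expR.
apply: cvgN; apply: cvgM; first exact: cvg_cst.
by apply: cvg_norm; exact: cvg_id.
Qed.

Lemma integ_abel a : 0 < a -> integ leb (abel a).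
Proof.
move=> a0.
have b0 : 0 < 2 / a by rewrite divr_gt0.
apply: (@integ_dom _ _ _ leb _ (fun x : R => a^-1 * poisson_kernel (2 / a) (0 - x))).
- by apply: continuous_measurable_fun; exact: continuous_abel.
- exact/integZ/integ_poisson_kernel.
move=> x; rewrite ger0_norm ?abel_ge0// /abel /poisson_kernel sub0r sqrrN expRN.
set t := a * `|x|.
have t0 : 0 <= t by rewrite mulr_ge0// ltW.
have : (1 + t / 2) ^+ 2 <= expR t.
  rewrite {2}(splitr t) expRD -expr2 ler_sqr ?nnegrE ?expR_ge0 ?expR_ge1Dx//; lra.
have -> : a^-1 * (2 * (2 / a) / ((2 / a) ^+ 2 + x ^+ 2)) = (1 + (t / 2) ^+ 2)^-1.
  rewrite -(real_normK (num_real x)) /t; field; rewrite !gt_eqF//; nra.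
move=> H; rewrite lef_pV2 ?posrE ?expR_gt0 ?(le_trans _ H)//; nra.
Qed.

Lemma cvg_expRN_bounded a (h : nat -> R) (M : R) : 0 < a -> (forall n, `|h n| <= M) ->
  expR (- (a * n%:R)) * h n @[n --> \oo] --> (0 : R).
Proof.
move=> a0 hM.
have e0 : expR (- (a * n%:R)) @[n --> \oo] --> (0 : R).
  under eq_cvg do rewrite mulrC -mulrN expRM_natl.
  by apply: cvg_expr; rewrite ger0_norm ?expR_ge0// expR_lt1 oppr_lt0.
have eM : expR (- (a * n%:R)) * M @[n --> \oo] --> (0 : R).
  by rewrite -[X in _ --> X](mul0r M); apply: cvgM => //; exact: cvg_cst.
have eMN : - (expR (- (a * n%:R)) * M) @[n --> \oo] --> (0 : R).
  by rewrite -[X in _ --> X]oppr0; exact: cvgN.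
apply: squeeze_cvgr eMN eM; apply: nearW => n.
by rewrite -ler_norml normrM ger0_norm ?expR_ge0// ler_wpM2l ?expR_ge0.
Qed.

Lemma measurable_abelM a G : continuous G -> measurable_fun setT (fun x => abel a x * G x).
Proof.
move=> cG; apply: continuous_measurable_fun => x.
by apply: cvgM; [exact: continuous_abel|exact: cG].
Qed.

Lemma continuous_cosM z : continuous (fun x : R => cos (z * x)).
Proof.
move=> x; apply: (@continuous_comp _ _ _ (fun x => z * x) cos); last exact: continuous_cos.
by apply: cvgM; [exact: cvg_cst|exact: cvg_id].
Qed.

Lemma continuous_sinM z : continuous (fun x : R => sin (z * x)).
Proof.
move=> x; apply: (@continuous_comp _ _ _ (fun x => z * x) sin); last exact: continuous_sin.
by apply: cvgM; [exact: cvg_cst|exact: cvg_id].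
Qed.

Lemma integ_abelM a G : 0 < a -> continuous G -> (forall x, `|G x| <= 1) ->
  integ leb (fun x => abel a x * G x).
Proof.
move=> a0 cG G1; apply: (@integ_dom _ _ _ leb _ (abel a)).
- exact: measurable_abelM.
- exact: integ_abel.
- by move=> x; rewrite normrM ger0_norm ?abel_ge0// ler_piMr ?abel_ge0.
Qed.

Lemma norm_trig_comb (x y u v : R) : `|u| <= 1 -> `|v| <= 1 -> `|x * u + y * v| <= `|x| + `|y|.
Proof. by move=> u1 v1; rewrite (le_trans (ler_normD _ _))// lerD// normrM ler_piMr. Qed.

Lemma normr_cos (x : R) : `|cos x| <= 1.
Proof. by rewrite ler_norml cos_geN1 cos_le1. Qed.

Lemma normr_sin (x : R) : `|sin x| <= 1.
Proof. by rewrite ler_norml sin_geN1 sin_le1. Qed.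

Lemma continuous_expM a : continuous (fun x : R => expR (a * x)).
Proof.
move=> x; apply: (@continuous_comp _ _ _ (fun x => a * x) expR); last exact: continuous_expR.
by apply: cvgM; [exact: cvg_cst|exact: cvg_id].
Qed.

(** The antiderivative is a combination of exp(s a x) cos(z x) and
    exp(s a x) sin(z x), with s = -1 on the right of the origin and s = 1 on
    the left.  Its coefficients solve a linear system of determinant
    a^2 + z^2. *)
Lemma abel_trig a z (u v : R) (G : R -> R) : 0 < a ->
  (forall x, G x = u * cos (z * x) + v * sin (z * x)) -> (forall x, `|G x| <= 1) ->
  rint leb (fun x => abel a x * G x) = u * poisson_kernel a z.
Proof.
move=> a0 GE G1.
have D0 : 0 < a ^+ 2 + z ^+ 2 by rewrite ltr_pwDl ?exprn_gt0 ?sqr_ge0.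
have cG : continuous G.
  rewrite (_ : G = fun x => u * cos (z * x) + v * sin (z * x)); last exact/funext.
  move=> x; apply: cvgD.
    by apply: cvgM; [exact: cvg_cst|exact: continuous_cosM].
  by apply: cvgM; [exact: cvg_cst|exact: continuous_sinM].
pose D := (a ^+ 2 + z ^+ 2)^-1.
pose H (s x : R) := (s * a * u - z * v) * cos (z * x) + (z * u + s * a * v) * sin (z * x).
pose A s x := D * (expR (s * a * x) * H s x).
have dA (s x : R) : s ^+ 2 = 1 -> is_derive x 1 (A s) (expR (s * a * x) * G x).
  move=> s1; have -> : expR (s * a * x) * G x = D * (s * a * expR (s * a * x) * H s x +
      expR (s * a * x) * ((s * a * u - z * v) * (- sin (z * x) * z) +
      (z * u + s * a * v) * (cos (z * x) * z))).
    transitivity (D * (s ^+ 2 * a ^+ 2 + z ^+ 2) * (expR (s * a * x) * G x)).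
      by rewrite s1 mul1r mulVf ?mul1r// gt_eqF.
    by rewrite GE /H; ring.
  have dM (c : R) : is_derive x 1 (fun y => c * y) c.
    by apply: (is_derive_eq (is_derZ c (is_der_id x))); rewrite mulr1.
  apply: is_derZ; apply: is_derM.
    by apply: (is_derive_eq (is_der_exp (dM (s * a)))); rewrite mulrC.
have cA s : continuous (fun x => expR (s * a * x) * G x).
  by move=> x; apply: cvgM; [exact: continuous_expM|exact: cG].
have HM s x : `|H s x| <= `|s * a * u - z * v| + `|z * u + s * a * v|.
  by apply: norm_trig_comb; [exact: normr_cos|exact: normr_sin].
have iG : integ leb (fun x => abel a x * G x) by exact: integ_abelM.
have s1 : (-1) ^+ 2 = 1 :> R by rewrite sqrrN expr1n.
have s2 : 1 ^+ 2 = 1 :> R by rewrite expr1n.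
rewrite (@rint_line_kink _ _ _ (A (-1)) (A 1) 0 0 iG _ _ (cA (-1)) (cA 1)
  (dA (-1) ^~ s1) (dA 1 ^~ s2)).
- rewrite /A /H /D /poisson_kernel !mulr0 expR0 cos0 sin0; field; exact: lt0r_neq0.
- by move=> x x0; rewrite /abel ger0_norm// mulN1r mulNr.
- by move=> x x0; rewrite /abel ler0_norm// mulrN opprK mul1r.
- rewrite -[X in _ --> X](mulr0 D); apply: cvgM; first exact: cvg_cst.
  under eq_cvg do rewrite mulN1r mulNr.
  exact: (@cvg_expRN_bounded a _ _ a0 (fun n => HM _ _)).
- rewrite -[X in _ --> X](mulr0 D); apply: cvgM; first exact: cvg_cst.
  under eq_cvg do rewrite mul1r mulrN.
  exact: (@cvg_expRN_bounded a _ _ a0 (fun n => HM _ _)).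
Qed.

Lemma rint_abel_cos a z : 0 < a ->
  rint leb (fun x => abel a x * cos (z * x)) = poisson_kernel a z.
Proof.
move=> a0; rewrite (abel_trig (G := fun x => cos (z * x)) (z := z) (u := 1) (v := 0))// ?mul1r//.
- by move=> x; rewrite mul1r mul0r addr0.
- by move=> x; exact: normr_cos.
Qed.

Lemma rint_abel_sin a z : 0 < a -> rint leb (fun x => abel a x * sin (z * x)) = 0.
Proof.
move=> a0; rewrite (abel_trig (G := fun x => sin (z * x)) (z := z) (u := 0) (v := 1))// ?mul0r//.
- by move=> x; rewrite mul1r mul0r add0r.
- by move=> x; exact: normr_sin.
Qed.

End line.

(** * The Plancherel inequality *)

Section plancherel.
Context {R : realType}.
Local Notation mu d := (@lebesgue_rV R d).
Local Notation leb := (@lebesgue_measure R).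
Implicit Types e : R.

Lemma measurable_dotr d :
  measurable_fun setT (fun p : 'rV[R]_d * 'rV[R]_d => dotr p.1 p.2).
Proof.
apply: measurable_sum => i; apply: measurable_funM.
  exact: (measurableT_comp (measurable_rV_coord i) measurable_fst).
exact: (measurableT_comp (measurable_rV_coord i) measurable_snd).
Qed.

Lemma dotrC d (x y : 'rV[R]_d) : dotr x y = dotr y x.
Proof. by apply: eq_bigr => i _; rewrite mulrC. Qed.

Lemma dotr_cons d (z : 'rV[R]_d.+1) (p : R * 'rV[R]_d) :
  dotr z (rV_cons p) = z ord0 ord0 * p.1 + dotr (rV_uncons z).2 p.2.
Proof.
rewrite /dotr big_ord_recl rV_cons0; congr (_ + _).
by apply: eq_bigr => i _; rewrite rV_consS mxE.
Qed.

(** The boolean lets one proof serve for cosines and sines. *)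
Definition trig (b : bool) (t : R) : R := if b then cos t else sin t.

Lemma trig_le1 b t : `|trig b t| <= 1.
Proof. by case: b; rewrite ler_norml ?cos_geN1 ?cos_le1 ?sin_geN1 ?sin_le1. Qed.

Lemma measurable_trig b : measurable_fun setT (trig b).
Proof. by case: b; apply: continuous_measurable_fun; [exact: continuous_cos|exact: continuous_sin]. Qed.

Lemma measurable_trig_dotr b d :
  measurable_fun setT (fun p : 'rV[R]_d * 'rV[R]_d => trig b (dotr p.1 p.2)).
Proof. exact: (measurableT_comp (measurable_trig b) (@measurable_dotr d)). Qed.

Lemma measurable_trig_dotrl b d (xi : 'rV[R]_d) :
  measurable_fun setT (fun x : 'rV[R]_d => trig b (dotr x xi)).
Proof. exact: (measurableT_comp (@measurable_trig_dotr b d) (measurable_pair2 _)). Qed.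

Lemma measurable_trig_dotrr b d (x : 'rV[R]_d) :
  measurable_fun setT (fun xi : 'rV[R]_d => trig b (dotr x xi)).
Proof. exact: (measurableT_comp (@measurable_trig_dotr b d) (measurable_pair1 _)). Qed.

Definition trig_transform (b : bool) d (a : 'rV[R]_d -> R) (xi : 'rV[R]_d) : R :=
  rint (mu d) (fun x => a x * trig b (dotr x xi)).

Lemma integ_trig b d (a : 'rV[R]_d -> R) (xi : 'rV[R]_d) : integ (mu d) a ->
  integ (mu d) (fun x => a x * trig b (dotr x xi)).
Proof.
move=> ia; apply: (eq_integ (fun x => mulrC _ _)).
by apply: (integ_bndM (M := 1)) => // [|x]; [exact: measurable_trig_dotrl|exact: trig_le1].
Qed.

Definition abel_rV d (e : R) (xi : 'rV[R]_d) : R := \prod_i abel e (xi ord0 i).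

Lemma abel_rV_ge0 d e (xi : 'rV[R]_d) : 0 <= abel_rV e xi.
Proof. by apply: prodr_ge0 => i _; exact: abel_ge0. Qed.

Lemma measurable_abel e : measurable_fun setT (@abel R e).
Proof. by apply: continuous_measurable_fun; exact: continuous_abel. Qed.

Lemma measurable_abel_rV d e : measurable_fun setT (@abel_rV d e).
Proof. by apply: (measurable_prod_coord (phi := fun=> abel e)) => i; exact: measurable_abel. Qed.

Lemma integ_abel_rV d e : 0 < e -> integ (mu d) (@abel_rV d e).
Proof.
move=> e0; apply: integ_ge0; [exact: measurable_abel_rV|exact: abel_rV_ge0|].
apply: (@le_lt_trans _ _ ((rint leb (abel e) ^+ d)%:E)); last exact: ltry.
apply: (@integral_prod_coord_le _ _ (fun=> abel e)) => [i|i x|i].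
- exact: measurable_abel.
- exact: abel_ge0.
- by rewrite (rint_EFin (integ_abel e0)).
Qed.

Lemma integ_abel_trig b d e (z : 'rV[R]_d) : 0 < e ->
  integ (mu d) (fun xi => abel_rV e xi * trig b (dotr z xi)).
Proof.
move=> e0; apply: (eq_integ (fun x => mulrC _ _)).
apply: (integ_bndM (M := 1)) => [|x|]; [exact: measurable_trig_dotrr|exact: trig_le1|exact: integ_abel_rV].
Qed.

(** The weight is a product over the coordinates and the wave obeys the
    addition formulas, so the integral factors by induction on the dimension;
    the sine integrals vanish by symmetry. *)
Lemma rint_abel_rV d e (z : 'rV[R]_d) : 0 < e ->
  rint (mu d) (fun xi => abel_rV e xi * cos (dotr z xi)) = \prod_(i < d) poisson_kernel e (z ord0 i) /\
  rint (mu d) (fun xi => abel_rV e xi * sin (dotr z xi)) = 0.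
Proof.
move=> e0; elim: d z => [|d IH] z.
  rewrite /rint /Rintegral !integral_dirac//; last 2 first.
  - by apply/measurable_EFinP; exact: (integ_meas (integ_abel_trig false z e0)).
  - by apply/measurable_EFinP; exact: (integ_meas (integ_abel_trig true z e0)).
  by rewrite !diracT !mul1e /abel_rV/= /dotr !big_ord0 cos0 sin0 !mulr1 mulr0.
have [IHc IHs] := IH (rV_uncons z).2.
have i1 b : integ leb (fun a => abel e a * trig b (z ord0 ord0 * a)).
  apply: integ_abelM => // [|x]; last exact: trig_le1.
  by case: b; [exact: continuous_cosM|exact: continuous_sinM].
have i2 b := integ_abel_trig b (rV_uncons z).2 e0.
pose f b1 b2 (p : R * 'rV[R]_d) := (abel e p.1 * trig b1 (z ord0 ord0 * p.1)) *
   (abel_rV e p.2 * trig b2 (dotr (rV_uncons z).2 p.2)).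
have if_ b1 b2 : integ (leb \x mu d)%E (f b1 b2).
  apply: (integ_prod_dom _ (integ_norm (i1 b1)) (integ_norm (i2 b2))).
    apply: measurable_funM.
      exact: (measurableT_comp (integ_meas (i1 b1)) measurable_fst).
    exact: (measurableT_comp (integ_meas (i2 b2)) measurable_snd).
  by move=> x y; rewrite normrM.
have Rf b1 b2 : rint (leb \x mu d)%E (f b1 b2) =
   rint leb (fun a => abel e a * trig b1 (z ord0 ord0 * a)) *
   rint (mu d) (fun xi => abel_rV e xi * trig b2 (dotr (rV_uncons z).2 xi)).
  have [|_ ->] := rint_fubini1 (if_ b1 b2); first by move=> x; rewrite /f/=; exact: integZ.
  rewrite mulrC -rintZ//; apply: eq_rint => x.
  by rewrite /f/= rintZ// mulrC.
have wE p : abel_rV e (rV_cons p) = abel e p.1 * abel_rV e p.2.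
  rewrite /abel_rV big_ord_recl rV_cons0; congr (_ * _).
  by apply: eq_bigr => i _; rewrite rV_consS.
split.
- rewrite rint_rVS; last exact: (integ_abel_trig true).
  transitivity (rint (leb \x mu d)%E (fun p => f true true p - f false false p)).
    by apply: eq_rint => p /=; rewrite wE dotr_cons cosD /f/=; ring.
  rewrite rintB// !Rf/= IHc IHs mulr0 subr0 rint_abel_cos// big_ord_recl.
  by congr (_ * _); apply: eq_bigr => i _; rewrite mxE.
- rewrite rint_rVS; last exact: (integ_abel_trig false).
  transitivity (rint (leb \x mu d)%E (fun p => f false true p + f true false p)).
    by apply: eq_rint => p /=; rewrite wE dotr_cons sinD /f/=; ring.
  by rewrite rintD// !Rf/= IHs mulr0 addr0 rint_abel_sin// mul0r.
Qed.

End plancherel.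

Section plancherel_inequality.
Context {R : realType}.
Local Notation mu d := (@lebesgue_rV R d).
Local Notation leb := (@lebesgue_measure R).
Implicit Types e : R.

(** The integrand Psi(xi) a(x) trig(x.xi) is dominated by |Psi(xi)| |a(x)|, so
    the two integrations may be exchanged. *)
Lemma trig_transform_mul b d (a Psi : 'rV[R]_d -> R) : integ (mu d) a -> integ (mu d) Psi ->
  integ (mu d) (fun xi => Psi xi * trig_transform b a xi) /\
  rint (mu d) (fun xi => Psi xi * trig_transform b a xi) =
  rint (mu d) (fun x => a x * trig_transform b Psi x).
Proof.
move=> ia iP.
pose f (p : 'rV[R]_d * 'rV[R]_d) := Psi p.1 * (a p.2 * trig b (dotr p.1 p.2)).
have if_ : integ (mu d \x mu d)%E f.
  apply: (integ_prod_dom _ (integ_norm iP) (integ_norm ia)).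
    apply: measurable_funM; first exact: (measurableT_comp (integ_meas iP) measurable_fst).
    apply: measurable_funM; last exact: measurable_trig_dotr.
    exact: (measurableT_comp (integ_meas ia) measurable_snd).
  move=> x y; rewrite /f/= !normrM ler_wpM2l//.
  by rewrite ler_piMr// trig_le1.
have fE1 xi : rint (mu d) (fun x => f (xi, x)) = Psi xi * trig_transform b a xi.
  rewrite /f/= rintZ/=; last first.
    by apply: eq_integ (integ_trig b xi ia) => x; rewrite dotrC.
  by congr (_ * _); apply: eq_rint => x; rewrite dotrC.
have fE2 x : rint (mu d) (fun xi => f (xi, x)) = a x * trig_transform b Psi x.
  by rewrite -rintZ; [apply: eq_rint => xi; rewrite /f/= mulrCA|exact: integ_trig].
have [|i1 r1] := rint_fubini1 if_.
  move=> xi; rewrite /f/=; apply: integZ.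
  by apply: eq_integ (integ_trig b xi ia) => x; rewrite dotrC.
have r2 := rint_fubini2 if_.
split; first by apply: eq_integ i1.
rewrite -(eq_rint _ fE1) -r1 r2 => [|x]; first exact: eq_rint.
by apply: eq_integ (integZ (a x) (integ_trig b x iP)) => xi; rewrite /f/= mulrCA.
Qed.

Lemma trig_transform_mulE b d (a Psi : 'rV[R]_d -> R) : integ (mu d) a -> integ (mu d) Psi ->
  rint (mu d) (fun xi => Psi xi * trig_transform b a xi) =
  rint (mu d) (fun x => a x * trig_transform b Psi x).
Proof. by move=> ia iP; have [] := trig_transform_mul b ia iP. Qed.

Lemma integ_trig_transformM b d (a Psi : 'rV[R]_d -> R) : integ (mu d) a -> integ (mu d) Psi ->
  integ (mu d) (fun xi => Psi xi * trig_transform b a xi).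
Proof. by move=> ia iP; have [] := trig_transform_mul b ia iP. Qed.

(** Dividing out a strictly positive integrable weight turns the
    measurability statement of Fubini's theorem into one for the transform. *)
Lemma measurable_trig_transform b d (a : 'rV[R]_d -> R) : integ (mu d) a ->
  measurable_fun setT (trig_transform b a).
Proof.
move=> ia; have iW := integ_trig_transformM b ia (integ_abel_rV d (@ltr01 R)).
rewrite (_ : trig_transform b a = fun xi => abel_rV (-1) xi * (abel_rV 1 xi * trig_transform b a xi)).
  by apply: measurable_funM; [exact: measurable_abel_rV|exact: integ_meas iW].
apply/funext => xi; rewrite mulrA -[LHS]mul1r; congr (_ * _).
rewrite /abel_rV -big_split/= big1// => i _.
by rewrite /abel -expRD mulN1r opprK mul1r subrr expR0.
Qed.

Definition poisson_rV d e (x y : 'rV[R]_d) : R := \prod_(i < d) poisson_kernel e (x ord0 i - y ord0 i).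

Lemma poisson_rV_ge0 d e (x y : 'rV[R]_d) : 0 <= e -> 0 <= poisson_rV e x y.
Proof. by move=> e0; apply: prodr_ge0 => i _; exact: poisson_kernel_ge0. Qed.

Lemma poisson_rVC d e (x y : 'rV[R]_d) : poisson_rV e x y = poisson_rV e y x.
Proof. by apply: eq_bigr => i _; rewrite /poisson_kernel -[(y _ _ - _) ^+ 2]sqrrN opprB. Qed.

Lemma measurable_poisson_kernel e : 0 < e -> measurable_fun setT (@poisson_kernel R e).
Proof.
move=> e0; apply: continuous_measurable_fun.
rewrite (_ : poisson_kernel e = fun y => poisson_kernel e (0 - y)).
  exact: continuous_poisson_kernel.
by apply/funext => y; rewrite /poisson_kernel sub0r sqrrN.
Qed.

Lemma measurable_poisson_rV d e : 0 < e ->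
  measurable_fun setT (fun p : 'rV[R]_d * 'rV[R]_d => poisson_rV e p.1 p.2).
Proof.
move=> e0; apply: measurable_prod => i _.
apply: (measurableT_comp (measurable_poisson_kernel e0)); apply: measurable_funB.
  exact: (measurableT_comp (measurable_rV_coord i) measurable_fst).
exact: (measurableT_comp (measurable_rV_coord i) measurable_snd).
Qed.

Lemma integral_poisson_rV_le d e (x : 'rV[R]_d) : 0 < e ->
  (\int[mu d]_y (poisson_rV e x y)%:E <= ((2 * pi) ^+ d)%:E)%E.
Proof.
move=> e0; apply: (integral_prod_coord_le (phi := fun i t => poisson_kernel e (x ord0 i - t))).
- by move=> i; apply: continuous_measurable_fun; exact: continuous_poisson_kernel.
- by move=> i t; exact/poisson_kernel_ge0/ltW.
- by move=> i; exact: integral_poisson_kernel_le.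
Qed.

Lemma abel_rVE d e (xi : 'rV[R]_d) : abel_rV e xi = expR (- (e * \sum_i `|xi ord0 i|)).
Proof.
rewrite mulr_sumr -sumrN (big_morph expR (id1 := 1) (op1 := *%R))//.
- exact: expRD.
- exact: expR0.
Qed.

(** Schur's test for a symmetric kernel: 2 |a(x) a(y)| <= a(x)^2 + a(y)^2, and
    each of the two terms is integrated first in the variable it is free of. *)
Lemma schur_poisson_rV d e (a : 'rV[R]_d -> R) : 0 < e -> measurable_fun setT a ->
  (\int[mu d]_x \int[mu d]_y (`|a x| * `|a y| * poisson_rV e x y)%:E <=
   ((2 * pi) ^+ d)%:E * \int[mu d]_x (a x ^+ 2)%:E)%E.
Proof.
move=> e0 ma; set C := ((2 * pi) ^+ d : R).
have C0 : 0 <= C by rewrite exprn_ge0// mulr_ge0// pi_ge0.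
pose g x := a x ^+ 2 / 2.
have g0 x : 0 <= g x by rewrite divr_ge0// sqr_ge0.
have mg : measurable_fun setT g by apply: measurable_funM => //; exact: measurable_funX.
have k0 (x y : 'rV[R]_d) : 0 <= poisson_rV e x y by exact/poisson_rV_ge0/ltW.
have mk := @measurable_poisson_rV d e e0.
have m1 : measurable_fun setT (fun p : 'rV[R]_d * 'rV[R]_d => (g p.1 * poisson_rV e p.1 p.2)%:E).
  apply/measurable_EFinP; apply: measurable_funM => //.
  exact: (measurableT_comp mg measurable_fst).
have m2 : measurable_fun setT (fun p : 'rV[R]_d * 'rV[R]_d => (g p.2 * poisson_rV e p.1 p.2)%:E).
  apply/measurable_EFinP; apply: measurable_funM => //.
  exact: (measurableT_comp mg measurable_snd).
have m3 : measurable_fun setT (fun p : 'rV[R]_d * 'rV[R]_d =>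
    (`|a p.1| * `|a p.2| * poisson_rV e p.1 p.2)%:E).
  apply/measurable_EFinP; apply: measurable_funM => //; apply: measurable_funM.
    by apply: measurableT_comp => //; exact: (measurableT_comp ma measurable_fst).
  by apply: measurableT_comp => //; exact: (measurableT_comp ma measurable_snd).
have I1 : (\int[mu d]_x \int[mu d]_y (g x * poisson_rV e x y)%:E <=
    C%:E * \int[mu d]_x (g x)%:E)%E.
  rewrite -ge0_integralZl_EFin//; last 2 first.
  - by move=> x _; rewrite lee_fin.
  - exact/measurable_EFinP.
  apply: ge0_le_integral => //.
  - by move=> x _; apply: integral_ge0 => y _; rewrite lee_fin mulr_ge0.
  - apply: (measurable_fun_fubini_tonelli_F _ m1).
    by move=> p; rewrite lee_fin mulr_ge0.
  - by apply/measurable_EFinP; exact: measurable_funM.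
  move=> x _; under eq_integral do rewrite EFinM.
  rewrite ge0_integralZl_EFin//; last 2 first.
  - by move=> y _; rewrite lee_fin.
  - apply/measurable_EFinP; exact: (measurableT_comp mk (measurable_pair1 x)).
  rewrite muleC; apply: lee_wpmul2r; first by rewrite lee_fin.
  exact: integral_poisson_rV_le.
have I2 : (\int[mu d]_x \int[mu d]_y (g y * poisson_rV e x y)%:E <=
    C%:E * \int[mu d]_x (g x)%:E)%E.
  rewrite (fubini_tonelli (m1 := mu d) (m2 := mu d) _ m2)/=; last first.
    by move=> p; rewrite lee_fin mulr_ge0.
  apply: le_trans I1; rewrite le_eqVlt; apply/orP; left; apply/eqP; apply: eq_integral => y _.
  by apply: eq_integral => x _; rewrite poisson_rVC.
have -> : (\int[mu d]_x (a x ^+ 2)%:E =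
    \int[mu d]_x (g x)%:E + \int[mu d]_x (g x)%:E)%E.
  rewrite -ge0_integralD//; try by [move=> x _; rewrite lee_fin|exact/measurable_EFinP].
  by apply: eq_integral => x _; rewrite -EFinD /g -splitr.
rewrite ge0_muleDr; try by apply: integral_ge0 => x _; rewrite lee_fin.
apply: (le_trans _ (leeD I1 I2)).
rewrite -ge0_integralD//; last 4 first.
- by move=> x _; apply: integral_ge0 => y _; rewrite lee_fin mulr_ge0.
- by apply: (measurable_fun_fubini_tonelli_F _ m1) => p; rewrite lee_fin mulr_ge0.
- by move=> x _; apply: integral_ge0 => y _; rewrite lee_fin mulr_ge0.
- by apply: (measurable_fun_fubini_tonelli_F _ m2) => p; rewrite lee_fin mulr_ge0.
have s1 x := measurableT_comp m1 (measurable_pair1 x).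
have s2 x := measurableT_comp m2 (measurable_pair1 x).
have s3 x := measurableT_comp m3 (measurable_pair1 x).
apply: ge0_le_integral => //.
- by move=> x _; apply: integral_ge0 => y _; rewrite lee_fin !mulr_ge0.
- by apply: (measurable_fun_fubini_tonelli_F _ m3) => p; rewrite lee_fin !mulr_ge0.
- apply: emeasurable_funD.
    by apply: (measurable_fun_fubini_tonelli_F _ m1) => p; rewrite lee_fin mulr_ge0.
  by apply: (measurable_fun_fubini_tonelli_F _ m2) => p; rewrite lee_fin mulr_ge0.
move=> x _; rewrite -ge0_integralD//; last 4 first.
- by move=> y _; rewrite lee_fin mulr_ge0.
- exact: s1.
- by move=> y _; rewrite lee_fin mulr_ge0.
- exact: s2.
apply: ge0_le_integral => //.
- by move=> y _; rewrite lee_fin !mulr_ge0.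
- exact: s3.
- by apply: emeasurable_funD; [exact: s1|exact: s2].
move=> y _; rewrite -EFinD lee_fin -mulrDl ler_wpM2r//.
rewrite /g -[a x ^+ 2]real_normK ?num_real// -[a y ^+ 2]real_normK ?num_real//.
by have := sqr_ge0 (`|a x| - `|a y|); nra.
Qed.

(** Exchanging the integrals twice turns the weighted integral of the squared
    transform into the quadratic form of a with kernel [poisson_rV]: the cosine
    and sine terms combine into cos((x-y).xi), whose weighted integral is
    explicit. *)
Lemma abel_plancherel d e (a : 'rV[R]_d -> R) : 0 < e -> integ (mu d) a ->
  (\int[mu d]_xi (abel_rV e xi * (trig_transform true a xi ^+ 2 + trig_transform false a xi ^+ 2))%:E <=
   ((2 * pi) ^+ d)%:E * \int[mu d]_x (a x ^+ 2)%:E)%E.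
Proof.
move=> e0 ia.
have iW b : integ (mu d) (fun xi => abel_rV e xi * trig_transform b a xi).
  by apply: integ_trig_transformM => //; exact: integ_abel_rV.
have iWF b : integ (mu d) (fun xi => abel_rV e xi * trig_transform b a xi ^+ 2).
  by apply: eq_integ (integ_trig_transformM b ia (iW b)) => xi; rewrite expr2 mulrA.
have iWx b x : integ (mu d) (fun xi => abel_rV e xi * trig b (dotr xi x)).
  by apply: eq_integ (integ_abel_trig b x e0) => xi; rewrite dotrC.
have WxE b x : trig_transform b (fun xi => abel_rV e xi * trig_transform b a xi) x =
    rint (mu d) (fun y => a y * trig_transform b (fun xi => abel_rV e xi * trig b (dotr xi x)) y).
  by rewrite -trig_transform_mulE//; apply: eq_rint => xi; rewrite mulrAC.
have iaWx b x : integ (mu d) (fun y => a y * trig_transform b (fun xi => abel_rV e xi * trig b (dotr xi x)) y).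
  exact: integ_trig_transformM.
have kE (x y : 'rV[R]_d) : trig_transform true (fun xi => abel_rV e xi * trig true (dotr xi x)) y +
    trig_transform false (fun xi => abel_rV e xi * trig false (dotr xi x)) y = poisson_rV e x y.
  rewrite /trig_transform -rintD; try exact: integ_trig.
  transitivity (rint (mu d) (fun xi => abel_rV e xi * cos (dotr (x - y) xi))).
    apply: eq_rint => xi /=; rewrite (_ : dotr (x - y) xi = dotr xi x - dotr xi y).
      by rewrite cosB; ring.
    by rewrite /dotr -sumrB; apply: eq_bigr => i _; rewrite !mxE; ring.
  have [-> _] := rint_abel_rV (x - y) e0.
  by apply: eq_bigr => i _; rewrite !mxE.
have E : rint (mu d) (fun xi => abel_rV e xi * (trig_transform true a xi ^+ 2 + trig_transform false a xi ^+ 2)) =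
    rint (mu d) (fun x => a x * rint (mu d) (fun y => a y * poisson_rV e x y)).
  transitivity (rint (mu d) (fun xi => abel_rV e xi * trig_transform true a xi ^+ 2) +
                rint (mu d) (fun xi => abel_rV e xi * trig_transform false a xi ^+ 2)).
    by rewrite -rintD//; apply: eq_rint => xi; rewrite mulrDr.
  have F b : rint (mu d) (fun xi => abel_rV e xi * trig_transform b a xi ^+ 2) =
      rint (mu d) (fun x => a x * trig_transform b (fun xi => abel_rV e xi * trig_transform b a xi) x).
    by rewrite -trig_transform_mulE//; apply: eq_rint => xi; rewrite expr2 mulrA.
  rewrite !F -rintD; try exact: integ_trig_transformM.
  apply: eq_rint => x; rewrite -mulrDr !WxE -rintD//; congr (_ * _).
  by apply: eq_rint => y; rewrite -mulrDr kE.
have iS : integ (mu d) (fun xi => abel_rV e xi * (trig_transform true a xi ^+ 2 + trig_transform false a xi ^+ 2)).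
  by apply: eq_integ (integD (iWF true) (iWF false)) => xi; rewrite mulrDr.
rewrite rint_EFin// E.
have iak x : integ (mu d) (fun y => a y * poisson_rV e x y).
  by apply: eq_integ (integD (iaWx true x) (iaWx false x)) => y; rewrite -mulrDr kE.
have iaa : integ (mu d) (fun x => a x * rint (mu d) (fun y => a y * poisson_rV e x y)).
  apply: eq_integ (integD (integ_trig_transformM true (iW true) ia) (integ_trig_transformM false (iW false) ia)) => x.
  by rewrite -mulrDr !WxE -rintD//; congr (_ * _); apply: eq_rint => y; rewrite -mulrDr kE.
apply: le_trans (schur_poisson_rV e0 (integ_meas ia)).
have k0 (x y : 'rV[R]_d) : 0 <= poisson_rV e x y by exact/poisson_rV_ge0/ltW.
apply: (@le_trans _ _ (\int[mu d]_x (`|a x * rint (mu d) (fun y => a y * poisson_rV e x y)|)%:E)%E).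
  rewrite rint_EFin; last exact: integ_norm.
  rewrite lee_fin; apply: le_rint => [||x]; [exact: iaa|exact: integ_norm|exact: ler_norm].
apply: ge0_le_integral => //.
- by apply/measurable_EFinP; exact: (integ_meas (integ_norm iaa)).
- apply: (measurable_fun_fubini_tonelli_F (fun p => (`|a p.1| * `|a p.2| * poisson_rV e p.1 p.2)%:E)).
    apply/measurable_EFinP; apply: measurable_funM; last exact: measurable_poisson_rV.
    apply: measurable_funM; apply: measurableT_comp => //.
      exact: (measurableT_comp (integ_meas ia) measurable_fst).
    exact: (measurableT_comp (integ_meas ia) measurable_snd).
  by move=> p; rewrite lee_fin !mulr_ge0.
move=> x _; rewrite rint_EFin; last first.
  apply: eq_integ (integZ `|a x| (integ_norm (iak x))) => y.
  by rewrite normrM (ger0_norm (k0 x y)) mulrA.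
rewrite lee_fin normrM; apply: (@le_trans _ _ (`|a x| * rint (mu d) (fun y => `|a y * poisson_rV e x y|))).
  by rewrite ler_wpM2l// norm_rint_le.
rewrite -rintZ; last exact: integ_norm.
rewrite le_eqVlt; apply/orP; left; apply/eqP; apply: eq_rint => y.
by rewrite normrM (ger0_norm (k0 x y)) mulrA.
Qed.

(** The bound for the weighted integral does not depend on the weight, which
    increases to 1. *)
Lemma plancherel_le d (a : 'rV[R]_d -> R) : integ (mu d) a ->
  (\int[mu d]_xi (trig_transform true a xi ^+ 2 + trig_transform false a xi ^+ 2)%:E <=
   ((2 * pi) ^+ d)%:E * \int[mu d]_x (a x ^+ 2)%:E)%E.
Proof.
move=> ia; pose e (n : nat) : R := n.+1%:R^-1.
have e0 n : 0 < e n by rewrite invr_gt0.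
apply: (@monotone_integral_le _ _ _ _ (fun n xi => abel_rV (e n) xi *
  (trig_transform true a xi ^+ 2 + trig_transform false a xi ^+ 2))).
- move=> n; apply: measurable_funM; first exact: measurable_abel_rV.
  by apply: measurable_funD; apply: measurable_funX; exact: measurable_trig_transform.
- by move=> n x; rewrite mulr_ge0 ?abel_rV_ge0// addr_ge0// sqr_ge0.
- move=> x n m nm; rewrite ler_wpM2r ?addr_ge0 ?sqr_ge0//.
  apply: ler_prod => i _; rewrite abel_ge0/= /abel ler_expR lerN2 ler_wpM2r//.
  by rewrite /e lef_pV2 ?posrE// ler_nat.
- move=> x; rewrite -[X in _ --> X]mul1r; apply: cvgM; last exact: cvg_cst.
  under eq_cvg do rewrite abel_rVE mulrC -mulNr.
  have H : e n @[n --> \oo] --> (0 : R) by exact: cvg_harmonic.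
  have cE := @continuous_expM R (- \sum_i `|x ord0 i|) 0.
  by have := cvg_comp _ _ H cE; rewrite mulr0 expR0.
by move=> n; exact: abel_plancherel.
Qed.

End plancherel_inequality.

(** * Fourier transforms of derivatives *)

Section partials.
Context {R : realType}.
Local Notation mu d := (@lebesgue_rV R d).
Local Notation leb := (@lebesgue_measure R).

(** The value is the product of 2 / (1 + x_i^2): an integrable bound for
    Schwartz functions that factors over the coordinates, as the inductions on
    the dimension require. *)
Definition envelope d (x : 'rV[R]_d) : R := \prod_i poisson_kernel 1 (x ord0 i).

Lemma envelope_ge0 d (x : 'rV[R]_d) : 0 <= envelope x.
Proof. by apply: prodr_ge0 => i _; exact: poisson_kernel_ge0. Qed.

Lemma integ_envelope d : integ (mu d) (@envelope d).
Proof.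
have E x : poisson_rV 1 0 x = @envelope d x.
  by apply: eq_bigr => i _; rewrite mxE sub0r /poisson_kernel sqrrN.
apply: integ_ge0; [|exact: envelope_ge0|].
  apply: (measurable_prod_coord (phi := fun=> poisson_kernel 1)) => i.
  exact: measurable_poisson_kernel.
under eq_integral do rewrite -E.
by rewrite (le_lt_trans (integral_poisson_rV_le 0 (@ltr01 R)))// ltry.
Qed.

Lemma envelope_cons d (p : R * 'rV[R]_d) :
  envelope (rV_cons p) = poisson_kernel 1 p.1 * envelope p.2.
Proof.
rewrite /envelope big_ord_recl rV_cons0; congr (_ * _).
by apply: eq_bigr => i _; rewrite rV_consS.
Qed.

Lemma rV_cons_shift0 d (a t : R) (v : 'rV[R]_d) :
  rV_cons (a, v) + t *: delta_mx ord0 ord0 = rV_cons (a + t, v).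
Proof.
apply/rowP => i; rewrite [LHS]mxE [X in _ + X]mxE [X in _ * X]mxE eqxx/=.
case: (unliftP ord0 i) => [j|] ->; first by rewrite !rV_consS/= mulr0 addr0.
by rewrite !rV_cons0/= mulr1.
Qed.

Lemma rV_cons_shiftS d (a t : R) (v : 'rV[R]_d) j :
  rV_cons (a, v) + t *: delta_mx ord0 (lift ord0 j) = rV_cons (a, v + t *: delta_mx ord0 j).
Proof.
apply/rowP => i; rewrite [LHS]mxE [X in _ + X]mxE [X in _ * X]mxE eqxx/=.
case: (unliftP ord0 i) => [k|] ->.
  by rewrite !rV_consS/= !mxE (inj_eq (@lift_inj _ ord0)) eqxx.
by rewrite !rV_cons0/= mulr0 addr0.
Qed.

Lemma poisson_kernel1_cvg0 (s : R) : s ^+ 2 = 1 ->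
  poisson_kernel 1 (s * n%:R) @[n --> \oo] --> (0 : R).
Proof.
move=> s1.
have H : 2 * (n.+1%:R^-1 : R) @[n --> \oo] --> (0 : R).
  by rewrite -[X in _ --> X](mulr0 2); apply: cvgM; [exact: cvg_cst|exact: cvg_harmonic].
rewrite -cvg_shiftS; apply: squeeze_cvgr (cvg_cst 0) H; apply: nearW => n.
rewrite poisson_kernel_ge0// /poisson_kernel mulr1 expr1n ler_wpM2l//.
rewrite exprMn s1 mul1r lef_pV2 ?posrE ?ltr_pwDl ?sqr_ge0//.
have : 1 <= n.+1%:R :> R by rewrite ler1n.
nra.
Qed.

(** The fundamental theorem of calculus in the variable i, the other
    variables being integrated out afterwards. *)
Lemma rint_partial0 d (i : 'I_d) (H G : 'rV[R]_d -> R) (M : R) :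
  (forall x (t : R), is_derive t 1 (fun t => H (x + t *: delta_mx ord0 i))
    (G (x + t *: delta_mx ord0 i))) ->
  (forall x, continuous (fun t : R => G (x + t *: delta_mx ord0 i))) ->
  measurable_fun setT G ->
  (forall x, `|H x| <= M * envelope x) -> (forall x, `|G x| <= M * envelope x) ->
  rint (mu d) G = 0.
Proof.
elim: d i H G M => [[]//|d IH] i H G M dH cG mG HM GM.
have iG : integ (mu d.+1) G by apply: integ_dom (integZ M (integ_envelope d.+1)) _.
have mGc := measurableT_comp mG (@measurable_rV_cons R d).
rewrite rint_rVS//.
have iGc := integ_rVS iG.
have env1 : integ leb (@poisson_kernel R 1).
  apply: eq_integ (integ_poisson_kernel 0 (@ltr01 R)) => x.
  by rewrite sub0r /poisson_kernel sqrrN.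
case: (unliftP ord0 i) => [j ij|i0].
- have sG a v t : G (rV_cons (a, v) + t *: delta_mx ord0 i) =
     G (rV_cons (a, v + t *: delta_mx ord0 j)) by rewrite ij rV_cons_shiftS.
  have mGa a : measurable_fun setT (fun v => G (rV_cons (a, v))).
    exact: (measurableT_comp mGc (measurable_pair1 a)).
  have bnd (F : 'rV[R]_d.+1 -> R) a v : (forall x, `|F x| <= M * envelope x) ->
      `|F (rV_cons (a, v))| <= (M * poisson_kernel 1 a) * envelope v.
    by move=> FM; rewrite -mulrA -(envelope_cons (a, v)); exact: FM.
  have [|_ ->] := rint_fubini1 iGc.
    move=> a; apply: (integ_dom (mGa a) (integZ _ (integ_envelope d))) => v.
    exact: bnd GM.
  rewrite -[RHS](rint0 leb); apply: eq_rint => a.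
  apply: (IH j (fun v => H (rV_cons (a, v))) _ (M * poisson_kernel 1 a)).
  + move=> v t; have := dH (rV_cons (a, v)) t; rewrite sG.
    rewrite (_ : (fun t => H (rV_cons (a, v) + t *: delta_mx ord0 i)) =
      (fun t => H (rV_cons (a, v + t *: delta_mx ord0 j))))//.
    by apply/funext => u; rewrite ij rV_cons_shiftS.
  + move=> v; have := cG (rV_cons (a, v)).
    rewrite (_ : (fun t => G (rV_cons (a, v) + t *: delta_mx ord0 i)) =
      (fun t => G (rV_cons (a, v + t *: delta_mx ord0 j))))//.
    exact/funext/sG.
  + exact: mGa.
  + by move=> v; exact: bnd HM.
  + by move=> v; exact: bnd GM.
- have bnd (F : 'rV[R]_d.+1 -> R) a v : (forall x, `|F x| <= M * envelope x) ->
      `|F (rV_cons (a, v))| <= (M * envelope v) * poisson_kernel 1 a.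
    by move=> FM; rewrite mulrAC -mulrA -(envelope_cons (a, v)); exact: FM.
  have mGv v : measurable_fun setT (fun a => G (rV_cons (a, v))).
    exact: (measurableT_comp mGc (measurable_pair2 v)).
  have iGv v : integ leb (fun a => G (rV_cons (a, v))).
    by apply: (integ_dom (mGv v) (integZ (M * envelope v) env1)) => a; exact: bnd GM.
  rewrite (rint_fubini2 iGc)//.
  rewrite -[RHS](rint0 (mu d)); apply: eq_rint => v.
  have sF (F : 'rV[R]_d.+1 -> R) : (fun t => F (rV_cons (0, v) + t *: delta_mx ord0 i)) =
      (fun t => F (rV_cons (t, v))).
    by apply/funext => t; rewrite i0 rV_cons_shift0 add0r.
  have lim0 s : s ^+ 2 = 1 -> H (rV_cons (s * n%:R, v)) @[n --> \oo] --> (0 : R).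
    move=> s1.
    have E0 : (M * envelope v) * poisson_kernel 1 (s * n%:R) @[n --> \oo] --> (0 : R).
      rewrite -[X in _ --> X](mulr0 (M * envelope v)); apply: cvgM; first exact: cvg_cst.
      exact: poisson_kernel1_cvg0.
    have E1 : - ((M * envelope v) * poisson_kernel 1 (s * n%:R)) @[n --> \oo] --> (0 : R).
      by rewrite -[X in _ --> X]oppr0; exact: cvgN.
    by apply: squeeze_cvgr E1 E0; apply: nearW => n; rewrite -ler_norml; exact: bnd HM.
  have dHv (t : R) : is_derive t 1 (fun a => H (rV_cons (a, v))) (G (rV_cons (t, v))).
    by have := dH (rV_cons (0, v)) t; rewrite sF i0 rV_cons_shift0 add0r.
  have cGv : continuous (fun a => G (rV_cons (a, v))).
    by have := cG (rV_cons (0, v)); rewrite sF.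
  have lp : H (rV_cons (n%:R, v)) @[n --> \oo] --> (0 : R).
    by have := lim0 1; rewrite expr1n => /(_ erefl); under eq_cvg do rewrite mul1r.
  have lm : H (rV_cons (- n%:R, v)) @[n --> \oo] --> (0 : R).
    by have := lim0 (-1); rewrite sqrrN expr1n => /(_ erefl); under eq_cvg do rewrite mulN1r.
  by rewrite (rint_line (iGv v) cGv dHv lp lm) subr0.
Qed.

End partials.

Section schwartz_transform.
Context {R : realType} {d : nat}.
Local Notation mu := (@lebesgue_rV R d).
Implicit Types (phi : 'rV[R]_d -> R) (h : 'rV[R]_d -> R[i]) (x xi : 'rV[R]_d).
Local Notation e_ i := (delta_mx ord0 i : 'rV[R]_d).

Lemma is_derive_line phi v x t : (forall y, differentiable phi y) ->
  is_derive (t : R) 1 (fun t => phi (x + t *: v)) ('D_v phi (x + t *: v)).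
Proof.
move=> dphi; have dv : derivable phi (x + t *: v) v by exact: diff_derivable.
have E : (fun h : R => h^-1 *: (phi (x + (h *: 1 + t) *: v) - phi (x + t *: v))) =
    (fun h : R => h^-1 *: (phi (h *: v + (x + t *: v)) - phi (x + t *: v))).
  apply/funext => h; congr (_ *: (phi _ - _)).
  by rewrite scalerDl [h *: 1]mulr1 addrCA.
split; first by rewrite /derivable E.
by rewrite /derive E.
Qed.

Lemma differentiable_measurable phi : (forall y, differentiable phi y) ->
  measurable_fun setT phi.
Proof.
by move=> dphi; apply: continuous_measurable_rV => x; exact: differentiable_continuous.
Qed.

(** What the integration by parts asks from a function and its derivative. *)
Definition tame phi := (forall y, differentiable phi y) /\
  exists M : R, forall x, `|phi x| <= M * envelope x.

Lemma tame_integ phi : tame phi -> integ mu phi.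
Proof.
move=> [dphi [M HM]]; apply: integ_dom (integZ M (integ_envelope d)) HM.
exact: differentiable_measurable.
Qed.

(** Integration by parts against a cosine or sine wave, in the form of the
    vanishing of the integral of the derivative of the product. *)
Lemma rint_partial_wave phi i xi (w w' : R -> R) : tame phi -> tame ('D_(e_ i) phi) ->
  (forall t : R, is_derive t 1 w (w' t)) -> continuous w' ->
  (forall t, `|w t| <= 1) -> (forall t, `|w' t| <= 1) ->
  rint mu (fun x => 'D_(e_ i) phi x * w (dotr x xi) + xi ord0 i * (phi x * w' (dotr x xi))) = 0.
Proof.
move=> [dp [M HM]] [dq [N HN]] dw cw' w1 w1'.
have lin x (t : R) : dotr (x + t *: e_ i) xi = dotr x xi + t * xi ord0 i.
  rewrite /dotr (bigD1 i)//= [in RHS](bigD1 i)//= !mxE !eqxx mulr1 mulrDl addrAC.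
  congr (_ + _ + _); apply: eq_bigr => j ji; rewrite !mxE (negPf ji) andbF mulr0 addr0//.
pose K := `|M| + (`|N| + `|xi ord0 i| * `|M|).
have bM x : `|phi x| <= `|M| * envelope x.
  by rewrite (le_trans (HM x))// ler_wpM2r ?envelope_ge0// ler_norm.
have bN x : `|'D_(e_ i) phi x| <= `|N| * envelope x.
  by rewrite (le_trans (HN x))// ler_wpM2r ?envelope_ge0// ler_norm.
have cw : continuous w by exact: is_der_continuous dw.
have dl x (t : R) : is_derive t 1 (fun t => dotr (x + t *: e_ i) xi) (xi ord0 i).
  rewrite (_ : (fun t => _) = (fun t => dotr x xi + xi ord0 i * t)); last first.
    by apply/funext => u; rewrite lin mulrC.
  apply: (is_derive_eq (is_derD (is_der_cst _ _) (is_derZ _ (is_der_id _)))).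
  by rewrite add0r mulr1.
have md : measurable_fun setT (fun x : 'rV[R]_d => dotr x xi).
  exact: (measurableT_comp (@measurable_dotr R d) (measurable_pair2 xi)).
apply: (@rint_partial0 _ _ i (fun x => phi x * w (dotr x xi)) _ K).
- move=> x t.
  have := is_derM (is_derive_line (e_ i) x t dp) (is_der_comp (dw _) (dl x t)).
  by move=> H; apply: (is_derive_eq H); ring.
- move=> x.
  have cl : continuous (fun t : R => dotr (x + t *: e_ i) xi) by exact: is_der_continuous (dl x).
  have cp : continuous (fun t : R => phi (x + t *: e_ i)).
    exact: (is_der_continuous (fun t => is_derive_line (e_ i) x t dp)).
  have cq : continuous (fun t : R => 'D_(e_ i) phi (x + t *: e_ i)).
    exact: (is_der_continuous (fun t => is_derive_line (e_ i) x t dq)).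
  have cwl := fun t => continuous_comp (cl t) (cw (dotr (x + t *: e_ i) xi)).
  have cwl' := fun t => continuous_comp (cl t) (cw' (dotr (x + t *: e_ i) xi)).
  move=> t; apply: cvgD; first by apply: cvgM; [exact: cq|exact: cwl].
  apply: cvgM; first exact: cvg_cst.
  by apply: cvgM; [exact: cp|exact: cwl'].
- apply: measurable_funD.
    apply: measurable_funM; first exact: differentiable_measurable.
    by apply: (measurableT_comp (continuous_measurable_fun cw) md).
  apply: measurable_funM => //; apply: measurable_funM; first exact: differentiable_measurable.
  by apply: (measurableT_comp (continuous_measurable_fun cw') md).
- move=> x; rewrite normrM (le_trans (ler_piMr _ (w1 _)))// (le_trans (bM x))//.
  rewrite ler_wpM2r ?envelope_ge0// /K lerDl addr_ge0// mulr_ge0//.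
- move=> x; rewrite (le_trans (ler_normD _ _))// /K !mulrDl.
  apply: (@le_trans _ _ (`|N| * envelope x + `|xi ord0 i| * `|M| * envelope x)); last first.
    by rewrite lerDr mulr_ge0// envelope_ge0.
  apply: lerD; first by rewrite normrM (le_trans (ler_piMr _ (w1 _))).
  rewrite normrM -mulrA ler_wpM2l// normrM (le_trans (ler_piMr _ (w1' _)))//.
Qed.

Lemma trig_transform_partial phi i xi : tame phi -> tame ('D_(e_ i) phi) ->
  trig_transform true ('D_(e_ i) phi) xi = xi ord0 i * trig_transform false phi xi /\
  trig_transform false ('D_(e_ i) phi) xi = - (xi ord0 i * trig_transform true phi xi).
Proof.
move=> tp tq; have ip := tame_integ tp; have iq := tame_integ tq.
have cN : continuous (fun t : R => - sin t) by move=> t; apply: cvgN; exact: continuous_sin.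
have sN1 (t : R) : `|- sin t| <= 1 by rewrite normrN normr_sin.
have := rint_partial_wave xi tp tq (w := cos) (w' := fun t => - sin t) _ cN (@normr_cos R) sN1.
have := rint_partial_wave xi tp tq (w := sin) (w' := cos) _ (@continuous_cos R)
  (@normr_sin R) (@normr_cos R).
rewrite rintD; [|exact: (integ_trig false)|exact/integZ/(integ_trig true)].
rewrite rintZ; last exact: (integ_trig true).
move=> /(_ (fun t => is_derive_sin t)) E1.
have NE x : (-1) * (phi x * trig false (dotr x xi)) = phi x * - sin (dotr x xi).
  by rewrite /trig; ring.
have iN := eq_integ NE (integZ (-1) (integ_trig false xi ip)).
rewrite rintD; [|exact: (integ_trig true)|exact: integZ].
rewrite rintZ// -(eq_rint mu NE) rintZ; last exact: (integ_trig false).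
move=> /(_ (fun t => is_derive_cos t)) E2.
rewrite /trig_transform /trig in E1 E2 *.
by split; lra.
Qed.

(** Two integrations by parts in the same variable turn cosines into cosines
    and sines into sines. *)
Lemma trig_transform_partial2 b phi i xi : tame phi -> tame ('D_(e_ i) phi) ->
  tame ('D_(e_ i) ('D_(e_ i) phi)) ->
  trig_transform b ('D_(e_ i) ('D_(e_ i) phi)) xi = - (xi ord0 i ^+ 2 * trig_transform b phi xi).
Proof.
move=> t0 t1 t2; have [E1 E2] := trig_transform_partial xi t0 t1.
have [F1 F2] := trig_transform_partial xi t1 t2.
by case: b; rewrite ?F1 ?F2 ?E1 ?E2; ring.
Qed.

(** Polynomial decay of every order dominates the inverse of the polynomial
    whose reciprocal is the envelope. *)
Lemma decay_envelope (g : 'rV[R]_d -> R) :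
  (forall k : nat, exists M : R, forall x, enorm x ^+ k * `|g x| <= M) ->
  exists M : R, forall x, `|g x| <= M * envelope x.
Proof.
move=> H; have [M0 H0] := H 0%N; have [M1 H1] := H (d.*2).
exists (2 ^+ d * (M0 + M1)) => x.
set q := dotr x x.
have q0 : 0 <= q by apply: sumr_ge0 => i _; rewrite -expr2 sqr_ge0.
have xq i : x ord0 i ^+ 2 <= q.
  rewrite /q /dotr (bigD1 i)//= -expr2 lerDl.
  by apply: sumr_ge0 => j _; rewrite -expr2 sqr_ge0.
have E1 : 1 <= (1 + q) ^+ d * envelope x.
  rewrite /envelope -{1}(card_ord d) -prodr_const -big_split/=.
  rewrite -[X in X <= _](big1 (R := R) (op := *%R) (index_enum 'I_d) xpredT (fun=> 1))//.
  apply: ler_prod => i _; rewrite ler01/= /poisson_kernel mulr1 expr1n mulrCA.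
  have A : 0 < 1 + x ord0 i ^+ 2 by rewrite ltr_pwDl ?sqr_ge0.
  by rewrite mulrA ler_pdivlMr// mul1r; have := xq i; nra.
have E2 : (1 + q) ^+ d <= 2 ^+ d * (1 + q ^+ d).
  have [q1|q1] := lerP q 1.
    apply: (@le_trans _ _ (2 ^+ d)); first by rewrite lerXn2r ?nnegrE//; lra.
    by rewrite ler_peMr ?exprn_ge0// lerDl exprn_ge0.
  apply: (@le_trans _ _ ((2 * q) ^+ d)); first by rewrite lerXn2r ?nnegrE//; lra.
  by rewrite exprMn ler_wpM2l ?exprn_ge0// lerDr.
have E3 : enorm x ^+ d.*2 = q ^+ d by rewrite -mul2n exprM sqr_sqrtr.
apply: (@le_trans _ _ (`|g x| * ((1 + q) ^+ d * envelope x))); first by rewrite ler_peMr.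
rewrite mulrA ler_wpM2r ?envelope_ge0//.
apply: (@le_trans _ _ (`|g x| * (2 ^+ d * (1 + q ^+ d)))); first by rewrite ler_wpM2l.
rewrite mulrCA ler_wpM2l ?exprn_ge0// mulrDr mulr1.
have := H0 x; have := H1 x; rewrite E3 expr0 mul1r; lra.
Qed.

Lemma normc_Re (z : R[i]) : `|complex.Re z| <= Normc.normc z.
Proof. by case: z => a b /=; rewrite -sqrtr_sqr ler_wsqrtr// lerDl sqr_ge0. Qed.

Lemma normc_Im (z : R[i]) : `|complex.Im z| <= Normc.normc z.
Proof. by case: z => a b /=; rewrite -sqrtr_sqr ler_wsqrtr// lerDr sqr_ge0. Qed.

Lemma schwartz_tame_Re h l : schwartz h -> tame (fun x => complex.Re (pderivs l h x)).
Proof.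
move=> [sh dh]; split=> [y|]; first by have [] := sh l y.
apply: decay_envelope => k; have [M HM] := dh k l; exists M => x.
apply: le_trans (HM x); rewrite ler_wpM2l ?normc_Re//.
by rewrite exprn_ge0// sqrtr_ge0.
Qed.

Lemma schwartz_tame_Im h l : schwartz h -> tame (fun x => complex.Im (pderivs l h x)).
Proof.
move=> [sh dh]; split=> [y|]; first by have [] := sh l y.
apply: decay_envelope => k; have [M HM] := dh k l; exists M => x.
apply: le_trans (HM x); rewrite ler_wpM2l ?normc_Im//.
by rewrite exprn_ge0// sqrtr_ge0.
Qed.

End schwartz_transform.

(** * Energy estimates *)

Section energy.
Context {R : realType}.

(** The product E exp(- Phi) is non-increasing. *)
Lemma gronwall (E E' Phi phi : R -> R) :
  (forall t : R, 0 < t -> is_derive t 1 E (E' t)) ->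
  (forall t : R, 0 < t -> is_derive t 1 Phi (phi t)) ->
  (forall t : R, 0 < t -> E' t <= phi t * E t) ->
  forall s t : R, 0 < s -> s <= t -> E t * expR (- Phi t) <= E s * expR (- Phi s).
Proof.
move=> dE dP le_E s t s0 st.
have dF (u : R) : 0 < u -> is_derive u 1 (fun u => E u * expR (- Phi u))
    ((E' u - phi u * E u) * expR (- Phi u)).
  move=> u0; have dN : is_derive u 1 (fun u => - Phi u) (- phi u).
    by apply: is_deriveN; exact: dP.
  apply: (is_derive_eq (is_derM (dE u u0) (is_der_exp dN))); ring.
have t0 : 0 < t by exact: lt_le_trans st.
have := @ler0_derive1_le_oo R (fun u => E u * expR (- Phi u)) 0 (t + 1).
apply => //; last 2 first.
- by rewrite in_itv/= t0/=; lra.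
- by rewrite in_itv/= s0/=; lra.
- by move=> u; rewrite in_itv/= => /andP[u0 _]; have := dF u u0 => -[].
- move=> u; rewrite in_itv/= => /andP[u0 _].
  rewrite derive1E (@derive_val _ _ _ _ _ _ _ (dF u u0)).
  by rewrite mulr_le0_ge0 ?expR_ge0// subr_le0 le_E.
- move=> u; rewrite inE/= in_itv/= => /andP[u0 _].
  apply: differentiable_continuous.
  exact/derivable1_diffP/(@ex_derive _ _ _ _ _ _ _ (dF u u0)).
Qed.

Lemma powR_subr1 (t a : R) : 0 < t -> t `^ (a - 1) = t `^ a / t.
Proof.
move=> t0; rewrite powRD; first by rewrite powR_inv1// ltW.
by rewrite (gt_eqF t0) implybT.
Qed.

(** The scalar quantities attached to a solution of
    v'' + (k/t) v' + m v = 0 in an inner product space: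
    N00 = <v,v>, N01 = <v,v'>, N11 = <v',v'>, M00 = <mv,v>, M01 = <mv,v'>. *)
Record energy_system (k : R) (N00 N01 N11 M00 M01 : R -> R) : Prop := EnergySystem {
  es_dN00 : forall t : R, 0 < t -> is_derive t 1 N00 (2 * N01 t);
  es_dN01 : forall t : R, 0 < t -> is_derive t 1 N01 (N11 t - k / t * N01 t - M00 t);
  es_dN11 : forall t : R, 0 < t -> is_derive t 1 N11 (- (2 * (k / t)) * N11 t - 2 * M01 t);
  es_dM00 : forall t : R, 0 < t -> is_derive t 1 M00 (2 * M01 t);
  es_psd : forall t a b : R, 0 < t ->
    0 <= a ^+ 2 * N00 t + 2 * a * b * N01 t + b ^+ 2 * N11 t }.

Variables (k : R) (N00 N01 N11 M00 M01 : R -> R).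
Hypothesis k1 : -1 < k < 1.
Hypothesis es : energy_system k N00 N01 N11 M00 M01.

Let N00_ge0 (t : R) : 0 < t -> 0 <= N00 t.
Proof. by move=> t0; have := es_psd es 1 0 t0; lra. Qed.

Let N11_ge0 (t : R) : 0 < t -> 0 <= N11 t.
Proof. by move=> t0; have := es_psd es 0 1 t0; lra. Qed.

Let dpow (t : R) : 0 < t -> is_derive t 1 (fun t : R => t `^ k) (k * (t `^ k / t)).
Proof. by move=> t0; apply: is_derive_eq (is_derive1_powR k t0) _; rewrite powR_subr1. Qed.

(** The integral over (0,T] of the growth rate t^(-k)/l + l t^k/T^2 of the low
    frequency energy, where l = T^(1-k). *)
Definition low_const : R := (1 - k)^-1 + (1 + k)^-1.

(** Below frequency 1/T: the energy <v,v> + l^2 <p,p> with p = t^k v' and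
    l = T^(1-k) grows at most by a constant factor up to time T, because
    v' = t^(-k) p and p' = - t^k m v have integrable coefficients at 0. *)
Lemma energy_low (T F G : R) : 0 < T ->
  (forall t b : R, 0 < t -> 2 * b * M01 t <= T ^- 2 * (N00 t + b ^+ 2 * N11 t)) ->
  (forall eps : R, 0 < eps -> exists s : R,
    [/\ 0 < s, s <= T, N00 s <= F + eps & (s `^ k) ^+ 2 * N11 s <= G + eps]) ->
  N00 T + T ^+ 2 * N11 T <= expR low_const * (F + (T `^ (1 - k)) ^+ 2 * G).
Proof.
move=> T0 HM init; set l := T `^ (1 - k).
have l0 : 0 < l by exact: powR_gt0.
have p0 (t : R) : 0 < t -> 0 < t `^ k by exact: powR_gt0.
pose E t := N00 t + l ^+ 2 * ((t `^ k) ^+ 2 * N11 t).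
pose Phi t := l^-1 * (1 - k)^-1 * t `^ (1 - k) + l * T ^- 2 * (1 + k)^-1 * t `^ (1 + k).
have /andP[kN kP] := k1.
have dE (t : R) : 0 < t -> is_derive t 1 E (2 * N01 t - 2 * l ^+ 2 * (t `^ k) ^+ 2 * M01 t).
  move=> t0; have dp := dpow t0.
  have d1 := is_derD (es_dN00 es t0) (is_derZ (l ^+ 2) (is_derM (is_derM dp dp) (es_dN11 es t0))).
  apply: (is_derive_eq d1).
  by field; rewrite gt_eqF.
have dPhi (t : R) : 0 < t -> is_derive t 1 Phi (l^-1 * (t `^ k)^-1 + l * T ^- 2 * t `^ k).
  move=> t0.
  have d1 := is_derD (is_derZ (l^-1 * (1 - k)^-1) (is_derive1_powR (1 - k) t0))
    (is_derZ (l * T ^- 2 * (1 + k)^-1) (is_derive1_powR (1 + k) t0)).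
  apply: (is_derive_eq d1).
  have -> : 1 - k - 1 = - k by ring.
  have -> : 1 + k - 1 = k by ring.
  rewrite powRN; set p := t `^ k; have pp : 0 < p by exact: p0.
  have kP0 : 0 < 1 + k by lra.
  have kN0 : 0 < 1 - k by lra.
  by field; rewrite !gt_eqF.
have leE (t : R) : 0 < t -> 2 * N01 t - 2 * l ^+ 2 * (t `^ k) ^+ 2 * M01 t <=
    (l^-1 * (t `^ k)^-1 + l * T ^- 2 * t `^ k) * E t.
  move=> t0; set p := t `^ k; have pp : 0 < p by exact: p0.
  have lp : 0 < l * p by rewrite mulr_gt0.
  rewrite [X in _ <= X]mulrDl; apply: lerD.
    rewrite -invfM ler_pdivlMl// /E -/p.
    by have := es_psd es 1 (- (l * p)) t0; nra.
  have := HM t (- (l * p)) t0; rewrite /E -/p => H.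
  rewrite (_ : - _ = l * p * (2 * - (l * p) * M01 t)); last by ring.
  rewrite (_ : _ * (N00 t + _) = l * p * (T ^- 2 * (N00 t + (- (l * p)) ^+ 2 * N11 t))); last by ring.
  by rewrite ler_wpM2l// ltW.
have PhiT : Phi T = low_const.
  rewrite /Phi /low_const -/l (_ : T `^ (1 + k) = T ^+ 2 / l); last first.
    rewrite /l -powRN -powR_mulrn ?ltW// -powRD; first by congr (_ `^ _); ring.
    by rewrite (gt_eqF T0) implybT.
  by field; rewrite !gt_eqF//; lra.
have Phi0 (t : R) : 0 < t -> 0 <= Phi t.
  move=> t0; rewrite /Phi addr_ge0// !mulr_ge0 ?powR_ge0 ?invr_ge0 ?exprn_ge0 ?ltW//; lra.
have ET : E T = N00 T + T ^+ 2 * N11 T.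
  rewrite /E mulrA -exprMn (_ : l * T `^ k = T)//.
  rewrite /l -powRD; first by rewrite subrK powRr1// ltW.
  by rewrite (gt_eqF T0) implybT.
rewrite -ET -ler_pdivrMl ?expR_gt0// -expRN -PhiT mulrC.
apply/ler_addgt0Pr => eps eps0.
have D0 : 0 < 1 + l ^+ 2 by rewrite ltr_pwDl// sqr_ge0.
have [s [s0 sT HN00 HN11]] := init (eps / (1 + l ^+ 2)) (divr_gt0 eps0 D0).
apply: (le_trans (gronwall dE dPhi leE s0 sT)).
have E0 : 0 <= E s.
  by rewrite /E addr_ge0 ?N00_ge0// mulr_ge0 ?sqr_ge0// mulr_ge0 ?sqr_ge0 ?N11_ge0.
apply: (@le_trans _ _ (E s)).
  by rewrite ler_piMr// expR_le1 oppr_le0 Phi0.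
rewrite /E (_ : eps = eps / (1 + l ^+ 2) + l ^+ 2 * (eps / (1 + l ^+ 2))); last first.
  by field; rewrite gt_eqF.
rewrite addrACA -mulrDr; apply: lerD => //.
by rewrite ler_wpM2l// sqr_ge0.
Qed.

(** Above frequency r: w = t^(k/2) v satisfies w'' + (m + O(1/t^2)) w = 0, so
    that the energy <w',w'> + <mw,w> changes by at most a constant factor after
    time 1/(2r). *)
Lemma energy_high (r t : R) : 0 < r -> (2 * r)^-1 <= t ->
  (forall t, 0 < t -> r ^+ 2 * N00 t <= M00 t <= (2 * r) ^+ 2 * N00 t) ->
  t `^ k * N00 t <= 8 * expR (3 / 2) * (((2 * r)^-1) `^ k *
    (N00 (2 * r)^-1 + (2 * r)^-1 ^+ 2 * N11 (2 * r)^-1)).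
Proof.
move=> r0 T0t HM; set T0 := (2 * r)^-1.
have T00 : 0 < T0 by rewrite invr_gt0 mulr_gt0.
have t0 : 0 < t by exact: lt_le_trans T0t.
have /andP[kN kP] := k1.
pose Z t := N11 t + k / t * N01 t + k ^+ 2 / (4 * t ^+ 2) * N00 t.
pose H t := t `^ k * (N11 t + (k * (t^-1 * N01 t) + (k ^+ 2 / 4 * (t^-1 * (t^-1 * N00 t)) + M00 t))).
pose V t := N01 t + k / (2 * t) * N00 t.
have HE (u : R) : 0 < u -> H u = u `^ k * (Z u + M00 u).
  by move=> u0; rewrite /H /Z; field; rewrite gt_eqF.
have dinv (u : R) : 0 < u -> is_derive u 1 (fun u : R => u^-1) (- (u ^- 2)).
  move=> u0; have un0 : u != 0 by rewrite gt_eqF.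
  apply: (is_derive_eq (@is_deriveV _ (fun x : R => x) u 1 1 un0 (is_der_id u))).
  by rewrite /GRing.scale/= mulr1.
have dH (u : R) : 0 < u -> is_derive u 1 H (u `^ k * (k * (k - 2) / 2 * u ^- 2) * V u).
  move=> u0; have di := dinv u u0.
  have d1 := is_derM (dpow u0) (is_derD (es_dN11 es u0)
    (is_derD (is_derZ k (is_derM di (es_dN01 es u0)))
    (is_derD (is_derZ (k ^+ 2 / 4) (is_derM di (is_derM di (es_dN00 es u0)))) (es_dM00 es u0)))).
  by apply: (is_derive_eq d1); rewrite /V; field; rewrite gt_eqF.
have dPhi (u : R) : 0 < u -> is_derive u 1 (fun u => - (3 / (4 * r) * u^-1)) (3 / (4 * r) * u ^- 2).
  move=> u0; have d1 : is_derive u 1 (fun u => - (3 / (4 * r) * u^-1)) (- (3 / (4 * r) * - (u ^- 2))).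
    by apply: is_deriveN; apply: is_derZ; exact: dinv.
  by apply: (is_derive_eq d1); rewrite mulrN opprK.
have psdV (u : R) : 0 < u -> 2 * r * `|V u| <= M00 u + Z u.
  move=> u0; have /andP[HM1 _] := HM u u0.
  have h1 := es_psd es (k / (2 * u) + r) 1 u0.
  have h2 := es_psd es (k / (2 * u) - r) 1 u0.
  have E1 : (k / (2 * u) + r) ^+ 2 * N00 u + 2 * (k / (2 * u) + r) * 1 * N01 u + 1 ^+ 2 * N11 u
    = Z u + 2 * r * V u + r ^+ 2 * N00 u by rewrite /Z /V; field; rewrite gt_eqF.
  have E2 : (k / (2 * u) - r) ^+ 2 * N00 u + 2 * (k / (2 * u) - r) * 1 * N01 u + 1 ^+ 2 * N11 u
    = Z u - 2 * r * V u + r ^+ 2 * N00 u by rewrite /Z /V; field; rewrite gt_eqF.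
  rewrite E1 in h1; rewrite E2 in h2; clear E1 E2.
  by case: (leP 0 (V u)) => hV; [rewrite ger0_norm|rewrite ltr0_norm]; lra.
have kk : `|k * (k - 2) / 2| <= 3 / 2.
  have h1 : 0 < (3 - k) * (k + 1) by rewrite mulr_gt0//; lra.
  by have h2 := sqr_ge0 (k - 1); rewrite ler_norml; apply/andP; split; lra.
have leH (u : R) : 0 < u -> u `^ k * (k * (k - 2) / 2 * u ^- 2) * V u <= 3 / (4 * r) * u ^- 2 * H u.
  move=> u0; rewrite HE//.
  have pu : 0 < u `^ k by exact: powR_gt0.
  have u20 : 0 < u ^- 2 by rewrite invr_gt0 exprn_gt0.
  have A0 := ltW (mulr_gt0 pu u20).
  rewrite (_ : _ * V u = u `^ k * u ^- 2 * (k * (k - 2) / 2 * V u)); last by ring.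
  rewrite (_ : 3 / _ * _ * _ = u `^ k * u ^- 2 * (3 / 2 * ((2 * r)^-1 * (M00 u + Z u)))); last first.
    by field; rewrite !gt_eqF.
  rewrite ler_wpM2l// (le_trans (ler_norm _))// normrM ler_pM//.
  by rewrite ler_pdivlMl ?mulr_gt0// psdV.
have HG := gronwall dH dPhi leH T00 T0t.
have N00t := N00_ge0 t0.
have Z0 (u : R) : 0 < u -> 0 <= Z u.
  move=> u0; have := es_psd es (k / (2 * u)) 1 u0.
  by congr (_ <= _); rewrite /Z; field; rewrite gt_eqF.
have pt : 0 < t `^ k by exact: powR_gt0.
have pT : 0 < T0 `^ k by exact: powR_gt0.
(* drop the non-negative terms at time t, bound the ones at time 1/(2r) *)
have low : r ^+ 2 * (t `^ k * N00 t) <= H t.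
  have /andP[HM1 _] := HM t t0; rewrite HE// mulrCA ler_pM2l//.
  by have := Z0 t t0; lra.
have up : H T0 <= T0 `^ k * (2 * T0 ^- 2 * (N00 T0 + T0 ^+ 2 * N11 T0)).
  have /andP[_ HM2] := HM T0 T00; rewrite HE// ler_pM2l//.
  have h := es_psd es (k / (2 * T0)) (-1) T00.
  have rT : (2 * r) ^+ 2 = T0 ^- 2 by rewrite /T0 exprVn invrK.
  rewrite rT in HM2.
  have E1 : Z T0 <= 2 * N11 T0 + k ^+ 2 / 2 * (T0 ^- 2 * N00 T0).
    rewrite -subr_ge0; move: h; congr (_ <= _).
    by rewrite /Z; field; rewrite gt_eqF.
  have E2 : k ^+ 2 / 2 * (T0 ^- 2 * N00 T0) <= 1 * (T0 ^- 2 * N00 T0).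
    apply: ler_wpM2r; last by nra.
    by rewrite mulr_ge0 ?invr_ge0 ?exprn_ge0 ?N00_ge0// ltW.
  rewrite (_ : 2 * T0 ^- 2 * _ = 2 * N11 T0 + 2 * (T0 ^- 2 * N00 T0)); last first.
    by field; rewrite gt_eqF.
  lra.
have eT : 3 / (4 * r) * T0^-1 = 3 / 2 by rewrite /T0 invrK; field; rewrite gt_eqF.
move: HG; rewrite !opprK eT => HG.
have Ht : H t <= H T0 * expR (3 / 2).
  apply: le_trans HG; rewrite ler_peMr; last 2 first.
  - apply: le_trans low; rewrite !mulr_ge0 ?exprn_ge0// ltW//.
  - by rewrite -expR0 ler_expR !mulr_ge0 ?invr_ge0 ?mulr_ge0// ltW.
  by [].
rewrite -(@ler_pM2l _ (r ^+ 2)) ?exprn_gt0// (le_trans low)// (le_trans Ht)//.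
apply: (@le_trans _ _ (T0 `^ k * (2 * T0 ^- 2 * (N00 T0 + T0 ^+ 2 * N11 T0)) * expR (3 / 2))).
  by rewrite ler_wpM2r ?expR_ge0.
rewrite le_eqVlt; apply/orP; left; apply/eqP.
have -> : T0 ^- 2 = 4 * r ^+ 2 by rewrite /T0 exprVn invrK; ring.
by ring.
Qed.

End energy.

(** * Square integrable functions *)

Section square_integrable.
Context {dsp : measure_display} {T : measurableType dsp} {R : realType}.
Variable mu : {measure set T -> \bar R}.
Implicit Types (f g : T -> R).

Definition sqi f := measurable_fun setT f /\ integ mu (fun x => f x ^+ 2).
Definition ip f g := rint mu (fun x => f x * g x).

Lemma integ_sqiM f g : sqi f -> sqi g -> integ mu (fun x => f x * g x).
Proof.
move=> [mf f2] [mg g2]; apply: integ_dom (integD f2 g2) _; first exact: measurable_funM.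
move=> x; rewrite normrM -[f x ^+ 2]real_normK ?num_real// -[g x ^+ 2]real_normK ?num_real//.
by have := sqr_ge0 (`|f x| - `|g x|); nra.
Qed.

Lemma eq_sqi f g : f =1 g -> sqi f -> sqi g.
Proof. by move=> /funext ->. Qed.

Lemma sqiD f g : sqi f -> sqi g -> sqi (fun x => f x + g x).
Proof.
move=> sf sg; split; first by apply: measurable_funD; [exact: sf.1|exact: sg.1].
apply: eq_integ (integD (integD sf.2 (integZ 2 (integ_sqiM sf sg))) sg.2) => x; ring.
Qed.

Lemma sqiZ c f : sqi f -> sqi (fun x => c * f x).
Proof.
move=> sf; split; first by apply: measurable_funM => //; exact: sf.1.
by apply: eq_integ (integZ (c ^+ 2) sf.2) => x; rewrite exprMn.
Qed.

Lemma sqiB f g : sqi f -> sqi g -> sqi (fun x => f x - g x).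
Proof. by move=> sf sg; apply: eq_sqi (sqiD sf (sqiZ (-1) sg)) => x; rewrite mulN1r. Qed.

Lemma sqi_bndM (a f : T -> R) M : measurable_fun setT a -> (forall x, `|a x| <= M) ->
  sqi f -> sqi (fun x => a x * f x).
Proof.
move=> ma aM [mf f2]; split; first exact: measurable_funM.
apply: (@eq_integ _ _ _ _ (fun x => a x ^+ 2 * f x ^+ 2)) => [x|]; first by rewrite exprMn.
apply: (integ_bndM (M := M ^+ 2)) => // [|x]; first exact: measurable_funX.
by rewrite normrX ler_sqr ?nnegrE// (le_trans _ (aM x)).
Qed.

Lemma ipC f g : ip f g = ip g f.
Proof. by apply: eq_rint => x; rewrite mulrC. Qed.

Lemma ipDl f g h : sqi f -> sqi g -> sqi h -> ip (fun x => f x + g x) h = ip f h + ip g h.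
Proof.
by move=> sf sg sh; rewrite /ip -rintD; [apply: eq_rint => x; rewrite mulrDl|exact: integ_sqiM..].
Qed.

Lemma ipZl c f h : sqi f -> sqi h -> ip (fun x => c * f x) h = c * ip f h.
Proof.
by move=> sf sh; rewrite /ip -rintZ; [apply: eq_rint => x; rewrite mulrA|exact: integ_sqiM].
Qed.

Lemma ipDr f g h : sqi f -> sqi g -> sqi h -> ip h (fun x => f x + g x) = ip h f + ip h g.
Proof. by move=> sf sg sh; rewrite ipC ipDl// !(ipC h). Qed.

Lemma ipZr c f h : sqi f -> sqi h -> ip h (fun x => c * f x) = c * ip h f.
Proof. by move=> sf sh; rewrite ipC ipZl// ipC. Qed.

Lemma ip_ge0 f : 0 <= ip f f.
Proof. by apply: rint_ge0 => x; rewrite -expr2 sqr_ge0. Qed.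

Lemma ip_psd a b f g : sqi f -> sqi g ->
  0 <= a ^+ 2 * ip f f + 2 * a * b * ip f g + b ^+ 2 * ip g g.
Proof.
move=> sf sg; have := ip_ge0 (fun x => a * f x + b * g x).
have [sa sb] := (sqiZ a sf, sqiZ b sg).
rewrite ipDl ?ipDr ?ipZl ?ipZr//; try exact: sqiD.
by rewrite (ipC g f); congr (_ <= _); ring.
Qed.

(** The three cases of the proof are <g,g> > 0, <f,f> > 0 and both zero. *)
Lemma cauchy_schwarz f g : sqi f -> sqi g -> `|ip f g| <= Num.sqrt (ip f f) * Num.sqrt (ip g g).
Proof.
move=> sf sg; rewrite -sqrtrM ?ip_ge0// -sqrtr_sqr ler_wsqrtr//.
have [a0 b0] := (ip_ge0 f, ip_ge0 g).
have H1 := ip_psd (ip g g) (- ip f g) sf sg.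
have H2 := ip_psd (- ip f g) (ip f f) sf sg.
have H3 := ip_psd 1 (- ip f g) sf sg.
move: a0 b0 H1 H2 H3; set A := ip f f; set B := ip g g; set c := ip f g => a0 b0 H1 H2 H3.
have [B0|B0] := ltP 0 B.
  by rewrite -(ler_pM2l B0); lra.
have [A0|A0] := ltP 0 A.
  by rewrite -(ler_pM2l A0); lra.
have AE : A = 0 by apply/le_anti; rewrite A0 a0.
have BE : B = 0 by apply/le_anti; rewrite B0 b0.
by move: H3; rewrite AE BE; lra.
Qed.

Lemma sqrt_cvg0 (F : set_system R) {FF : Filter F} (a : R -> R) :
  a h @[h --> F] --> (0 : R) -> Num.sqrt (a h) @[h --> F] --> (0 : R).
Proof.
move=> a0; have c0 := @sqrt_continuous R 0; have := cvg_comp _ _ a0 c0.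
by rewrite sqrtr0.
Qed.

(** Convergence in mean square lets one pass to the limit in inner products. *)
Lemma ip_cvg0 (F : set_system R) {FF : Filter F} (a b : R -> T -> R) (M : R) :
  (\forall h \near F, sqi (a h)) -> (\forall h \near F, sqi (b h)) ->
  ip (a h) (a h) @[h --> F] --> (0 : R) ->
  (\forall h \near F, ip (b h) (b h) <= M) ->
  ip (a h) (b h) @[h --> F] --> (0 : R).
Proof.
move=> sa sb a0 bM.
have E1 : Num.sqrt (ip (a h) (a h)) * Num.sqrt M @[h --> F] --> (0 : R).
  rewrite -[X in _ --> X](mul0r (Num.sqrt M)); apply: cvgM; last exact: cvg_cst.
  exact: sqrt_cvg0.
have E2 : - (Num.sqrt (ip (a h) (a h)) * Num.sqrt M) @[h --> F] --> (0 : R).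
  by rewrite -[X in _ --> X]oppr0; exact: cvgN.
apply: squeeze_cvgr E2 E1; near=> h.
rewrite -ler_norml (le_trans (cauchy_schwarz _ _))//; [by near: h..|].
by rewrite ler_wpM2l ?sqrtr_ge0// ler_wsqrtr//; near: h.
Unshelve. all: by end_near. Qed.

Definition quotient_error (a : R -> T -> R) (a' : T -> R) (t h : R) (x : T) : R :=
  h^-1 * (a (t + h) x - a t x) - a' x.

Definition sq_derivative (a : R -> T -> R) (t : R) (a' : T -> R) :=
  ip (quotient_error a a' t h) (quotient_error a a' t h) @[h --> 0^'] --> (0 : R).

Lemma is_derive_cvg (f : R -> R) (t D : R) :
  h^-1 * (f (t + h) - f t) @[h --> 0^'] --> D -> is_derive t 1 f D.
Proof.
move=> H.
have H' : (fun h : R => h^-1 *: (f (h *: (1 : R) + t) - f t)) @ 0^' --> D.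
  apply: cvg_trans H; apply: near_eq_cvg; apply: nearW => h.
  by rewrite /GRing.scale/= mulr1 [h + t]addrC.
split; first by apply/cvg_ex; exists D.
exact: cvg_lim H'.
Qed.

(** With a(t+h) = a(t) + h (a' + ra) and likewise for b, the difference
    quotient of <a,b> is <a',b> + <a,b'> plus terms that contain ra, rb or h,
    and these tend to 0 by the Cauchy-Schwarz inequality. *)
Lemma ip_derive (a b : R -> T -> R) (a' b' : T -> R) (t : R) : 0 < t ->
  (forall s, 0 < s -> sqi (a s)) -> (forall s, 0 < s -> sqi (b s)) ->
  sqi a' -> sqi b' -> sq_derivative a t a' -> sq_derivative b t b' ->
  is_derive t 1 (fun s => ip (a s) (b s)) (ip a' (b t) + ip (a t) b').
Proof.
move=> t0 sa sb sa' sb' da db; apply: is_derive_cvg.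
pose ra := quotient_error a a' t; pose rb := quotient_error b b' t.
have th : \forall h \near (0 : R)^', 0 < t + h.
  near=> h; suff : `|h| < t by rewrite ltr_norml => /andP[? _]; lra.
  by near: h; apply: dnbhs0_lt.
have sra : \forall h \near (0 : R)^', sqi (ra h).
  near=> h; apply: sqiB => //; apply/sqiZ/sqiB; apply: sa => //.
  by near: h.
have srb : \forall h \near (0 : R)^', sqi (rb h).
  near=> h; apply: sqiB => //; apply/sqiZ/sqiB; apply: sb => //.
  by near: h.
have h0 : (h : R) @[h --> (0 : R)^'] --> (0 : R) by exact: nbhs_dnbhs.
pose rest h := ip (ra h) (b t) + ip (rb h) (a t) +
  h * (ip a' b' + ip (ra h) b' + ip (rb h) a' + ip (ra h) (rb h)).
have rest0 : rest h @[h --> (0 : R)^'] --> (0 : R).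
  have c0 (q : R -> T -> R) c : (\forall h \near (0 : R)^', sqi (q h)) -> sqi c ->
      ip (q h) (q h) @[h --> 0^'] --> (0 : R) -> ip (q h) c @[h --> 0^'] --> (0 : R).
    move=> sq sc q0; apply: (@ip_cvg0 _ _ _ (fun=> c) (ip c c)) => //.
      exact: nearW.
    exact: nearW.
  rewrite -[X in _ --> X](_ : 0 + 0 + 0 * (ip a' b' + 0 + 0 + 0) = 0 :> R); last by ring.
  apply: cvgD; first by apply: cvgD; apply: c0 => //; [exact: sb|exact: sa].
  apply: cvgM => //; apply: cvgD; last first.
    apply: (@ip_cvg0 _ _ _ _ 1) => //.
    by move/cvgr_le : db; apply; exact: ltr01.
  apply: cvgD; last exact: c0.
  by apply: cvgD; [exact: cvg_cst|exact: c0].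
have : ip a' (b t) + ip (a t) b' + rest h @[h --> (0 : R)^'] --> ip a' (b t) + ip (a t) b'.
  by rewrite -[X in _ --> X]addr0; apply: cvgD => //; exact: cvg_cst.
apply: cvg_trans; apply: near_eq_cvg; near=> h.
have hn0 : h != 0 by near: h; exact: nbhs_dnbhs_neq.
have sah : sqi (ra h) by near: h.
have sbh : sqi (rb h) by near: h.
have sat := sa t t0; have sbt := sb t t0.
have aE : a (t + h) = (fun x => a t x + h * (a' x + ra h x)).
  by apply/funext => x; rewrite /ra /quotient_error; field.
have bE : b (t + h) = (fun x => b t x + h * (b' x + rb h x)).
  by apply/funext => x; rewrite /rb /quotient_error; field.
rewrite aE bE /rest /=; move: (ra h) (rb h) sah sbh => A B sA sB.
have s1 := sqiD sa' sA; have s2 := sqiD sb' sB.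
have s3 := sqiZ h s1; have s4 := sqiZ h s2.
rewrite ipDl ?ipDr ?ipZl ?ipZr ?ipDl ?ipDr//; last exact: sqiD.
rewrite [ip B (a t)]ipC [ip B a']ipC.
by field.
Unshelve. all: by end_near. Qed.

End square_integrable.

Section solution_energy.
Context {dsp : measure_display} {T : measurableType dsp} {R : realType}.
Variables (mu : {measure set T -> \bar R}) (k B : R) (m : T -> R).
Variables (v v1 : R -> T -> R) (f g : T -> R).
Local Notation sqi := (sqi mu).
Local Notation ip := (ip mu).
Hypothesis k1 : -1 < k < 1.
Hypothesis mm : measurable_fun setT m.
Hypothesis mB : forall x, 0 <= m x <= B.
Hypothesis sv : forall t, 0 < t -> sqi (v t).
Hypothesis sv1 : forall t, 0 < t -> sqi (v1 t).
Hypothesis dv : forall t, 0 < t -> sq_derivative mu v t (v1 t).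
Hypothesis dv1 : forall t, 0 < t ->
  sq_derivative mu v1 t (fun x => - (k / t) * v1 t x - m x * v t x).
Hypothesis (sf : sqi f) (sg : sqi g).
Hypothesis vf : ip (fun x => v t x - f x) (fun x => v t x - f x) @[t --> 0^'+] --> (0 : R).
Hypothesis v1g : ip (fun x => (1 - k)^-1 * t `^ k * v1 t x - g x)
  (fun x => (1 - k)^-1 * t `^ k * v1 t x - g x) @[t --> 0^'+] --> (0 : R).

Let normmB x : `|m x| <= B.
Proof. by have /andP[h1 h2] := mB x; rewrite ger0_norm. Qed.

Let sqim h : sqi h -> sqi (fun x => m x * h x).
Proof. by move=> sh; apply: sqi_bndM normmB sh. Qed.

Let ip_mC a b : ip (fun x => m x * a x) b = ip (fun x => m x * b x) a.
Proof. by apply: eq_rint => x; rewrite mulrAC. Qed.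

Let dmv t : 0 < t -> sq_derivative mu (fun s x => m x * v s x) t (fun x => m x * v1 t x).
Proof.
move=> t0; rewrite /sq_derivative.
have E h : quotient_error (fun s x => m x * v s x) (fun x => m x * v1 t x) t h =
    (fun x => m x * quotient_error v (v1 t) t h x).
  by apply/funext => x; rewrite /quotient_error; ring.
have C : B ^+ 2 * ip (quotient_error v (v1 t) t h) (quotient_error v (v1 t) t h) @[h --> 0^'] --> (0 : R).
  by rewrite -[X in _ --> X](mulr0 (B ^+ 2)); apply: cvgM; [exact: cvg_cst|exact: dv].
apply: squeeze_cvgr (cvg_cst 0) C; near=> h.
have th : 0 < t + h.
  suff : `|h| < t by rewrite ltr_norml => /andP[? _]; lra.
  by near: h; apply: dnbhs0_lt.
rewrite ip_ge0/= E; set q := quotient_error _ _ _ _.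
have sq : sqi q by apply: sqiB (sv1 t0); apply/sqiZ/sqiB; exact: sv.
rewrite /ip -rintZ; last exact: integ_sqiM.
apply: le_rint => [||x].
- by apply: integ_sqiM; exact: sqim.
- by apply: integZ; exact: integ_sqiM.
have /andP[h1 h2] := mB x.
rewrite mulrACA -!expr2 ler_wpM2r ?sqr_ge0// ler_sqr ?nnegrE//.
exact: le_trans h2.
Unshelve. all: by end_near. Qed.

Let N00 t := ip (v t) (v t).
Let N01 t := ip (v t) (v1 t).
Let N11 t := ip (v1 t) (v1 t).
Let M00 t := ip (fun x => m x * v t x) (v t).
Let M01 t := ip (fun x => m x * v t x) (v1 t).

(** The product rule, with v'' replaced by - (k/t) v' - m v. *)
Lemma solution_energy_system : energy_system k N00 N01 N11 M00 M01.
Proof.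
have sw t : 0 < t -> sqi (fun x => - (k / t) * v1 t x - m x * v t x).
  by move=> t0; apply: sqiB; [exact/sqiZ/sv1|exact/sqim/sv].
have wE t c : 0 < t -> sqi c -> ip (fun x => - (k / t) * v1 t x - m x * v t x) c =
    - (k / t) * ip (v1 t) c - ip (fun x => m x * v t x) c.
  move=> t0 sc; have s1 := sqiZ (- (k / t)) (sv1 t0); have s2 := sqim (sv t0).
  transitivity (ip (fun x => - (k / t) * v1 t x + -1 * (m x * v t x)) c).
    by apply: eq_rint => x; rewrite mulN1r.
  rewrite ipDl ?ipZl ?mulN1r//; first exact: sv1.
  exact: sqiZ.
split=> [t t0|t t0|t t0|t t0|t a b t0].
- apply: (is_derive_eq (ip_derive t0 sv sv (sv1 t0) (sv1 t0) (dv t0) (dv t0))).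
  by rewrite /N01 [ip (v1 t) (v t)]ipC; ring.
- apply: (is_derive_eq (ip_derive t0 sv sv1 (sv1 t0) (sw t t0) (dv t0) (dv1 t0))).
  rewrite [ip (v t) _]ipC wE//; last exact: sv.
  by rewrite /N01 /N11 /M00 [ip (v1 t) (v t)]ipC; ring.
- apply: (is_derive_eq (ip_derive t0 sv1 sv1 (sw t t0) (sw t t0) (dv1 t0) (dv1 t0))).
  rewrite [ip (v1 t) (fun _ => _)]ipC wE//; last exact: sv1.
  by rewrite /N11 /M01; ring.
- have smv s : 0 < s -> sqi (fun x => m x * v s x) by move=> s0; exact/sqim/sv.
  apply: (is_derive_eq (ip_derive t0 smv sv (sqim (sv1 t0)) (sv1 t0) (dmv t0) (dv t0))).
  by rewrite ip_mC /M01; ring.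
- by apply: ip_psd; [exact: sv|exact: sv1].
Qed.

Let ip_shift a b : sqi a -> sqi b ->
  ip a a <= 2 * ip (fun x => a x - b x) (fun x => a x - b x) + 2 * ip b b.
Proof.
move=> sa sb; rewrite /ip -!rintZ; try (apply: integ_sqiM => //; exact: sqiB).
rewrite -rintD; try (apply/integZ/integ_sqiM => //; exact: sqiB).
apply: le_rint => [||x]; first exact: integ_sqiM.
  by apply: integD; apply/integZ/integ_sqiM => //; exact: sqiB.
by have := sqr_ge0 (a x - 2 * b x); nra.
Qed.

Let initial_energy T0 : 0 < T0 -> forall eps : R, 0 < eps -> exists s : R,
    [/\ 0 < s, s <= T0, N00 s <= 2 * ip f f + eps &
        (s `^ k) ^+ 2 * N11 s <= 2 * (1 - k) ^+ 2 * ip g g + eps].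
Proof.
move=> T00 eps eps0; have /andP[kN kP] := k1.
have e2 : 0 < eps / 2 by rewrite divr_gt0.
have D0 : 0 < 2 * (1 - k) ^+ 2 by rewrite mulr_gt0// exprn_gt0// subr_gt0.
have e3 : 0 < eps / (2 * (1 - k) ^+ 2) by rewrite divr_gt0.
near (0 : R)^'+ => s; exists s.
have s0 : 0 < s by [].
have H1 : ip (fun x => v s x - f x) (fun x => v s x - f x) <= eps / 2.
  by near: s; move/cvgr_le : vf; apply.
have H2 : ip (fun x => (1 - k)^-1 * s `^ k * v1 s x - g x)
  (fun x => (1 - k)^-1 * s `^ k * v1 s x - g x) <= eps / (2 * (1 - k) ^+ 2).
  by near: s; move/cvgr_le : v1g; apply.
split => //.
- by near: s; exact: nbhs_right_le.
- apply: (le_trans (ip_shift (sv s0) sf)).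
  by rewrite addrC lerD2l mulrC -ler_pdivlMr.
- have sa := sqiZ ((1 - k)^-1 * s `^ k) (sv1 s0).
  have := ip_shift sa sg; rewrite ipZl ?ipZr//; try by [exact: sv1|exact/sqiZ/sv1].
  move=> H3; have -> : (s `^ k) ^+ 2 * N11 s =
    (1 - k) ^+ 2 * ((1 - k)^-1 * s `^ k * ((1 - k)^-1 * s `^ k * ip (v1 s) (v1 s))).
    by rewrite /N11; field; rewrite gt_eqF// subr_gt0.
  apply: (@le_trans _ _ ((1 - k) ^+ 2 * (2 * (eps / (2 * (1 - k) ^+ 2)) + 2 * ip g g))).
    rewrite ler_wpM2l ?sqr_ge0// (le_trans H3)// lerD2r ler_wpM2l//.
  rewrite le_eqVlt; apply/orP; left; apply/eqP; field.
  by rewrite gt_eqF// subr_gt0.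
Unshelve. all: by end_near. Qed.

(** Twice the initial value of |v|^2 + l^2 |t^k v'|^2 for l = T0^(1-k), since
    t^k v' tends to (1 - k) g. *)
Definition data_energy (T0 : R) : R := 2 * ip f f + (T0 `^ (1 - k)) ^+ 2 * (2 * (1 - k) ^+ 2 * ip g g).

(** The energy at small times is at most [data_energy] up to a small error
    because the data are limits in mean square; the factor 2 there comes from
    (a+b)^2 <= 2 a^2 + 2 b^2. *)
Lemma solution_low (T0 : R) : 0 < T0 -> (forall x, m x <= T0 ^- 2) ->
  ip (v T0) (v T0) + T0 ^+ 2 * ip (v1 T0) (v1 T0) <= expR (low_const k) * data_energy T0.
Proof.
move=> T00 mT; apply: (energy_low k1 solution_energy_system) => //; last exact: initial_energy.
move=> t b t0; rewrite /M01 /N00 /N11 /ip.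
have [svt sv1t] := (sv t0, sv1 t0).
have i1 := integ_sqiM svt svt; have i2 := integ_sqiM sv1t sv1t.
rewrite -(rintZ (b ^+ 2))// -rintD//; last exact: integZ.
rewrite -!rintZ//; last 2 first.
- by apply: integD => //; exact: integZ.
- by apply: integ_sqiM => //; exact: sqim.
apply: le_rint => [||x].
- by apply/integZ/integ_sqiM => //; exact: sqim.
- by apply/integZ/integD => //; exact: integZ.
have /andP[m0 _] := mB x.
apply: (@le_trans _ _ (m x * (v t x * v t x + b ^+ 2 * (v1 t x * v1 t x)))).
  rewrite -subr_ge0 (_ : _ - _ = m x * (v t x - b * v1 t x) ^+ 2); last by ring.
  by rewrite mulr_ge0// sqr_ge0.
rewrite ler_wpM2r// -!expr2 addr_ge0 ?sqr_ge0// mulr_ge0 ?sqr_ge0//.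
Qed.

Lemma solution_high (r t : R) : 0 < r -> (2 * r)^-1 <= t ->
  (forall x, r ^+ 2 <= m x <= (2 * r) ^+ 2) ->
  t `^ k * ip (v t) (v t) <= 8 * expR (3 / 2) *
    (((2 * r)^-1) `^ k * (expR (low_const k) * data_energy (2 * r)^-1)).
Proof.
move=> r0 rt mr.
have T00 : 0 < (2 * r)^-1 by rewrite invr_gt0 mulr_gt0.
apply: (le_trans (energy_high k1 solution_energy_system r0 rt _)).
  move=> s s0; rewrite /N00 /M00 /ip; have ss := sv s0.
  rewrite -!rintZ; try exact: integ_sqiM.
  have i1 := integ_sqiM ss ss; have i2 := integ_sqiM (sqim ss) ss.
  apply/andP; split; apply: le_rint => [||x]//; try exact: integZ;
    by have /andP[h1 h2] := mr x; rewrite -mulrA ler_wpM2r// -expr2 sqr_ge0.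
rewrite ler_wpM2l ?mulr_ge0 ?expR_ge0// ler_wpM2l ?powR_ge0//.
by apply: solution_low => // x; have /andP[_] := mr x; rewrite exprVn invrK.
Qed.

End solution_energy.

(** * The Fourier transform of a solution *)

Section fourier_parts.
Context {R : realType} {d : nat}.
Local Notation mu := (@lebesgue_rV R d).
Implicit Types (h p q r : 'rV[R]_d -> R[i]) (x xi : 'rV[R]_d) (b : bool).

(** Real and imaginary parts, indexed by a boolean so that both are treated
    at once. *)
Definition part b (z : R[i]) : R := if b then complex.Re z else complex.Im z.

Definition integC h := forall b, integ mu (fun x => part b (h x)).

Definition fpart b h xi : R := part b (fourier h xi).

Definition fourier_cst : R := (2 * pi) `^ (- (d%:R / 2)).

Definition part_sign b : R := if b then 1 else -1.

(** The real part of the transform involves the cosine transform of the real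
    part and the sine transform of the imaginary part, and conversely. *)
Lemma fpartE b h xi : integC h -> fpart b h xi = fourier_cst *
  (trig_transform true (fun x => part b (h x)) xi +
   part_sign b * trig_transform false (fun x => part (~~ b) (h x)) xi).
Proof.
move=> ih; have i1 b' b'' := integ_trig b' xi (ih b'').
have -> : fpart b h xi = fourier_cst * part b (integralC (fun x =>
    h x * (cos (dotr x xi) -i* sin (dotr x xi))%C)).
  by rewrite /fpart /fourier -/fourier_cst; case: (integralC _) => u v; case: b; rewrite /= mul0r ?subr0 ?addr0.
congr (_ * _); rewrite /trig_transform; case: b => /=.
  rewrite mul1r -rintD; [|exact: (i1 true true)|exact: (i1 false false)].
  by apply: eq_rint => x; case: (h x) => u v /=; ring.
rewrite mulN1r -rintB; [|exact: (i1 true false)|exact: (i1 false true)].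
by apply: eq_rint => x; case: (h x) => u v /=; ring.
Qed.

Lemma trig_transform_lin b (a1 a2 a3 : R) (f1 f2 f3 : 'rV[R]_d -> R) xi :
  integ mu f1 -> integ mu f2 -> integ mu f3 ->
  trig_transform b (fun x => a1 * f1 x + a2 * f2 x + a3 * f3 x) xi =
  a1 * trig_transform b f1 xi + a2 * trig_transform b f2 xi + a3 * trig_transform b f3 xi.
Proof.
move=> i1 i2 i3; have j1 := integ_trig b xi i1.
have j2 := integ_trig b xi i2; have j3 := integ_trig b xi i3.
transitivity (rint mu (fun x => a1 * (f1 x * trig b (dotr x xi)) +
    a2 * (f2 x * trig b (dotr x xi)) + a3 * (f3 x * trig b (dotr x xi)))).
  by apply: eq_rint => x; ring.
rewrite rintD; [|by apply: integD; exact: integZ|exact: integZ].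
by rewrite rintD ?rintZ//; exact: integZ.
Qed.

(** Linearity over the reals, for the three-term combinations that occur in
    difference quotients, in the equation and in the initial conditions. *)
Lemma fpart_lin b (a1 a2 a3 : R) h p q r xi : integC h -> integC p -> integC q -> integC r ->
  (forall b' x, part b' (h x) = a1 * part b' (p x) + a2 * part b' (q x) + a3 * part b' (r x)) ->
  fpart b h xi = a1 * fpart b p xi + a2 * fpart b q xi + a3 * fpart b r xi.
Proof.
move=> ih ip iq ir E; rewrite !fpartE//.
rewrite (_ : (fun x => part b (h x)) = (fun x => a1 * part b (p x) + a2 * part b (q x) + a3 * part b (r x))); last exact/funext/E.
rewrite (_ : (fun x => part (~~ b) (h x)) = (fun x => a1 * part (~~ b) (p x) + a2 * part (~~ b) (q x) + a3 * part (~~ b) (r x))); last exact/funext/E.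
by rewrite !trig_transform_lin//; ring.
Qed.

Lemma integC_lin (a1 a2 a3 : R) h p q r : integC p -> integC q -> integC r ->
  (forall b' x, part b' (h x) = a1 * part b' (p x) + a2 * part b' (q x) + a3 * part b' (r x)) ->
  integC h.
Proof.
move=> ip iq ir E b; apply: eq_integ (integD (integD (integZ a1 (ip b)) (integZ a2 (iq b))) (integZ a3 (ir b))).
by move=> x; rewrite E.
Qed.

Lemma measurable_fpart b h : integC h -> measurable_fun setT (fpart b h).
Proof.
move=> ih; rewrite (_ : fpart b h = fun xi => fourier_cst *
  (trig_transform true (fun x => part b (h x)) xi +
   part_sign b * trig_transform false (fun x => part (~~ b) (h x)) xi)); last first.
  by apply/funext => xi; exact: fpartE.
apply: measurable_funM => //; apply: measurable_funD; first exact: measurable_trig_transform.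
by apply: measurable_funM => //; exact: measurable_trig_transform.
Qed.

Lemma normc_sqr (z : R[i]) : Normc.normc z ^+ 2 = part true z ^+ 2 + part false z ^+ 2.
Proof. by case: z => u v /=; rewrite sqr_sqrtr// addr_ge0 ?sqr_ge0. Qed.

Lemma normc_ge0 (z : R[i]) : 0 <= Normc.normc z.
Proof. by case: z => u v; exact: sqrtr_ge0. Qed.

Lemma measurable_normc_fourier h : integC h ->
  measurable_fun setT (fun xi => Normc.normc (fourier h xi) ^+ 2).
Proof.
move=> ih; rewrite (_ : (fun x => _) = fun x => fpart true h x ^+ 2 + fpart false h x ^+ 2).
  by apply: measurable_funD; apply: measurable_funX; exact: measurable_fpart.
by apply/funext => xi; rewrite normc_sqr.
Qed.

Lemma fourier_cst_sqr : fourier_cst ^+ 2 * (2 * pi) ^+ d = 1.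
Proof.
have p0 : 0 < 2 * pi :> R by rewrite mulr_gt0// pi_gt0.
rewrite /fourier_cst -powR_mulrn ?powR_ge0// -powRrM mulNr divfK// powRN.
by rewrite powR_mulrn ?ltW// mulVf// gt_eqF// exprn_gt0.
Qed.

(** The factor 2 comes from (a+b)^2 <= 2 a^2 + 2 b^2, used to separate the
    cosine and sine transforms of the real and imaginary parts; the Plancherel
    inequality applies to each part. *)
Lemma fourier_L2_le h : integC h ->
  (\int[mu]_xi (Normc.normc (fourier h xi) ^+ 2)%:E <=
   2%:E * \int[mu]_x (Normc.normc (h x) ^+ 2)%:E)%E.
Proof.
move=> ih.
have mp b : measurable_fun setT (fun x => part b (h x)) := integ_meas (ih b).
have mt b b' : measurable_fun setT (trig_transform b (fun x => part b' (h x))) := measurable_trig_transform b (ih b').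
pose S b xi := 2 * fourier_cst ^+ 2 * (trig_transform true (fun x => part b (h x)) xi ^+ 2 +
  trig_transform false (fun x => part b (h x)) xi ^+ 2).
have S0 b xi : 0 <= S b xi.
  rewrite /S; apply: mulr_ge0; [by rewrite mulr_ge0 ?sqr_ge0|by rewrite addr_ge0 ?sqr_ge0].
have mS b : measurable_fun setT (S b).
  by apply: measurable_funM => //; apply: measurable_funD; exact: measurable_funX.
have SP b : (\int[mu]_xi (S b xi)%:E <= 2%:E * \int[mu]_x (part b (h x) ^+ 2)%:E)%E.
  have /= := plancherel_le (ih b).
  set A := (X in (X <= _)%E); set B := (X in (_ <= _ * X)%E) => AB.
  rewrite /S; under eq_integral do rewrite EFinM.
  rewrite ge0_integralZl_EFin//; last 3 first.
  - by move=> x _; rewrite lee_fin addr_ge0// sqr_ge0.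
  - by apply/measurable_EFinP; apply: measurable_funD; exact: measurable_funX.
  - by rewrite mulr_ge0// sqr_ge0.
  apply: (le_trans (lee_wpmul2l _ AB)); first by rewrite lee_fin mulr_ge0// sqr_ge0.
  by rewrite muleA -EFinM -mulrA fourier_cst_sqr mulr1.
apply: (@le_trans _ _ (\int[mu]_xi (S true xi)%:E + \int[mu]_xi (S false xi)%:E)%E).
  rewrite -ge0_integralD//; try (by move=> x _; rewrite lee_fin); try exact/measurable_EFinP.
  apply: ge0_le_integral => //.
  - by move=> x _; rewrite lee_fin sqr_ge0.
  - by apply/measurable_EFinP; exact: measurable_normc_fourier.
  - by apply: emeasurable_funD; exact/measurable_EFinP.
  move=> xi _; rewrite -EFinD lee_fin normc_sqr -!/(fpart _ _ _) !fpartE// /S /=.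
  set a1 := trig_transform true _ xi; set a2 := trig_transform false _ xi.
  set a3 := trig_transform true _ xi; set a4 := trig_transform false _ xi.
  rewrite -subr_ge0 (_ : _ - _ = fourier_cst ^+ 2 * ((a1 - a2) ^+ 2 + (a3 + a4) ^+ 2)); last by ring.
  by rewrite mulr_ge0 ?sqr_ge0// addr_ge0 ?sqr_ge0.
apply: (le_trans (leeD (SP true) (SP false))).
rewrite -ge0_muleDr; try by apply: integral_ge0 => x _; rewrite lee_fin sqr_ge0.
rewrite -ge0_integralD//; try (by move=> x _; rewrite lee_fin sqr_ge0);
  try (by apply/measurable_EFinP; exact: measurable_funX).
by under [X in (_ <= _ * X)%E]eq_integral do rewrite normc_sqr EFinD.
Qed.

Lemma schwartz_tame b h : schwartz h -> tame (fun x => part b (h x)).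
Proof. by case: b => sh; [exact: (schwartz_tame_Re [::])|exact: (schwartz_tame_Im [::])]. Qed.

Lemma schwartz_integC h : schwartz h -> integC h.
Proof. by move=> sh b; exact/tame_integ/schwartz_tame. Qed.

Lemma envelope_le (x : 'rV[R]_d) : envelope x <= 2 ^+ d.
Proof.
have -> : 2 ^+ d = \prod_(i < d) 2 :> R by rewrite prodr_const card_ord.
rewrite /envelope; apply: ler_prod => i _.
rewrite poisson_kernel_ge0//= /poisson_kernel mulr1 expr1n ler_pdivrMr; last first.
  by rewrite ltr_pwDl ?sqr_ge0.
by have := sqr_ge0 (x ord0 i); lra.
Qed.

Lemma tame_sqi (phi : 'rV[R]_d -> R) : tame phi -> sqi mu phi.
Proof.
move=> [dphi [M HM]]; have mphi := differentiable_measurable dphi; split=> //.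
apply: integ_dom (integZ (M ^+ 2 * 2 ^+ d) (integ_envelope d)) _.
  exact: measurable_funX.
move=> x; rewrite normrX -mulrA.
apply: (@le_trans _ _ ((M * envelope x) ^+ 2)).
  by rewrite ler_sqr ?nnegrE// (le_trans _ (HM x)).
rewrite exprMn ler_wpM2l ?sqr_ge0// expr2 ler_wpM2r ?envelope_ge0//.
exact: envelope_le.
Qed.

Lemma schwartz_fourier_sqi b h : schwartz h -> sqi mu (fpart b h).
Proof.
move=> sh; have ih := schwartz_integC sh; have mf := measurable_fpart b ih.
split=> //; apply: integ_ge0; [exact: measurable_funX|by move=> x; exact: sqr_ge0|].
apply: (@le_lt_trans _ _ (2%:E * \int[mu]_x (Normc.normc (h x) ^+ 2)%:E)%E); last first.
  have s2 b' := (tame_sqi (schwartz_tame b' sh)).2.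
  under eq_integral do rewrite normc_sqr.
  by rewrite rint_EFin ?ltry//; exact: integD.
apply: le_trans (fourier_L2_le ih); apply: ge0_le_integral => //.
- by move=> x _; rewrite lee_fin sqr_ge0.
- by apply/measurable_EFinP; exact: measurable_funX.
- by apply/measurable_EFinP; exact: measurable_normc_fourier.
by move=> x _; rewrite lee_fin normc_sqr; case: b mf => _; rewrite ?lerDl ?lerDr sqr_ge0.
Qed.

Lemma fpart_laplacian b h xi : schwartz h ->
  fpart b (laplacian h) xi = - (dotr xi xi * fpart b h xi).
Proof.
move=> sh.
have tl b' l : tame (fun x => part b' (pderivs l h x)).
  by case: b'; [exact: schwartz_tame_Re|exact: schwartz_tame_Im].
have lapE b' x : part b' (laplacian h x) = \sum_(i < d) part b' (pderivs [:: i; i] h x).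
  rewrite /laplacian; apply: (big_morph (part b')); last by case: b'.
  by move=> [u v] [u' v']; case: b'.
have il : integC (laplacian h).
  move=> b'; apply: eq_integ (integ_sum (index_enum 'I_d) (fun i => tame_integ (tl b' [:: i; i]))).
  by move=> x; rewrite lapE.
have tE b1 b2 : trig_transform b1 (fun x => part b2 (laplacian h x)) xi =
    - (dotr xi xi * trig_transform b1 (fun x => part b2 (h x)) xi).
  rewrite {1}/trig_transform; transitivity (rint mu (fun x => \sum_(i < d)
      part b2 (pderivs [:: i; i] h x) * trig b1 (dotr x xi))).
    by apply: eq_rint => x; rewrite lapE mulr_suml.
  rewrite rint_sum; last by move=> i; exact/integ_trig/tame_integ/tl.
  rewrite /dotr mulr_suml -sumrN; apply: eq_bigr => i _; rewrite -expr2.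
  have D l : (fun x => part b2 (pderivs (i :: l) h x)) =
      'D_(delta_mx ord0 i) (fun x => part b2 (pderivs l h x)).
    by case: b2.
  have := @trig_transform_partial2 R d b1 (fun x => part b2 (h x)) i xi (tl b2 [::]).
  rewrite -(D [::]) -(D [:: i]) => /(_ (tl b2 [:: i]) (tl b2 [:: i; i])) <-.
  by [].
have ih := schwartz_integC sh.
by rewrite !fpartE// !tE; ring.
Qed.

End fourier_parts.

Section L2_calculus.
Context {R : realType} {d : nat}.
Local Notation mu := (@lebesgue_rV R d).
Implicit Types (h p q r f g : 'rV[R]_d -> R[i]) (x xi : 'rV[R]_d) (b : bool).
Implicit Types (phi m : 'rV[R]_d -> R).

Lemma Lnorm2_sqr (F : 'rV[R]_d -> R) : (forall x, 0 <= F x) ->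
  (\int[mu]_x (F x ^+ 2)%:E = Lnorm mu 2%:E (fun x => (F x)%:E) `^ 2)%E.
Proof.
move=> F0; rewrite powR_Lnorm//; apply: eq_integral => x _.
by rewrite poweR_EFin ger0_norm// powR_mulrn.
Qed.

Lemma L2_norm_sqr_le h (e : R) : 0 <= e -> (L2_norm h <= e%:E)%E ->
  (\int[mu]_x (Normc.normc (h x) ^+ 2)%:E <= (e ^+ 2)%:E)%E.
Proof.
move=> e0 he; rewrite Lnorm2_sqr; last by move=> x; exact: normc_ge0.
rewrite -powR_mulrn// -poweR_EFin gt0_ler_poweR//.
- by rewrite in_itv/= Lnorm_ge0 leey.
- by rewrite in_itv/= lee_fin e0 leey.
Qed.

(** The cut-off phi will be the indicator of a band times a power of the
    Sobolev weight. *)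
Definition weighted phi b h xi : R := phi xi * fpart b h xi.

Lemma measurable_weighted phi b h : measurable_fun setT phi -> integC h ->
  measurable_fun setT (weighted phi b h).
Proof. by move=> mphi ih; apply: measurable_funM => //; exact: measurable_fpart. Qed.

(** Multiplication by phi costs its square sup norm M^2, the Fourier transform
    the factor 2. *)
Lemma ip_weighted_le phi (M e : R) b h : measurable_fun setT phi ->
  (forall xi, `|phi xi| <= M) -> integC h -> 0 <= e -> (L2_norm h <= e%:E)%E ->
  ip mu (weighted phi b h) (weighted phi b h) <= 2 * M ^+ 2 * e ^+ 2.
Proof.
move=> mphi phiM ih e0 he.
have M0 : 0 <= M by exact: le_trans (phiM 0).
have mw := measurable_weighted b mphi ih.
have mn := measurable_normc_fourier ih.
have B : (\int[mu]_xi (weighted phi b h xi ^+ 2)%:E <= (2 * M ^+ 2 * e ^+ 2)%:E)%E.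
  apply: (@le_trans _ _ ((M ^+ 2)%:E * \int[mu]_xi (Normc.normc (fourier h xi) ^+ 2)%:E)%E).
    rewrite -ge0_integralZl_EFin//; last 3 first.
    - by move=> xi _; rewrite lee_fin sqr_ge0.
    - exact/measurable_EFinP.
    - exact: sqr_ge0.
    apply: ge0_le_integral => //.
    - by move=> xi _; rewrite lee_fin sqr_ge0.
    - by apply/measurable_EFinP; exact: measurable_funX.
    - by apply/measurable_EFinP; exact: measurable_funM.
    move=> xi _; rewrite -EFinM lee_fin /weighted exprMn ler_pM ?sqr_ge0//.
      by rewrite -[phi xi ^+ 2]real_normK ?num_real// ler_sqr ?nnegrE.
    by rewrite normc_sqr /fpart; case: b {mw}; rewrite ?lerDl ?lerDr sqr_ge0.
  apply: (@le_trans _ _ ((M ^+ 2)%:E * (2%:E * (e ^+ 2)%:E))%E); last first.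
    by rewrite -!EFinM lee_fin le_eqVlt; apply/orP; left; apply/eqP; ring.
  apply: lee_wpmul2l; first by rewrite lee_fin sqr_ge0.
  apply: (le_trans (fourier_L2_le ih)); apply: lee_wpmul2l => //.
  exact: L2_norm_sqr_le.
rewrite -lee_fin /ip -rint_EFin.
  by apply: le_trans B; rewrite le_eqVlt; apply/orP; left; apply/eqP; apply: eq_integral.
apply: integ_ge0; [exact: measurable_funM|by move=> xi; rewrite -expr2 sqr_ge0|].
by apply: le_lt_trans (ltry (2 * M ^+ 2 * e ^+ 2)).
Qed.

Lemma L2_cvg_weighted (F : set_system R) {FF : ProperFilter F} (H : R -> 'rV[R]_d -> R[i])
    phi (M : R) b : measurable_fun setT phi -> (forall xi, `|phi xi| <= M) ->
  (\forall e \near F, integC (H e)) -> L2_norm (H e) @[e --> F] --> 0%E ->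
  ip mu (weighted phi b (H e)) (weighted phi b (H e)) @[e --> F] --> (0 : R).
Proof.
move=> mphi phiM iH H0.
have M0 : 0 <= M by exact: le_trans (phiM 0).
apply/cvgr0Pnorm_le => eps eps0.
pose D := eps / (2 * M ^+ 2 + 1).
have N0 : 0 < 2 * M ^+ 2 + 1 by rewrite ltr_wpDl// mulr_ge0// sqr_ge0.
have D0 : 0 < D by rewrite divr_gt0.
have s0 : 0 < Num.sqrt D by rewrite sqrtr_gt0.
move/fine_cvgP : H0 => [Hfin /cvgr_le Hle].
near=> e.
rewrite ger0_norm ?ip_ge0//.
apply: (@le_trans _ _ (2 * M ^+ 2 * (Num.sqrt D) ^+ 2)).
  apply: ip_weighted_le => //; first by near: e.
  have fe : L2_norm (H e) \is a fin_num by near: e.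
  by rewrite -(fineK fe) lee_fin; near: e; apply: Hle.
rewrite sqr_sqrtr; last exact: ltW.
rewrite /D mulrA ler_pdivrMr// mulrC ler_pM2l//; lra.
Unshelve. all: by end_near. Qed.

End L2_calculus.

Section constants.
Context {R : realType}.
Implicit Types a b w e : R.

Lemma data_energy_bound sigma a b w : 0 < sigma < 1 -> 0 <= a -> 0 <= b -> 0 <= w ->
  2 * a + w * (2 * (2 * sigma) ^+ 2 * b) <= 8 * (a + w * b).
Proof.
move=> /andP[s0 s1] a0 b0 w0.
have wb : 0 <= w * b by rewrite mulr_ge0.
have s2 : sigma ^+ 2 <= 1 by rewrite expr_le1// ltW.
have h : w * b * sigma ^+ 2 <= w * b by rewrite ler_piMr.
by rewrite (_ : w * _ = 8 * (w * b * sigma ^+ 2)); [lra|ring].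
Qed.

Lemma low_energy_sumE e w a a' b b' : e * (8 * (a + w * b)) + e * (8 * (a' + w * b')) =
  8 * e * (a + a' + w * (b + b')).
Proof. by ring. Qed.

Lemma high_energy_sumE c e p w a a' b b' :
  8 * c * (p * (e * (8 * (a + w * b)))) + 8 * c * (p * (e * (8 * (a' + w * b')))) =
  64 * c * e * (p * (a + a' + w * (b + b'))).
Proof. by ring. Qed.

End constants.

Section spectral.
Context {R : realType} {d : nat}.
Local Notation mu := (@lebesgue_rV R d).
Implicit Types (h f g : 'rV[R]_d -> R[i]) (xi : 'rV[R]_d) (b : bool).

Variables (sigma M lo hi : R) (f g : 'rV[R]_d -> R[i]) (u : R -> 'rV[R]_d -> R[i]).
Variable phi : 'rV[R]_d -> R.
Hypothesis sigma01 : 0 < sigma < 1.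
Hypotheses (sf : schwartz f) (sg : schwartz g).
Hypothesis su : schwartz_solution sigma f g u.
Hypothesis mphi : measurable_fun setT phi.
Hypothesis phiM : forall xi, `|phi xi| <= M.
Hypothesis lohi : 0 <= lo <= hi.
Hypothesis phi_supp : forall xi, phi xi != 0 -> lo <= dotr xi xi <= hi.

Let k : R := 1 - 2 * sigma.

(** The symbol of minus the Laplacian, truncated to the frequency band. *)
Let m xi : R := Num.max lo (Num.min (dotr xi xi) hi).

Let mm : measurable_fun setT m.
Proof.
apply: measurable_maxr => //; apply: measurable_minr => //.
apply: measurable_sum => i; apply: measurable_funM; exact: measurable_rV_coord.
Qed.

Let m_bnd xi : lo <= m xi <= hi.
Proof.
have /andP[_ lh] := lohi.
by rewrite /m le_max lexx/= ge_max lh/= ge_min lexx orbT.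
Qed.

Let mE b h xi : m xi * weighted phi b h xi = dotr xi xi * weighted phi b h xi.
Proof.
rewrite /weighted; have [->|/phi_supp/andP[l1 l2]] := eqVneq (phi xi) 0.
  by rewrite mul0r !mulr0.
by rewrite /m min_l// max_r.
Qed.

Definition spectral_mass h : R := rint mu (fun xi => phi xi ^+ 2 * Normc.normc (fourier h xi) ^+ 2).

Lemma weighted_sqi b h : schwartz h -> sqi mu (weighted phi b h).
Proof. by move=> sh; apply: sqi_bndM phiM (schwartz_fourier_sqi b sh). Qed.

Lemma spectral_massE h : schwartz h -> spectral_mass h =
  ip mu (weighted phi true h) (weighted phi true h) +
  ip mu (weighted phi false h) (weighted phi false h).
Proof.
move=> sh; rewrite -rintD; try by apply: integ_sqiM; exact: weighted_sqi.
by apply: eq_rint => xi; rewrite normc_sqr /weighted /fpart; ring.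
Qed.

Lemma spectral_mass_ge0 h : 0 <= spectral_mass h.
Proof. by apply: rint_ge0 => xi; rewrite mulr_ge0// sqr_ge0. Qed.

Let part_lin (a : R) (p q r : R[i]) b :
  part b ((a%:C)%C * (p - q) - r) = a * part b p + (- a) * part b q + (-1) * part b r.
Proof. by move: p q r => [p1 p2] [q1 q2] [r1 r2]; case: b => /=; ring. Qed.

(** Real and imaginary parts of the transform of a solution, cut off by phi,
    solve the hypotheses of the abstract energy estimates: the Fourier transform
    is bounded on L^2, hence carries derivatives and limits in L^2 to the same,
    and the Laplacian becomes multiplication by - |xi|^2. *)
Lemma spectral_energy b : exists v1 : R -> 'rV[R]_d -> R,
  [/\ forall t, 0 < t -> sqi mu (v1 t),
  (forall t, 0 < t -> sq_derivative mu (fun t => weighted phi b (u t)) t (v1 t)),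
  (forall t, 0 < t -> sq_derivative mu v1 t
    (fun xi => - (k / t) * v1 t xi - m xi * weighted phi b (u t) xi)),
  ip mu (fun xi => weighted phi b (u t) xi - weighted phi b f xi)
    (fun xi => weighted phi b (u t) xi - weighted phi b f xi) @[t --> 0^'+] --> (0 : R) &
  ip mu (fun xi => (1 - k)^-1 * t `^ k * v1 t xi - weighted phi b g xi)
    (fun xi => (1 - k)^-1 * t `^ k * v1 t xi - weighted phi b g xi) @[t --> 0^'+] --> (0 : R)].
Proof.
have [u1 [u2 [sch deriv eqn u0 u10]]] := su.
have ic t : 0 < t -> [/\ integC (u t), integC (u1 t) & integC (u2 t)].
  by move=> t0; have [s0 s1 s2] := sch t t0; split; exact: schwartz_integC.
have [icf icg] := (schwartz_integC sf, schwartz_integC sg).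
have tpos t (t0 : 0 < t) : \forall h \near (0 : R)^', 0 < t + h.
  near=> h; suff : `|h| < t by rewrite ltr_norml => /andP[? _]; lra.
  by near: h; apply: dnbhs0_lt.
(* passing from L^2 derivatives of the solution to those of its transform *)
have dq (w w1 : R -> 'rV[R]_d -> R[i]) t : (forall t, 0 < t -> integC (w t)) ->
    integC (w1 t) -> 0 < t -> L2_derivative w t (w1 t) ->
    sq_derivative mu (fun t => weighted phi b (w t)) t (weighted phi b (w1 t)).
  move=> iw iw1 t0 dw; rewrite /sq_derivative.
  have iq : \forall e \near (0 : R)^', integC (fun x => (e^-1)%:C%C * (w (t + e) x - w t x) - w1 t x).
    near=> e; have te : 0 < t + e by near: e; exact: tpos.
    apply: (integC_lin (iw _ te) (iw _ t0) iw1 (a1 := e^-1) (a2 := - e^-1) (a3 := -1)) => b' x.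
    exact: part_lin.
  have := @L2_cvg_weighted R d _ _ _ phi M b mphi phiM iq dw => /(_ _).
  apply: cvg_trans; apply: near_eq_cvg; near=> e.
  have te : 0 < t + e by near: e; exact: tpos.
  have iqe : integC (fun x => (e^-1)%:C%C * (w (t + e) x - w t x) - w1 t x) by near: e.
  suff -> : weighted phi b (fun x => (e^-1)%:C%C * (w (t + e) x - w t x) - w1 t x) =
    quotient_error (fun t => weighted phi b (w t)) (weighted phi b (w1 t)) t e by [].
  apply/funext => xi; rewrite /weighted /quotient_error.
  rewrite (@fpart_lin R d b (e^-1) (- e^-1) (-1) _ (w (t + e)) (w t) (w1 t))//; first by ring.
  - exact: iw.
  - exact: iw.
exists (fun t => weighted phi b (u1 t)); split.
- by move=> t t0; apply: weighted_sqi; have [] := sch t t0.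
- move=> t t0; have [_ i1 _] := ic t t0; have [d1 _ _] := deriv t t0.
  by apply: dq => // s s0; have [] := ic s s0.
- move=> t t0; have [i0 i1 i2] := ic t t0; have [_ d2 _] := deriv t t0.
  rewrite (_ : (fun xi => _ - _) = weighted phi b (u2 t)).
    by apply: dq => // s s0; have [] := ic s s0.
  apply/funext => xi; rewrite mE.
  have [s0 _ _] := sch t t0.
  have le b' x : part b' (laplacian (u t) x) =
     1 * part b' (u2 t x) + k / t * part b' (u1 t x) + 0 * part b' (u1 t x).
    rewrite -(eqn t x t0) -/k.
    by case: (u2 t x) (u1 t x) => [p1 p2] [q1 q2]; case: b' => /=; ring.
  have il := integC_lin i2 i1 i1 le.
  have := fpart_laplacian b xi s0; rewrite (fpart_lin b xi il i2 i1 i1 le) /weighted => E.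
  have -> : fpart b (u2 t) xi = - (dotr xi xi * fpart b (u t) xi) - k / t * fpart b (u1 t) xi.
    by rewrite -E; ring.
  by ring.
- have E t x b' : part b' (u t x - f x) = 1 * part b' (u t x) + (-1) * part b' (f x) + 0 * part b' (f x).
    by case: (u t x) (f x) => [p1 p2] [q1 q2]; case: b' => /=; ring.
  have pos : \forall t \near (0 : R)^'+, 0 < t by exact: nbhs_right_gt.
  have iq : \forall t \near (0 : R)^'+, integC (fun x => u t x - f x).
    near=> t; have t0 : 0 < t by near: t.
    by have [i0 _ _] := ic t t0; exact: (integC_lin i0 icf icf (fun b' x => E t x b')).
  have := @L2_cvg_weighted R d _ _ _ phi M b mphi phiM iq u0 => /(_ _).
  apply: cvg_trans; apply: near_eq_cvg; near=> t.
  have t0 : 0 < t by near: t.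
  have iqt : integC (fun x => u t x - f x) by near: t.
  have [i0 _ _] := ic t t0.
  suff -> : weighted phi b (fun x => u t x - f x) =
    (fun xi => weighted phi b (u t) xi - weighted phi b f xi) by [].
  apply/funext => xi; rewrite /weighted (fpart_lin b xi iqt i0 icf icf (fun b' x => E t x b')).
  by ring.
- have kE : 1 - k = 2 * sigma by rewrite /k; ring.
  have E t x b' : part b' (((2 * sigma)^-1 * t `^ (1 - 2 * sigma))%:C%C * u1 t x - g x) =
     ((1 - k)^-1 * t `^ k) * part b' (u1 t x) + (-1) * part b' (g x) + 0 * part b' (g x).
    by rewrite -/k kE; case: (u1 t x) (g x) => [p1 p2] [q1 q2]; case: b' => /=; ring.
  have pos : \forall t \near (0 : R)^'+, 0 < t by exact: nbhs_right_gt.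
  pose G t x := ((2 * sigma)^-1 * t `^ (1 - 2 * sigma))%:C%C * u1 t x - g x.
  have iq : \forall t \near (0 : R)^'+, integC (G t).
    near=> t; have t0 : 0 < t by near: t.
    by have [_ i1 _] := ic t t0; exact: (integC_lin i1 icg icg (fun b' x => E t x b')).
  have := @L2_cvg_weighted R d _ _ _ phi M b mphi phiM iq u10 => /(_ _).
  apply: cvg_trans; apply: near_eq_cvg; near=> t.
  have t0 : 0 < t by near: t.
  have iqt : integC (G t) by near: t.
  have [_ i1 _] := ic t t0.
  suff -> : weighted phi b (G t) =
    (fun xi => (1 - k)^-1 * t `^ k * weighted phi b (u1 t) xi - weighted phi b g xi) by [].
  apply/funext => xi; rewrite /weighted (fpart_lin b xi iqt i1 icg icg (fun b' x => E t x b')).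
  by ring.
Unshelve. all: by end_near. Qed.

Let k1 : -1 < k < 1.
Proof. by have /andP[h1 h2] := sigma01; rewrite /k; apply/andP; split; lra. Qed.

Let m_ge0 xi : 0 <= m xi <= hi.
Proof. by have /andP[h1 ->] := m_bnd xi; have /andP[l0 _] := lohi; rewrite (le_trans l0). Qed.

Let sv b t : 0 < t -> sqi mu (weighted phi b (u t)).
Proof. by move=> t0; apply: weighted_sqi; have [u1 [u2 [/(_ t t0)[]]]] := su. Qed.

Let data_energy_le b (T0 : R) : 0 < T0 ->
  data_energy mu k (weighted phi b f) (weighted phi b g) T0 <=
  8 * (ip mu (weighted phi b f) (weighted phi b f) +
       T0 `^ (4 * sigma) * ip mu (weighted phi b g) (weighted phi b g)).
Proof.
move=> T00; have /andP[s0 s1] := sigma01.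
have kE : 1 - k = 2 * sigma by rewrite /k; ring.
rewrite /data_energy kE -powR_mulrn ?powR_ge0// -powRrM (_ : 2 * sigma * 2 = 4 * sigma); last by ring.
exact: data_energy_bound (ip_ge0 _ _) (ip_ge0 _ _) (powR_ge0 _ _).
Qed.

Lemma spectral_low (T0 : R) : 0 < T0 -> hi <= T0 ^- 2 ->
  spectral_mass (u T0) <= 8 * expR (low_const k) * (spectral_mass f + T0 `^ (4 * sigma) * spectral_mass g).
Proof.
move=> T00 hT.
have B b : ip mu (weighted phi b (u T0)) (weighted phi b (u T0)) <=
    expR (low_const k) * (8 * (ip mu (weighted phi b f) (weighted phi b f) +
       T0 `^ (4 * sigma) * ip mu (weighted phi b g) (weighted phi b g))).
  have [v1 [h1 h2 h3 h4 h5]] := spectral_energy b.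
  have mT xi : m xi <= T0 ^- 2 by have /andP[_ h] := m_bnd xi; exact: le_trans hT.
  have H := solution_low k1 mm m_ge0 (sv b) h1 h2 h3 (weighted_sqi b sf) (weighted_sqi b sg) h4 h5 T00 mT.
  have : expR (low_const k) * data_energy mu k (weighted phi b f) (weighted phi b g) T0 <=
    expR (low_const k) * (8 * (ip mu (weighted phi b f) (weighted phi b f) +
       T0 `^ (4 * sigma) * ip mu (weighted phi b g) (weighted phi b g))).
    by rewrite ler_wpM2l ?expR_ge0// data_energy_le.
  apply: le_trans; apply: le_trans H; rewrite lerDl mulr_ge0 ?sqr_ge0//.
  exact: ip_ge0.
have [u1 [u2 [/(_ T0 T00)[su0 _ _] _ _ _ _]]] := su.
rewrite !spectral_massE//; apply: (le_trans (lerD (B true) (B false))).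
by rewrite low_energy_sumE.
Qed.

Lemma spectral_high (r t : R) : 0 < r -> (2 * r)^-1 <= t -> r ^+ 2 <= lo -> hi <= (2 * r) ^+ 2 ->
  t `^ k * spectral_mass (u t) <= 64 * expR (3 / 2) * expR (low_const k) * ((2 * r)^-1 `^ k *
    (spectral_mass f + ((2 * r)^-1) `^ (4 * sigma) * spectral_mass g)).
Proof.
move=> r0 rt rlo rhi.
have T00 : 0 < (2 * r)^-1 by rewrite invr_gt0 mulr_gt0.
have t0 : 0 < t by exact: lt_le_trans rt.
have B b : t `^ k * ip mu (weighted phi b (u t)) (weighted phi b (u t)) <=
    8 * expR (3 / 2) * ((2 * r)^-1 `^ k * (expR (low_const k) *
      (8 * (ip mu (weighted phi b f) (weighted phi b f) +
       (2 * r)^-1 `^ (4 * sigma) * ip mu (weighted phi b g) (weighted phi b g))))).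
  have [v1 [h1 h2 h3 h4 h5]] := spectral_energy b.
  have mr xi : r ^+ 2 <= m xi <= (2 * r) ^+ 2.
    by have /andP[a1 a2] := m_bnd xi; rewrite (le_trans rlo)// (le_trans a2).
  have H := solution_high k1 mm m_ge0 (sv b) h1 h2 h3 (weighted_sqi b sf) (weighted_sqi b sg) h4 h5 r0 rt mr.
  apply: (le_trans H); rewrite ler_wpM2l ?mulr_ge0 ?expR_ge0// ler_wpM2l ?powR_ge0//.
  by rewrite ler_wpM2l ?expR_ge0// data_energy_le.
have [u1 [u2 [/(_ t t0)[su0 _ _] _ _ _ _]]] := su.
rewrite !spectral_massE// mulrDr; apply: (le_trans (lerD (B true) (B false))).
by rewrite high_energy_sumE.
Qed.

End spectral.

(** * Comparison of the multipliers with Sobolev weights *)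

Section weights.
Context {R : realType}.
Implicit Types s t x J tau kap : R.

Lemma powR_lel (x y a : R) : 0 <= a -> 0 <= x -> x <= y -> x `^ a <= y `^ a.
Proof. by move=> a0 x0 xy; apply: ge0_ler_powR; rewrite ?nnegrE// (le_trans x0). Qed.

Lemma powR_pos_add (x a b : R) : 0 < x -> x `^ (a + b) = x `^ a * x `^ b.
Proof. by move=> x0; apply: powRD; rewrite (gt_eqF x0) implybT. Qed.

Lemma powR2_le16 (a : R) : a <= 4 -> 2 `^ a <= 16 :> R.
Proof.
move=> a4; apply: (@le_trans _ _ (2 `^ (4%N)%:R)); first by rewrite ler_powR// ler1n.
by rewrite powR_mulrn//; lra.
Qed.

(** When J <= 2, the factor J^(2s) is at most 2^(2s) and tau <= t; otherwise
    (tau J)^x <= 2^x <= 16, which trades the power of tau for one of J. *)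
Lemma data_weight_le s x kap t tau J : 0 <= s -> 0 <= x <= 4 -> 0 < tau <= t -> 1 <= J ->
  J <= 2 \/ tau <= 2 / J ->
  t `^ (2 * kap) * tau `^ x * J `^ (2 * s) <=
  (2 `^ (2 * s) + 16) * (t `^ (2 * kap) * t `^ x + t `^ (2 * kap) * J `^ (2 * s - x)).
Proof.
move=> s0 /andP[x0 x4] /andP[tau0 taut] J1 H.
have J0 : 0 < J by exact: lt_le_trans J1.
have t0 : 0 < t by exact: lt_le_trans taut.
rewrite -mulrDr mulrCA -mulrA ler_wpM2l ?powR_ge0//.
set A := 2 `^ (2 * s); have A0 : 0 <= A by exact: powR_ge0.
have B0 : 0 <= J `^ (2 * s - x) by exact: powR_ge0.
have C0 : 0 <= t `^ x by exact: powR_ge0.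
case: H => [J2|tJ].
  apply: (@le_trans _ _ (t `^ x * A)).
    apply: ler_pM; rewrite ?powR_ge0//; apply: powR_lel => //; first exact: ltW.
      by rewrite mulr_ge0.
    exact: ltW.
  by nra.
apply: (@le_trans _ _ (16 * J `^ (2 * s - x))); last by nra.
rewrite (_ : J `^ (2 * s) = J `^ x * J `^ (2 * s - x)); last first.
  by rewrite -powR_pos_add//; congr (_ `^ _); ring.
rewrite mulrA ler_wpM2r// -powRM ?(ltW tau0) ?(ltW J0)//.
apply: (@le_trans _ _ (2 `^ x)); last exact: powR2_le16.
by apply: powR_lel => //; [rewrite mulr_ge0 ?(ltW tau0) ?(ltW J0)|rewrite -ler_pdivlMr].
Qed.

Lemma solution_weight_le s kap t J : 0 <= kap -> 0 < t -> 1 <= J ->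
  J `^ (2 * s) <= (1 + t) `^ (2 * kap) * J `^ (2 * s + 2 * kap).
Proof.
move=> k0 t0 J1; have J0 : 0 < J by exact: lt_le_trans J1.
have k20 : 0 <= 2 * kap by rewrite mulr_ge0.
rewrite -[X in X <= _]mul1r; apply: ler_pM; rewrite ?powR_ge0//.
  by rewrite -[X in X <= _](powRr0 (1 + t)) ler_powR//; lra.
by rewrite ler_powR//; lra.
Qed.

(** Here e is the upper end of a dyadic band, so that e t is t |xi| up to a
    factor 2, and t |xi| <= (1+t) J. *)
Lemma solution_weight_high_le s kap t J e : 0 <= kap <= 1 -> 0 < t -> 1 <= J ->
  0 < e -> e <= 2 * J ->
  (e * t) `^ (2 * kap) * J `^ (2 * s) <= 4 * ((1 + t) `^ (2 * kap) * J `^ (2 * s + 2 * kap)).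
Proof.
move=> /andP[k0 k1] t0 J1 e0 eJ; have J0 : 0 < J by exact: lt_le_trans J1.
have k20 : 0 <= 2 * kap by rewrite mulr_ge0.
rewrite powR_pos_add// [J `^ _ * _]mulrC mulrA mulrA ler_wpM2r ?powR_ge0//.
apply: (@le_trans _ _ ((2 * ((1 + t) * J)) `^ (2 * kap))).
  apply: powR_lel => //; first by rewrite mulr_ge0 ?ltW.
  nra.
have t10 : 0 <= 1 + t by lra.
rewrite powRM//; last by rewrite mulr_ge0// ltW.
rewrite powRM//; last exact: ltW.
rewrite mulrA ler_wpM2r ?powR_ge0// ler_wpM2r ?powR_ge0//.
apply: (@le_trans _ _ (2 `^ (2%N)%:R)); first by rewrite ler_powR ?ler1n//; lra.
by rewrite powR_mulrn//; lra.
Qed.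

End weights.

(** * Summation over dyadic frequency bands *)

Section bands.
Context {dsp : measure_display} {T : measurableType dsp} {R : realType}.
Variable mu : {measure set T -> \bar R}.

Lemma measurable_seqD (S : (set T)^nat) : (forall n, measurable (S n)) ->
  forall n, measurable (seqD S n).
Proof. by move=> mS [|n] //=; exact: measurableD. Qed.

(** The differences of consecutive sets S_n are disjoint and cover the space. *)
Lemma integral_bands_le (S : (set T)^nat) (F G : T -> \bar R) :
  (forall n, measurable (S n)) -> {homo S : n m / (n <= m)%N >-> (n <= m)%O} ->
  \bigcup_n S n = setT ->
  measurable_fun setT F -> measurable_fun setT G ->
  (forall x, 0 <= F x)%E -> (forall x, 0 <= G x)%E ->
  (forall n, \int[mu]_(x in seqD S n) F x <= \int[mu]_(x in seqD S n) G x)%E ->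
  (\int[mu]_x F x <= \int[mu]_x G x)%E.
Proof.
move=> mS ndS coverS mF mG F0 G0 FG.
have mD := measurable_seqD mS.
rewrite -coverS -eq_bigcup_seqD.
rewrite !ge0_integral_bigcup//; try by [exact: trivIset_seqD|rewrite eq_bigcup_seqD coverS].
by apply: lee_nneseries => // n _ _; exact: integral_ge0.
Qed.

End bands.

Section multiplier_bound.
Context {R : realType} {d : nat}.
Local Notation mu := (@lebesgue_rV R d).
Local Notation N h xi := (Normc.normc (fourier h xi)).
Implicit Types (xi : 'rV[R]_d) (h : 'rV[R]_d -> R[i]).

Lemma dotr_ge0 xi : 0 <= dotr xi xi.
Proof. by apply: sumr_ge0 => i _; rewrite -expr2 sqr_ge0. Qed.

Lemma japanese_sqr xi : japanese xi ^+ 2 = 1 + dotr xi xi.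
Proof. by rewrite /japanese /enorm !sqr_sqrtr// ?addr_ge0 ?sqr_ge0// dotr_ge0. Qed.

Lemma japanese_ge1 xi : 1 <= japanese xi.
Proof.
rewrite -(@ler_pXn2r _ 2) ?nnegrE ?sqrtr_ge0// expr1n japanese_sqr lerDl.
exact: dotr_ge0.
Qed.

Lemma japanese_le xi (a : R) : 0 <= a -> 1 + dotr xi xi <= a ^+ 2 -> japanese xi <= a.
Proof. by move=> a0; rewrite -japanese_sqr ler_pXn2r// nnegrE sqrtr_ge0. Qed.

Lemma measurable_dotr_diag : measurable_fun setT (fun xi : 'rV[R]_d => dotr xi xi).
Proof. by apply: measurable_sum => i; apply: measurable_funM; exact: measurable_rV_coord. Qed.

Lemma measurable_japanese_powR (a : R) : measurable_fun setT (fun xi : 'rV[R]_d => japanese xi `^ a).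
Proof.
apply: (measurableT_comp (measurable_powR a)).
rewrite (_ : japanese = fun xi : 'rV[R]_d => Num.sqrt (1 + dotr xi xi)); last first.
  by apply/funext => xi; rewrite /japanese /enorm sqr_sqrtr// dotr_ge0.
apply: (measurableT_comp (continuous_measurable_fun (@sqrt_continuous R))).
by apply: measurable_funD => //; exact: measurable_dotr_diag.
Qed.

Lemma measurable_norm_fourier h : schwartz h -> measurable_fun setT (fun xi => N h xi ^+ 2).
Proof. by move=> sh; exact: (measurable_normc_fourier (schwartz_integC sh)). Qed.

Variables (sigma s : R).
Hypotheses (sigma01 : 0 < sigma < 1) (s0 : 0 <= s).

(** The loss of derivatives, which is nonzero only for sigma > 1/2. *)
Definition loss : R := Num.max 0 (sigma - 2^-1).

Let kap := loss.
Let x := 4 * sigma - 2 * kap.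

Let kap_bnd : [/\ 0 <= kap, kap <= 1, 2 * sigma - 1 <= 2 * kap & 0 <= x <= 4].
Proof.
have /andP[h0 h1] := sigma01; rewrite /x /kap /loss.
by case: (leP 0 (sigma - 2^-1)) => h; split; try (apply/andP; split); lra.
Qed.

Definition energy_cst : R := 64 * expR (3 / 2) * expR (low_const (1 - 2 * sigma)).
Definition band_cst : R := energy_cst * (2 `^ (2 * s) + 20).

Let E0_gt0 : 0 < energy_cst.
Proof. by rewrite !mulr_gt0 ?expR_gt0. Qed.

Let wf t xi : R := (1 + t) `^ (2 * kap) * japanese xi `^ (2 * s + 2 * kap).
Let wg t xi : R := t `^ (2 * kap) * t `^ x + t `^ (2 * kap) * japanese xi `^ (2 * s - x).

Let wf0 t xi : 0 <= wf t xi. Proof. by rewrite mulr_ge0 ?powR_ge0. Qed.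
Let wg0 t xi : 0 <= wg t xi. Proof. by rewrite addr_ge0 ?mulr_ge0 ?powR_ge0. Qed.

Section band.
Variables (f g : 'rV[R]_d -> R[i]) (u : R -> 'rV[R]_d -> R[i]) (t : R).
Hypotheses (sf : schwartz f) (sg : schwartz g) (su : schwartz_solution sigma f g u).
Hypothesis t0 : 0 < t.

Let sut : schwartz (u t).
Proof. by have [u1 [u2 [/(_ t t0)[]]]] := su. Qed.

Variables (D : set 'rV[R]_d) (lo hi : R).
Hypothesis mD : measurable D.
Hypothesis D_band : forall xi, D xi -> lo <= dotr xi xi <= hi.

Let phi xi : R := \1_D xi * japanese xi `^ s.

Lemma band_weight_measurable : measurable_fun setT phi.
Proof. by apply: measurable_funM => //; exact: measurable_japanese_powR. Qed.

Lemma band_weight_le xi : `|phi xi| <= (1 + hi) `^ s.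
Proof.
rewrite /phi indicE; case: (boolP (xi \in D)); rewrite ?mul0r ?normr0 ?powR_ge0//.
rewrite inE => /D_band/andP[_ h]; rewrite mul1r ger0_norm ?powR_ge0//.
apply: powR_lel => //; first by rewrite (le_trans ler01)// japanese_ge1.
have q0 := dotr_ge0 xi.
by apply: japanese_le; [lra|nra].
Qed.

Lemma band_weight_supp xi : phi xi != 0 -> lo <= dotr xi xi <= hi.
Proof.
rewrite /phi indicE; case: (boolP (xi \in D)); last by rewrite mul0r eqxx.
by rewrite inE => /D_band.
Qed.

Lemma band_weight_sqr xi : phi xi ^+ 2 = \1_D xi * japanese xi `^ (2 * s).
Proof.
have -> : japanese xi `^ (2 * s) = (japanese xi `^ s) ^+ 2.
  by rewrite -powR_mulrn ?powR_ge0// -powRrM mulrC.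
by rewrite /phi exprMn indicE; case: (xi \in D); rewrite ?expr1n ?expr0n.
Qed.

Let ispec h : schwartz h -> integ mu (fun xi => phi xi ^+ 2 * N h xi ^+ 2).
Proof.
move=> sh; have sw b := weighted_sqi band_weight_measurable band_weight_le b sh.
apply: eq_integ (integD (sw true).2 (sw false).2) => xi.
by rewrite normc_sqr /weighted /fpart; ring.
Qed.

(** The inequality between masses is one between integrals over the band, with
    constant coefficients A and B; these are then bounded pointwise by the
    weights of the theorem. *)
Lemma band_integral_le (A B : R) : 0 <= A -> 0 <= B ->
  spectral_mass phi (u t) <= A * spectral_mass phi f + B * spectral_mass phi g ->
  (forall xi, D xi -> A * japanese xi `^ (2 * s) <= band_cst * wf t xi) ->
  (forall xi, D xi -> B * japanese xi `^ (2 * s) <= band_cst * wg t xi) ->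
  (\int[mu]_(xi in D) (japanese xi `^ (2 * s) * N (u t) xi ^+ 2)%:E <=
   \int[mu]_(xi in D) (band_cst * (wf t xi * N f xi ^+ 2 + wg t xi * N g xi ^+ 2))%:E)%E.
Proof.
move=> A0 B0 H HA HB.
have E : (\int[mu]_(xi in D) (japanese xi `^ (2 * s) * N (u t) xi ^+ 2)%:E =
    (spectral_mass phi (u t))%:E)%E.
  rewrite integral_mkcond -rint_EFin; last exact: ispec.
  apply: eq_integral => xi _; rewrite band_weight_sqr patchE indicE.
  by case: ifPn => _; rewrite ?mul1r ?mul0r.
rewrite E; apply: (@le_trans _ _ (A * spectral_mass phi f + B * spectral_mass phi g)%:E); first by rewrite lee_fin.
have [i1 i2] := (ispec sf, ispec sg).
have iAB := integD (integZ A i1) (integZ B i2).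
rewrite -!rintZ// -rintD; [|exact: integZ..].
rewrite -(rint_EFin iAB) [X in (_ <= X)%E]integral_mkcond.
have mW : measurable_fun setT (fun xi => band_cst * (wf t xi * N f xi ^+ 2 + wg t xi * N g xi ^+ 2)).
  apply: measurable_funM => //; apply: measurable_funD.
    apply: measurable_funM; last exact: measurable_norm_fourier.
    by apply: measurable_funM => //; exact: measurable_japanese_powR.
  apply: measurable_funM; last exact: measurable_norm_fourier.
  apply: measurable_funD => //; apply: measurable_funM => //; exact: measurable_japanese_powR.
apply: ge0_le_integral => //.
- by move=> xi _; rewrite lee_fin addr_ge0// mulr_ge0// mulr_ge0// sqr_ge0.
- by apply/measurable_EFinP; exact: integ_meas iAB.
- by apply/(measurable_restrictT _ _).1 => //; apply/measurable_EFinP; exact: measurable_funTS.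
move=> xi _; rewrite !band_weight_sqr patchE indicE.
case: (boolP (xi \in D)) => [/set_mem Dxi|_]; last first.
  by rewrite /= !mul0r !mulr0 addr0; exact: (lexx (0%E : \bar R)).
rewrite lee_fin /= !mul1r [X in _ <= X]mulrDr; apply: lerD.
  rewrite [A * _]mulrA [X in _ <= X]mulrA.
  by apply: ler_wpM2r; [exact: sqr_ge0|exact: HA].
rewrite [B * _]mulrA [X in _ <= X]mulrA.
by apply: ler_wpM2r; [exact: sqr_ge0|exact: HB].
Qed.

End band.

Lemma powR_invl (y a : R) : 0 < y -> y^-1 `^ a = y `^ (- a).
Proof. by move=> y0; rewrite -[y^-1](powR_inv1 (ltW y0)) -powRrM mulN1r. Qed.

Let bcstE (a b : R) : a <= energy_cst -> 0 <= b -> b <= 2 `^ (2 * s) + 20 -> a * b <= band_cst.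
Proof.
move=> ha hb hb'; apply: (@le_trans _ _ (energy_cst * b)); first by rewrite ler_wpM2r.
by rewrite ler_wpM2l// ltW.
Qed.

Let low_cst_le : 8 * expR (low_const (1 - 2 * sigma)) <= energy_cst.
Proof.
rewrite /energy_cst ler_wpM2r ?expR_ge0//.
have : 1 <= expR (3 / 2) :> R by rewrite -expR0 ler_expR divr_ge0.
by move=> h; lra.
Qed.

Let p20 : 0 <= 2 `^ (2 * s) :> R. Proof. exact: powR_ge0. Qed.

Section bounds.
Variables (f g : 'rV[R]_d -> R[i]) (u : R -> 'rV[R]_d -> R[i]) (t : R).
Hypotheses (sf : schwartz f) (sg : schwartz g) (su : schwartz_solution sigma f g u).
Hypothesis t0 : 0 < t.

Let F xi : \bar R := (japanese xi `^ (2 * s) * N (u t) xi ^+ 2)%:E.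
Let G xi : \bar R := (band_cst * (wf t xi * N f xi ^+ 2 + wg t xi * N g xi ^+ 2))%:E.

(** Here [data_weight_le] is applied with tau = t: on this band either |xi| <= 1
    and J <= 2, or J <= 2 |xi| <= 2/t. *)
Lemma low_band_le (D : set 'rV[R]_d) : measurable D ->
  (forall xi, D xi -> dotr xi xi <= t ^- 2) ->
  (\int[mu]_(xi in D) F xi <= \int[mu]_(xi in D) G xi)%E.
Proof.
move=> mD HD; have [k0 k1 k2 /andP[x0 x4]] := kap_bnd.
have t20 : 0 < t ^- 2 by rewrite invr_gt0 exprn_gt0.
have lohi : (0 : R) <= 0 <= t ^- 2 by rewrite lexx ltW.
have Db xi : D xi -> 0 <= dotr xi xi <= t ^- 2 by move=> Dx; rewrite dotr_ge0 HD.
have J0 xi : 0 <= japanese xi `^ (2 * s) by exact: powR_ge0.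
set A := 8 * expR (low_const (1 - 2 * sigma)).
have A0 : 0 <= A by rewrite mulr_ge0// expR_ge0.
apply: (@band_integral_le f g u t sf sg su t0 D 0 (t ^- 2) mD Db A (A * t `^ (4 * sigma))) => //.
- by rewrite mulr_ge0// powR_ge0.
- have := @spectral_low _ _ sigma _ 0 (t ^- 2) f g u _ sigma01 sf sg su
    (band_weight_measurable mD) (band_weight_le Db) lohi (band_weight_supp Db) t t0 (lexx _).
  by rewrite -/A mulrDr mulrA.
- move=> xi Dx; have h := solution_weight_le s k0 t0 (japanese_ge1 xi).
  apply: (@le_trans _ _ (A * wf t xi)); first by rewrite ler_wpM2l.
  rewrite ler_wpM2r// -[A]mulr1; apply: bcstE; [exact: low_cst_le|exact: ler01|move: p20; lra].
- move=> xi Dx.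
  have h : t `^ (2 * kap) * t `^ x * japanese xi `^ (2 * s) <=
      (2 `^ (2 * s) + 16) * wg t xi.
    apply: data_weight_le => //; [by rewrite x0|by rewrite t0 lexx|exact: japanese_ge1|].
    have q0 := dotr_ge0 xi; have qt := HD xi Dx.
    have [q1|q1] := leP (dotr xi xi) 1; [left; apply: japanese_le => //; lra|right].
    rewrite ler_pdivlMr; last exact: lt_le_trans (japanese_ge1 xi).
    rewrite mulrC -ler_pdivlMr//; apply: japanese_le; first by rewrite divr_ge0// ltW.
    by rewrite expr_div_n; lra.
  rewrite (_ : 4 * sigma = 2 * kap + x); last by rewrite /x; ring.
  rewrite powR_pos_add// -mulrA.
  apply: (@le_trans _ _ (A * ((2 `^ (2 * s) + 16) * wg t xi))); first by rewrite ler_wpM2l.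
  by rewrite mulrA ler_wpM2r//; apply: bcstE; [exact: low_cst_le|move: p20; lra|move: p20; lra].
Qed.

(** Here [data_weight_le] is applied with tau = 1/e, the inverse of the upper
    end of the band, and (e t)^(2 sigma - 1) <= (e t)^(2 kap) since e t >= 1. *)
Lemma high_band_le (D : set 'rV[R]_d) (e : R) : measurable D -> 0 < e -> 1 <= e * t ->
  (forall xi, D xi -> (e / 2) ^+ 2 <= dotr xi xi <= e ^+ 2) ->
  (\int[mu]_(xi in D) F xi <= \int[mu]_(xi in D) G xi)%E.
Proof.
move=> mD e0 et1 HD; have [k0 k1 k2 /andP[x0 x4]] := kap_bnd.
have et0 : 0 < e * t by rewrite mulr_gt0.
have lohi : 0 <= (e / 2) ^+ 2 <= e ^+ 2.
  have e20 : 0 <= e / 2 by rewrite divr_ge0// ltW.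
  by rewrite sqr_ge0/= ler_pXn2r ?nnegrE ?(ltW e0)// ler_pdivrMr// ler_peMr ?ler1n// ltW.
have J0 xi : 0 <= japanese xi `^ (2 * s) by exact: powR_ge0.
have r0 : 0 < e / 2 by rewrite divr_gt0.
have e2 : 2 * (e / 2) = e by field.
have rt : (2 * (e / 2))^-1 <= t by rewrite e2 -[e^-1]mul1r ler_pdivrMr// mulrC.
have Q0 h := @spectral_mass_ge0 R d (fun xi => \1_D xi * japanese xi `^ s) h.
pose y : R := e * t.
have yk : y `^ (- (1 - 2 * sigma)) <= y `^ (2 * kap) by rewrite ler_powR//; lra.
set A := energy_cst * y `^ (2 * kap).
have A0 : 0 <= A by rewrite mulr_ge0 ?powR_ge0// ltW.
apply: (@band_integral_le f g u t sf sg su t0 D _ _ mD HD A (A * e^-1 `^ (4 * sigma))) => //.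
- by rewrite mulr_ge0// powR_ge0.
- have := @spectral_high _ _ sigma _ ((e / 2) ^+ 2) (e ^+ 2) f g u _ sigma01 sf sg su
    (band_weight_measurable mD) (band_weight_le HD) lohi (band_weight_supp HD) (e / 2) t r0 rt (lexx _).
  rewrite e2 => /(_ (lexx _)).
  set k := 1 - 2 * sigma; set Qu := spectral_mass _ _; set Qf := spectral_mass _ f; set Qg := spectral_mass _ g.
  rewrite -/energy_cst -/k.
  have -> : t `^ k = e^-1 `^ k * y `^ k.
    rewrite -powRM ?invr_ge0 ?(ltW e0) ?(ltW et0)//.
    by rewrite /y mulKf// gt_eqF.
  have ek0 : 0 < e^-1 `^ k by rewrite powR_gt0// invr_gt0.
  rewrite mulrCA -mulrA ler_pM2l// => H.
  have yk0 : 0 < y `^ k by exact: powR_gt0.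
  have S0 : 0 <= Qf + e^-1 `^ (4 * sigma) * Qg.
    by rewrite addr_ge0 ?Q0// mulr_ge0 ?powR_ge0// Q0.
  rewrite -mulrA -mulrDr.
  apply: (@le_trans _ _ (energy_cst * y `^ (- k) * (Qf + e^-1 `^ (4 * sigma) * Qg))).
    by rewrite powRN mulrAC ler_pdivlMr// mulrC.
  by rewrite ler_wpM2r// ler_wpM2l// ltW.
- move=> xi Dx; have J1 := japanese_ge1 xi.
  have eJ : e <= 2 * japanese xi.
    rewrite mulrC -ler_pdivrMr// -(@ler_pXn2r _ 2) ?nnegrE ?(ltW r0) ?sqrtr_ge0//.
    by rewrite japanese_sqr; have /andP[h _] := HD xi Dx; lra.
  have h := @solution_weight_high_le R s kap t (japanese xi) e (introT andP (conj k0 k1)) t0 J1 e0 eJ.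
  rewrite /A -mulrA; apply: (@le_trans _ _ (energy_cst * (4 * wf t xi))).
    by rewrite ler_wpM2l// ltW.
  by rewrite mulrA ler_wpM2r//; apply: bcstE; [exact: lexx|move: p20; lra|move: p20; lra].
- move=> xi Dx; have J1 := japanese_ge1 xi.
  have ei0 : 0 < e^-1 by rewrite invr_gt0.
  have h : t `^ (2 * kap) * e^-1 `^ x * japanese xi `^ (2 * s) <=
      (2 `^ (2 * s) + 16) * wg t xi.
    apply: data_weight_le => //; first by rewrite x0.
      by rewrite ei0/= -e2.
    have /andP[_ qe] := HD xi Dx.
    have [e1|e1] := leP e 1; [left; apply: japanese_le => //|right].
      have e21 : e ^+ 2 <= 1 by rewrite expr_le1// ltW.
      by lra.
    rewrite ler_pdivlMr; last exact: lt_le_trans J1.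
    rewrite mulrC ler_pdivrMr//; apply: japanese_le; first by rewrite mulr_ge0// ltW.
    have e21 : 1 <= e ^+ 2 by rewrite expr_ge1// ltW.
    by rewrite exprMn; lra.
  have -> : A * e^-1 `^ (4 * sigma) = energy_cst * (t `^ (2 * kap) * e^-1 `^ x).
    have -> : e^-1 `^ x = e `^ (2 * kap) * e^-1 `^ (4 * sigma).
      by rewrite !powR_invl// -powR_pos_add//; congr (_ `^ _); rewrite /x; ring.
    by rewrite /A /y powRM ?(ltW e0) ?(ltW t0)//; ring.
  rewrite -mulrA.
  apply: (@le_trans _ _ (energy_cst * ((2 `^ (2 * s) + 16) * wg t xi))).
    by rewrite ler_wpM2l// ltW.
  by rewrite mulrA ler_wpM2r//; apply: bcstE; [exact: lexx|move: p20; lra|move: p20; lra].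
Qed.

End bounds.
End multiplier_bound.

Section total.
Context {R : realType} {d : nat}.
Local Notation mu := (@lebesgue_rV R d).
Local Notation N h xi := (Normc.normc (fourier h xi)).
Local Open Scope ereal_scope.

(** The bands are the differences of the balls of radii 2^n / t. *)
Lemma solution_energy_le (sigma s : R) (f g : 'rV[R]_d -> R[i]) (u : R -> 'rV[R]_d -> R[i]) (t : R) :
  (0 < sigma < 1)%R -> (0 <= s)%R -> schwartz f -> schwartz g -> schwartz_solution sigma f g u ->
  (0 < t)%R ->
  \int[mu]_xi (japanese xi `^ (2 * s) * N (u t) xi ^+ 2)%R%:E <=
  \int[mu]_xi (band_cst sigma s *
    ((1 + t) `^ (2 * loss sigma) * japanese xi `^ (2 * s + 2 * loss sigma) * N f xi ^+ 2 +
    (t `^ (2 * loss sigma) * t `^ (4 * sigma - 2 * loss sigma) +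
     t `^ (2 * loss sigma) * japanese xi `^ (2 * s - (4 * sigma - 2 * loss sigma))) * N g xi ^+ 2))%R%:E.
Proof.
move=> sig s0 sf sg su t0.
have sut : schwartz (u t) by have [u1 [u2 [/(_ t t0)[]]]] := su.
have J0 a (xi : 'rV[R]_d) : (0 <= japanese xi `^ a)%R by exact: powR_ge0.
have B0 : (0 <= band_cst sigma s)%R.
  by rewrite mulr_ge0 ?addr_ge0 ?powR_ge0// !mulr_ge0 ?expR_ge0.
pose S (n : nat) : set 'rV[R]_d := [set xi | dotr xi xi < (2 ^+ n / t) ^+ 2]%R.
have e0 n : (0 < 2 ^+ n / t :> R)%R by rewrite divr_gt0// exprn_gt0.
have mS n : measurable (S n).
  rewrite [X in measurable X](_ : _ = (fun xi => dotr xi xi) @^-1` `]-oo, ((2 ^+ n / t) ^+ 2)%R[).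
    by rewrite -[X in measurable X]setTI; exact: measurable_dotr_diag.
  by apply/seteqP; split=> xi /=; rewrite in_itv.
have mF : measurable_fun setT (fun xi : 'rV[R]_d => (japanese xi `^ (2 * s) * N (u t) xi ^+ 2)%R%:E).
  apply/measurable_EFinP; apply: measurable_funM; first exact: measurable_japanese_powR.
  exact: measurable_norm_fourier.
apply: (integral_bands_le mS) => //.
- move=> n m nm; apply/subsetPset => xi /= /lt_le_trans; apply.
  rewrite ler_pXn2r ?nnegrE ?(ltW (e0 _))// ler_wpM2r ?invr_ge0 ?(ltW t0)//.
  by rewrite ler_weXn2l// ler1n.
- apply/seteqP; split=> // xi _.
  exists (Num.bound (t ^+ 2 * dotr xi xi)) => //=; set n := Num.bound _.
  have nb : (t ^+ 2 * dotr xi xi < n%:R)%R.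
    by apply: archi_boundP; rewrite mulr_ge0 ?dotr_ge0// sqr_ge0.
  rewrite /S/= expr_div_n ltr_pdivlMr ?exprn_gt0// mulrC (lt_le_trans nb)//.
  apply: (@le_trans _ _ (2 ^+ n)%R).
    by rewrite -natrX ler_nat ltnW// ltn_expl.
  by rewrite -exprM ler_weXn2l ?ler1n// leq_pmulr.
- apply/measurable_EFinP; apply: measurable_funM => //; apply: measurable_funD.
    apply: measurable_funM; last exact: measurable_norm_fourier.
    by apply: measurable_funM => //; exact: measurable_japanese_powR.
  apply: measurable_funM; last exact: measurable_norm_fourier.
  apply: measurable_funD => //; apply: measurable_funM => //; exact: measurable_japanese_powR.
- by move=> xi; rewrite lee_fin mulr_ge0// sqr_ge0.
- move=> xi; rewrite lee_fin mulr_ge0// addr_ge0// mulr_ge0 ?sqr_ge0//.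
    by rewrite mulr_ge0// powR_ge0.
  by rewrite addr_ge0// mulr_ge0 ?powR_ge0.
move=> [|n].
  apply: (low_band_le sig s0 sf sg su t0); first exact: mS.
  by move=> xi /ltW; rewrite expr0 div1r exprVn.
apply: (high_band_le sig s0 sf sg su t0 (measurableD (mS _) (mS _)) (e0 n.+1)).
  by rewrite divfK ?gt_eqF// exprn_ege1// ler1n.
move=> xi /= [h1 h2]; rewrite (ltW h1) andbT.
have -> : (2 ^+ n.+1 / t / 2 = 2 ^+ n / t :> R)%R.
  by rewrite exprS; field; rewrite gt_eqF.
by rewrite leNgt; apply/negP.
Qed.

(** Squares of norms are compared first; infinite norms make the right-hand
    side infinite. *)
Lemma le_sum3_of_sqr (a X Y Z : \bar R) (C : R) : (0 < C)%R ->
  0 <= a -> 0 <= X -> 0 <= Y -> 0 <= Z ->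
  a `^ 2 <= (C ^+ 2)%R%:E * (X `^ 2 + Y `^ 2 + Z `^ 2) -> a <= C%:E * (X + Y + Z).
Proof.
move=> C0 a0 X0 Y0 Z0.
have top (b c : \bar R) : 0 <= b -> 0 <= c -> a <= C%:E * (+oo + b + c).
  move=> b0 c0.
  have nb : b != -oo by apply: contraTneq b0 => ->.
  have nc : c != -oo by apply: contraTneq c0 => ->.
  by rewrite !addye// gt0_muley ?lte_fin// leey.
case: X X0 => [X| |]//; last first.
  by move=> _ _; exact: top.
case: Y Y0 => [Y| |]//; last first.
  by move=> _ X0 _; rewrite [X%:E + _]addeC; exact: top.
case: Z Z0 => [Z| |]//; last first.
  by move=> _ Y0 X0 _; rewrite addeC addeA; exact: top.
rewrite !poweR_EFin -!EFinD -!EFinM !lee_fin => Z0 Y0 X0.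
case: a a0 {top} => [a| |]// a0; rewrite ?poweR_EFin ?lee_fin.
  rewrite !powR_mulrn// => H.
  have XY : (0 <= X * Y)%R by exact: mulr_ge0.
  have XZ : (0 <= X * Z)%R by exact: mulr_ge0.
  have YZ : (0 <= Y * Z)%R by exact: mulr_ge0.
  have s0 : (0 <= X + Y + Z)%R by rewrite !addr_ge0.
  rewrite -(@ler_pXn2r _ 2) ?nnegrE ?mulr_ge0 ?(ltW C0)//.
  apply: (le_trans H); rewrite exprMn ler_wpM2l ?sqr_ge0//.
  by rewrite (_ : (X + Y + Z) ^+ 2 = X ^+ 2 + Y ^+ 2 + Z ^+ 2 + 2 * (X * Y + X * Z + Y * Z))%R; [lra|ring].
by rewrite poweRyr// leye_eq.
Qed.

Lemma sobolev_norm_sqr (r : R) (h : 'rV[R]_d -> R[i]) :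
  sobolev_norm r h `^ 2 = \int[mu]_xi (japanese xi `^ (2 * r) * N h xi ^+ 2)%R%:E.
Proof.
rewrite -Lnorm2_sqr; last by move=> xi; rewrite mulr_ge0 ?powR_ge0 ?normc_ge0.
apply: eq_integral => xi _; rewrite exprMn.
by rewrite -[((_ `^ r) ^+ 2)%R]powR_mulrn ?powR_ge0// -powRrM mulrC [(r * _)%R]mulrC [in RHS]mulrC.
Qed.

Lemma integral_comb3 (b a1 a2 a3 : R) (F1 F2 F3 : 'rV[R]_d -> R) :
  (0 <= b)%R -> (0 <= a1)%R -> (0 <= a2)%R -> (0 <= a3)%R ->
  measurable_fun setT F1 -> measurable_fun setT F2 -> measurable_fun setT F3 ->
  (forall x, 0 <= F1 x)%R -> (forall x, 0 <= F2 x)%R -> (forall x, 0 <= F3 x)%R ->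
  \int[mu]_x (b * (a1 * F1 x + a2 * F2 x + a3 * F3 x))%R%:E =
  b%:E * (a1%:E * \int[mu]_x (F1 x)%:E + a2%:E * \int[mu]_x (F2 x)%:E +
          a3%:E * \int[mu]_x (F3 x)%:E).
Proof.
move=> b0 a10 a20 a30 m1 m2 m3 p1 p2 p3.
have Z (c : R) (F : 'rV[R]_d -> R) : (0 <= c)%R -> measurable_fun setT F -> (forall x, 0 <= F x)%R ->
    \int[mu]_x (c * F x)%R%:E = c%:E * \int[mu]_x (F x)%:E.
  move=> c0 mF F0; under eq_integral do rewrite EFinM.
  by rewrite ge0_integralZl_EFin//; [move=> x _; rewrite lee_fin|exact/measurable_EFinP].
have A (F G : 'rV[R]_d -> R) : measurable_fun setT F -> measurable_fun setT G ->
    (forall x, 0 <= F x)%R -> (forall x, 0 <= G x)%R ->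
    \int[mu]_x (F x + G x)%R%:E = \int[mu]_x (F x)%:E + \int[mu]_x (G x)%:E.
  move=> mF mG F0 G0; under eq_integral do rewrite EFinD.
  by rewrite ge0_integralD//; try (by move=> x _; rewrite lee_fin); exact/measurable_EFinP.
have q1 x : (0 <= a1 * F1 x)%R by rewrite mulr_ge0.
have q2 x : (0 <= a2 * F2 x)%R by rewrite mulr_ge0.
have q3 x : (0 <= a3 * F3 x)%R by rewrite mulr_ge0.
have n1 : measurable_fun setT (fun x => a1 * F1 x)%R by exact: measurable_funM.
have n2 : measurable_fun setT (fun x => a2 * F2 x)%R by exact: measurable_funM.
have n3 : measurable_fun setT (fun x => a3 * F3 x)%R by exact: measurable_funM.
have n12 : measurable_fun setT (fun x => a1 * F1 x + a2 * F2 x)%R by exact: measurable_funD.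
have q12 x : (0 <= a1 * F1 x + a2 * F2 x)%R by rewrite addr_ge0.
rewrite Z//; [|exact: measurable_funD|by move=> x; rewrite addr_ge0].
by rewrite A// A// !Z.
Qed.

Lemma lee_sum3_double (a n c l : \bar R) : 0 <= a -> 0 <= l -> 0 <= c -> n <= 2%:E * l ->
  a + n + c <= 2%:E * (a + l + c).
Proof.
move=> a0 l0 c0 nl.
have le2 (y : \bar R) : 0 <= y -> y <= 2%:E * y.
  by move=> y0; rewrite lee_pemull// lee_fin ler1n.
rewrite ge0_muleDr ?adde_ge0// ge0_muleDr//.
by apply: leeD; [apply: leeD => //|]; exact: le2.
Qed.

(** The exponents are those of the second case of the theorem when
    sigma >= 1/2, and those of the first case when sigma <= 1/2, where the loss
    vanishes. *)
Lemma sobolev_bound (sigma s : R) : (0 < sigma < 1)%R -> (0 <= s)%R ->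
  exists C : R, forall (f g : 'rV[R]_d -> R[i]) (u : R -> 'rV[R]_d -> R[i]),
  schwartz f -> schwartz g -> schwartz_solution sigma f g u -> forall t : R, (0 < t)%R ->
  sobolev_norm s (u t) <= C%:E *
    (((1 + t) `^ loss sigma)%R%:E * sobolev_norm (s + loss sigma) f +
     (t `^ (2 * sigma))%R%:E * L2_norm g +
     (t `^ loss sigma)%R%:E * sobolev_norm (s - 2 * sigma + loss sigma) g).
Proof.
move=> sig s0; set B := band_cst sigma s; set k := loss sigma.
have B0 : (0 <= B)%R.
  by rewrite mulr_ge0 ?addr_ge0 ?powR_ge0// !mulr_ge0 ?expR_ge0.
have C0 : (0 < 2 * B + 1)%R by rewrite ltr_wpDl// mulr_ge0.
exists (2 * B + 1)%R => f g u sf sg su t t0.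
have L0 p (F : 'rV[R]_d -> \bar R) : 0 <= Lnorm mu p F by exact: Lnorm_ge0.
have pw0 (y a : R) : 0 <= (y `^ a)%R%:E by rewrite lee_fin powR_ge0.
have sq (y a : R) : ((y `^ a)%R%:E `^ 2 = (y `^ (2 * a))%R%:E :> \bar R).
  by rewrite poweR_EFin -powRrM mulrC.
have S0 (r : R) (h : 'rV[R]_d -> R[i]) : 0 <= sobolev_norm r h by exact: L0.
have G0 (h : 'rV[R]_d -> R[i]) : 0 <= L2_norm h by exact: L0.
apply: le_sum3_of_sqr => //; try exact: (mule_ge0 (pw0 _ _) (S0 _ _)).
  exact: (mule_ge0 (pw0 _ _) (G0 _)).
rewrite !poweRM// !sq !sobolev_norm_sqr -Lnorm2_sqr; last by move=> x; exact: normc_ge0.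
apply: (le_trans (solution_energy_le sig s0 sf sg su t0)).
rewrite -/B -/k.
have mf := measurable_norm_fourier sf; have mg := measurable_norm_fourier sg.
have I0 (a : R) h : 0 <= \int[mu]_xi (japanese xi `^ a * N h xi ^+ 2)%R%:E.
  by apply: integral_ge0 => xi _; rewrite lee_fin mulr_ge0 ?powR_ge0// sqr_ge0.
have mJ (a : R) h : schwartz h ->
    measurable_fun setT (fun xi : 'rV[R]_d => (japanese xi `^ a * N h xi ^+ 2)%R%:E).
  move=> sh; apply/measurable_EFinP; apply: measurable_funM; first exact: measurable_japanese_powR.
  exact: measurable_norm_fourier.
rewrite (_ : \int[mu]_xi _ =
  B%:E * (((1 + t) `^ (2 * k))%R%:E * \int[mu]_xi (japanese xi `^ (2 * (s + k)) * N f xi ^+ 2)%R%:E +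
   (t `^ (2 * (2 * sigma)))%R%:E * \int[mu]_xi (N g xi ^+ 2)%R%:E +
   (t `^ (2 * k))%R%:E * \int[mu]_xi (japanese xi `^ (2 * (s - 2 * sigma + k)) * N g xi ^+ 2)%R%:E));
  last first.
  rewrite -integral_comb3 ?powR_ge0//.
  - apply: eq_integral => xi _; congr (_ * _)%R%:E.
    rewrite -powR_pos_add// (_ : 2 * k + (4 * sigma - 2 * k) = 2 * (2 * sigma))%R; last by ring.
    rewrite (_ : 2 * s + 2 * k = 2 * (s + k))%R; last by ring.
    rewrite (_ : 2 * s - (4 * sigma - 2 * k) = 2 * (s - 2 * sigma + k))%R; last by ring.
    by ring.
  - by apply/measurable_EFinP; exact: mJ.
  - by apply/measurable_EFinP; exact: mJ.
  - by move=> xi; rewrite mulr_ge0 ?powR_ge0 ?sqr_ge0.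
  - by move=> xi; rewrite sqr_ge0.
  - by move=> xi; rewrite mulr_ge0 ?powR_ge0 ?sqr_ge0.
have L20 : 0 <= \int[mu]_x (Normc.normc (g x) ^+ 2)%R%:E.
  by apply: integral_ge0 => x _; rewrite lee_fin sqr_ge0.
apply: (@le_trans _ _ ((2 * B)%R%:E *
  (((1 + t) `^ (2 * k))%R%:E * \int[mu]_xi (japanese xi `^ (2 * (s + k)) * N f xi ^+ 2)%R%:E +
   (t `^ (2 * (2 * sigma)))%R%:E * \int[mu]_x (Normc.normc (g x) ^+ 2)%R%:E +
   (t `^ (2 * k))%R%:E * \int[mu]_xi (japanese xi `^ (2 * (s - 2 * sigma + k)) * N g xi ^+ 2)%R%:E))).
  rewrite (_ : (2 * B)%R%:E = B%:E * 2%:E); last by rewrite -EFinM mulrC.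
  rewrite -[X in _ <= X]muleA; apply: lee_wpmul2l; first by rewrite lee_fin.
  apply: (lee_sum3_double (mule_ge0 (pw0 _ _) (I0 _ _)) (mule_ge0 (pw0 _ _) L20)
    (mule_ge0 (pw0 _ _) (I0 _ _))).
  rewrite [X in _ <= X]muleCA; apply: lee_wpmul2l; first exact: pw0.
  exact: (fourier_L2_le (schwartz_integC sg)).
apply: lee_wpmul2r.
  by apply: adde_ge0; [apply: adde_ge0|]; [exact: (mule_ge0 (pw0 _ _) (I0 _ _))|
    exact: (mule_ge0 (pw0 _ _) L20)|exact: (mule_ge0 (pw0 _ _) (I0 _ _))].
by rewrite lee_fin; nra.
Qed.

End total.

Theorem theorem6 (R : realType) (d : nat) (sigma s : R) :
  (0 < d)%N -> 0 < sigma < 1 -> 0 <= s ->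
  exists C : R,
  forall (f g : 'rV[R]_d -> R[i]) (u : R -> 'rV[R]_d -> R[i]),
    schwartz f -> schwartz g ->
    fourier_vanishes_near0 f -> fourier_vanishes_near0 g ->
    schwartz_solution sigma f g u ->
  forall t : R, 0 < t ->
    (sigma <= 2^-1 ->
      (sobolev_norm s (u t) <=
       C%:E * (sobolev_norm s f + (t `^ (2 * sigma))%:E * L2_norm g
               + sobolev_norm (s - 2 * sigma) g))%E) /\
    (2^-1 <= sigma ->
      (sobolev_norm s (u t) <=
       C%:E * (((1 + t) `^ (sigma - 2^-1))%:E
                 * sobolev_norm (s + sigma - 2^-1) f
               + (t `^ (2 * sigma))%:E * L2_norm g
               + (t `^ (sigma - 2^-1))%:E
                 * sobolev_norm (s - sigma - 2^-1) g))%E).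
Proof.
move=> _ sig s0; have [C HC] := @sobolev_bound R d sigma s sig s0.
exists C => f g u sf sg _ _ su t t0; have := HC f g u sf sg su t t0.
rewrite /loss; split=> h.
  move: H; rewrite max_l; last by lra.
  by rewrite !addr0 !powRr0 !mul1e.
move: H; rewrite max_r; last by lra.
have -> : s + (sigma - 2^-1) = s + sigma - 2^-1 by ring.
by have -> : s - 2 * sigma + (sigma - 2^-1) = s - sigma - 2^-1 by ring.
Qed.
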